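(* Let $\Lambda$ be a non-singular weighted surface algebra over $K$ (with triangulation quiver having at least three vertices) whose Gabriel quiver is bipartite, and suppose that $\Lambda$ is not isomorphic to a triangle algebra $T(\lambda)$ or a spherical algebra $S(\lambda)$ for any $\lambda\in K\setminus\{0,1\}$. Let $M$ be the right $\Lambda$-module $$M=\Lambda\oplus\Big[\bigoplus_{i\in\Gamma}S_i\Big]\oplus\Big[\bigoplus_{\nu\in Q_0\setminus\Gamma}\Omega^2(S_\nu)\Big],$$ where $\Gamma\subset Q_0$ is the set of vertices not adjacent to a virtual arrow. Then $M$ is not a 3-cluster tilting module.
   Context: $K$ is an algebraically closed field of arbitrary characteristic. Modules are finite-dimensional right modules; paths are composed left to right; $S_i$ is the simple module at vertex $i$ and $\Omega$ is the syzygy operator (kernel of a projective cover). A module $M$ is 3-cluster tilting if $$\mathrm{add}(M)=\{N\mid \mathrm{Ext}^i(M,N)=0,\ i=1,2\}=\{N\mid\mathrm{Ext}^i(N,M)=0,\ i=1,2\}.$$ Weighted surface algebras. A quiver $Q$ is 2-regular if at each vertex exactly two arrows start and exactly two arrows end; for an arrow $\alpha$, $\bar\alpha$ denotes the other arrow with the same source. A triangulation quiver $(Q,f)$ is a finite connected 2-regular quiver $Q$ with a permutation $f$ of its arrows such that $t(\alpha)=s(f(\alpha))$ for all $\alpha$ and $f^3=\mathrm{id}$. Put $g(\alpha)=\overline{f(\alpha)}$. Fix weights $m_\alpha\in\{1,2,\dots\}$ and parameters $c_\alpha\in K^*$, both constant on $g$-cycles; $n_\alpha$ is the length of the $g$-cycle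 of $\alpha$, and $A_\alpha=\alpha g(\alpha)\cdots g^{m_\alpha n_\alpha-2}(\alpha)$ is the path of length $m_\alpha n_\alpha-1$ along the $g$-cycle. An arrow $\alpha$ is virtual if $m_\alpha n_\alpha=2$. It is assumed that $m_\alpha n_\alpha\ge2$ for all $\alpha$; that $m_\alpha n_\alpha\ge3$ whenever $\bar\alpha$ is virtual and not a loop; that $m_\alpha n_\alpha\ge4$ whenever $\bar\alpha$ is a virtual loop; and that $|Q_0|\ge3$. The weighted surface algebra is $\Lambda=KQ/I$, with $I$ generated by: (1) $\alpha f(\alpha)-c_{\bar\alpha}A_{\bar\alpha}$ for all arrows $\alpha$; (2) $\alpha f(\alpha)g(f(\alpha))$ for all arrows $\alpha$, unless $f^2(\alpha)$ is virtual, or unless $f(\bar\alpha)$ is virtual and $m_{\bar\alpha}=1$, $n_{\bar\alpha}=3$; (3) $\alpha g(\alpha)f(g(\alpha))$ for all arrows $\alpha$, unless $f(\alpha)$ is virtual, or unless $f^2(\alpha)$ is virtual and $m_{f(\alpha)}=1$, $n_{f(\alpha)}=3$. The Gabriel quiver of $\Lambda$ is obtained from $Q$ by removing all virtual arrows. It is bipartite if its vertex set is a disjoint union of two subsets such that every arrow joins vertices in different subsets. A vertex is adjacent to an arrow if it is its source or target. The triangle algebra $T(\lambda)$ is the path algebra of the quiver with vertices $1,2,3$ and arrows $\alpha:1\to2$, $\beta:2\to1$, $\gamma:2\to3$, $\delta:3\to2$, modulo the relations $\alpha\beta\alpha=\alpha\gamma\delta$, $\delta\beta\alpha=\lambda\delta\gamma\delta$,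 $\beta\alpha\beta=\gamma\delta\beta$, $\beta\alpha\gamma=\lambda\gamma\delta\gamma$, $\alpha\beta\alpha\gamma=0$, $\beta\alpha\beta\alpha\beta=0$, $\delta\gamma\delta\beta=0$, $\gamma\delta\gamma\delta\gamma=0$, $\alpha\beta\alpha\beta\alpha=0$, $\delta\gamma\delta\gamma\delta=0$, $\delta\beta\alpha\beta=0$. The spherical algebra $S(\lambda)$ is the path algebra of the quiver with vertices $1,\dots,6$ and arrows $\alpha:1\to2$, $\beta:2\to3$, $\nu:3\to5$, $\delta:5\to1$, $\varrho:1\to6$, $\omega:6\to3$, $\gamma:3\to4$, $\sigma:4\to1$, modulo the relations $\alpha\beta\nu=\varrho\omega\nu$, $\beta\nu\delta=\lambda\beta\gamma\sigma$, $\nu\delta\alpha=\lambda\gamma\sigma\alpha$, $\delta\alpha\beta=\delta\varrho\omega$, $\gamma\sigma\varrho=\nu\delta\varrho$, $\sigma\varrho\omega=\lambda\sigma\alpha\beta$, $\varrho\omega\gamma=\lambda\alpha\beta\gamma$, $\omega\gamma\sigma=\omega\nu\delta$, and the following paths are zero: $\alpha\beta\nu\delta\alpha$, $\beta\nu\delta\varrho$, $\nu\delta\alpha\beta\nu$, $\delta\alpha\beta\gamma$, $\gamma\sigma\varrho\omega\gamma$, $\sigma\varrho\omega\nu$, $\varrho\omega\gamma\sigma\varrho$, $\omega\gamma\sigma\alpha$, $\beta\gamma\sigma\varrho$, $\sigma\alpha\beta\nu$, $\delta\varrho\omega\gamma$, $\omega\nu\delta\alpha$, $\beta\nu\delta\alpha\beta$,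 $\delta\alpha\beta\nu\delta$, $\sigma\varrho\omega\gamma\sigma$, $\omega\gamma\sigma\varrho\omega$. For algebras with bipartite Gabriel quiver, non-singular means that $\Lambda$ is not isomorphic to the weighted surface algebras given by these presentations with $\lambda=1$ (the singular triangle algebra and the singular spherical algebra). *)

(* Defs.v *)
From HB Require Import structures.
From mathcomp Require Import all_boot all_fingroup all_algebra.
From mathcomp Require Import finmap generic_quotient boolp.
From mathcomp.multinomials Require Import monalg.

Set Implicit Arguments.
Unset Strict Implicit.
Unset Printing Implicit Defensive.

Import GRing.Theory.
Local Open Scope ring_scope.

Definition alg_iso (K : fieldType) (A B : algType K) : Prop :=
  exists phi : {lrmorphism A -> B}, bijective phi.

Section Ideal.
Variables (K : fieldType) (A : algType K).

Definition two_sided_ideal (J : A -> Prop) : Prop :=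
  [/\ J 0, forall x y, J x -> J y -> J (x + y)
    & forall a x b, J x -> J (a * x * b)].

Definition ideal_gen (R : A -> Prop) (x : A) : Prop :=
  forall J : A -> Prop, two_sided_ideal J -> (forall r, R r -> J r) -> J x.

(* [algType K] requires 1 != 0, hence the properness condition. *)
Record relations := Relations {
  relset :> A -> Prop;
  relset_proper : ~ ideal_gen relset 1
}.

End Ideal.

Section IdealQuotient.
Variables (K : fieldType) (A : algType K).

Section IdealTheory.
Variable R : A -> Prop.
Local Notation I := (ideal_gen R).

Fact ideal_gen0 : I 0.
Proof. by move=> J [J0 _ _] _. Qed.

Fact ideal_genD x y : I x -> I y -> I (x + y).
Proof.
by move=> Ix Iy J HJ JR; case: (HJ) => _ JD _; apply: JD; [apply: Ix|apply: Iy].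
Qed.

Fact ideal_genM a x b : I x -> I (a * x * b).
Proof. by move=> Ix J HJ JR; case: (HJ) => _ _ JM; apply: JM; apply: Ix. Qed.

Fact ideal_genMl a x : I x -> I (a * x).
Proof. by move=> /(ideal_genM a 1); rewrite mulr1. Qed.

Fact ideal_genMr x b : I x -> I (x * b).
Proof. by move=> /(ideal_genM 1 b); rewrite mul1r. Qed.

Fact ideal_genZ k x : I x -> I (k *: x).
Proof. by rewrite -[in k *: x](mul1r x) scalerAl; exact: ideal_genMl. Qed.

Fact ideal_genN x : I x -> I (- x).
Proof. by rewrite -scaleN1r; exact: ideal_genZ. Qed.

End IdealTheory.

Variable R : relations A.
Local Notation I := (ideal_gen R).

Definition ideal_rel (x y : A) : bool := `[< I (x - y) >].

Fact ideal_rel_refl : reflexive ideal_rel.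
Proof. by move=> x; apply/asboolP; rewrite subrr; exact: ideal_gen0. Qed.

Fact ideal_rel_sym : symmetric ideal_rel.
Proof.
by move=> x y; apply/asboolP/asboolP => /ideal_genN; rewrite opprB.
Qed.

Fact ideal_rel_trans : transitive ideal_rel.
Proof.
move=> y x z /asboolP Ixy /asboolP Iyz; apply/asboolP.
by have := ideal_genD Ixy Iyz; rewrite addrA subrK.
Qed.

Canonical ideal_equiv :=
  EquivRel ideal_rel ideal_rel_refl ideal_rel_sym ideal_rel_trans.

Definition alg_quot : Type := {eq_quot ideal_equiv}%qT.

HB.instance Definition _ := Choice.on alg_quot.
HB.instance Definition _ := EqQuotient.on alg_quot.

Definition quot_repr (u : alg_quot) : A := repr u.

End IdealQuotient.

(* The projection and the operations are locked to keep unification from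
   unfolding them down to coefficients. *)
HB.lock Definition quot_pi (K : fieldType) (A : algType K) (R : relations A)
  (x : A) : alg_quot R := (\pi_(alg_quot R) x)%qT.
HB.lock Definition quot_add (K : fieldType) (A : algType K) (R : relations A)
  (u v : alg_quot R) : alg_quot R := quot_pi R (quot_repr u + quot_repr v).
HB.lock Definition quot_opp (K : fieldType) (A : algType K) (R : relations A)
  (u : alg_quot R) : alg_quot R := quot_pi R (- quot_repr u).
HB.lock Definition quot_mul (K : fieldType) (A : algType K) (R : relations A)
  (u v : alg_quot R) : alg_quot R := quot_pi R (quot_repr u * quot_repr v).
HB.lock Definition quot_scale (K : fieldType) (A : algType K) (R : relations A)
  (k : K) (u : alg_quot R) : alg_quot R := quot_pi R (k *: quot_repr u).

Arguments quot_pi {K A} R x.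
Arguments quot_add {K A R} u v.
Arguments quot_opp {K A R} u.
Arguments quot_mul {K A R} u v.
Arguments quot_scale {K A R} k u.

Section QuotientAlgebra.
Variables (K : fieldType) (A : algType K) (R : relations A).
Local Notation I := (ideal_gen R).
Local Notation alg_quot := (alg_quot R).
Local Notation quot_pi := (quot_pi R).
Local Notation quot_add := (@quot_add K A R).
Local Notation quot_opp := (@quot_opp K A R).
Local Notation quot_mul := (@quot_mul K A R).
Local Notation quot_scale := (@quot_scale K A R).

Fact quot_reprK : cancel (@quot_repr K A R) quot_pi.
Proof. by move=> u; rewrite quot_pi.unlock /quot_repr reprK. Qed.

Fact quot_pi_eqP (x y : A) : quot_pi x = quot_pi y <-> I (x - y).
Proof.
rewrite quot_pi.unlock; split=> [/eqP|Ixy].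
  by rewrite eqmodE => /asboolP.
by apply/eqP; rewrite eqmodE; apply/asboolP.
Qed.

Fact quot_repr_pi (x : A) : I (quot_repr (quot_pi x) - x).
Proof. by apply/quot_pi_eqP; rewrite quot_reprK. Qed.

Fact quot_addE x y : quot_add (quot_pi x) (quot_pi y) = quot_pi (x + y).
Proof.
rewrite quot_add.unlock; apply/quot_pi_eqP; rewrite opprD addrACA.
by apply: ideal_genD; exact: quot_repr_pi.
Qed.

Fact quot_oppE x : quot_opp (quot_pi x) = quot_pi (- x).
Proof.
rewrite quot_opp.unlock; apply/quot_pi_eqP.
by rewrite -opprD; apply: ideal_genN; exact: quot_repr_pi.
Qed.

Fact quot_mulE x y : quot_mul (quot_pi x) (quot_pi y) = quot_pi (x * y).
Proof.
rewrite quot_mul.unlock; apply/quot_pi_eqP; set x' := quot_repr _; set y' := quot_repr _.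
have -> : x' * y' - x * y = (x' - x) * y' + x * (y' - y).
  by rewrite mulrBl mulrBr addrA subrK.
by apply: ideal_genD; [apply: ideal_genMr|apply: ideal_genMl];
  exact: quot_repr_pi.
Qed.

Fact quot_scaleE k x : quot_scale k (quot_pi x) = quot_pi (k *: x).
Proof.
rewrite quot_scale.unlock; apply/quot_pi_eqP.
by rewrite -scalerBr; apply: ideal_genZ; exact: quot_repr_pi.
Qed.

Let quot_ind (P : alg_quot -> Prop) : (forall x, P (quot_pi x)) -> forall u, P u.
Proof. by move=> H u; rewrite -(quot_reprK u). Qed.

Fact quot_addA : associative quot_add.
Proof.
by do 3![elim/quot_ind => ?]; rewrite !quot_addE addrA.
Qed.
Fact quot_addC : commutative quot_add.
Proof. by do 2![elim/quot_ind => ?]; rewrite !quot_addE addrC. Qed.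
Fact quot_add0 : left_id (quot_pi 0) quot_add.
Proof. by elim/quot_ind => ?; rewrite !quot_addE add0r. Qed.
Fact quot_addN : left_inverse (quot_pi 0) quot_opp quot_add.
Proof. by elim/quot_ind => ?; rewrite quot_oppE quot_addE addNr. Qed.

HB.instance Definition _ :=
  GRing.isZmodule.Build alg_quot quot_addA quot_addC quot_add0 quot_addN.

Fact quot_mulA : associative quot_mul.
Proof. by do 3![elim/quot_ind => ?]; rewrite !quot_mulE mulrA. Qed.
Fact quot_mul1l : left_id (quot_pi 1) quot_mul.
Proof. by elim/quot_ind => ?; rewrite quot_mulE mul1r. Qed.
Fact quot_mul1r : right_id (quot_pi 1) quot_mul.
Proof. by elim/quot_ind => ?; rewrite quot_mulE mulr1. Qed.
Fact quot_mulDl : left_distributive quot_mul quot_add.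
Proof.
by do 3![elim/quot_ind => ?]; rewrite !(quot_addE, quot_mulE) mulrDl.
Qed.
Fact quot_mulDr : right_distributive quot_mul quot_add.
Proof.
by do 3![elim/quot_ind => ?]; rewrite !(quot_addE, quot_mulE) mulrDr.
Qed.

Fact quot_oner_neq0 : quot_pi 1 != quot_pi 0.
Proof.
by apply/eqP => /quot_pi_eqP; rewrite subr0; exact: relset_proper.
Qed.

HB.instance Definition _ := GRing.Zmodule_isNzRing.Build alg_quot
  quot_mulA quot_mul1l quot_mul1r quot_mulDl quot_mulDr quot_oner_neq0.

Fact quot_scaleA k l u : quot_scale k (quot_scale l u) = quot_scale (k * l) u.
Proof. by elim/quot_ind: u => ?; rewrite !quot_scaleE scalerA. Qed.
Fact quot_scale1 : left_id 1 quot_scale.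
Proof. by elim/quot_ind => ?; rewrite quot_scaleE scale1r. Qed.
Fact quot_scaleDr : right_distributive quot_scale +%R.
Proof.
move=> k; do 2![elim/quot_ind => ?].
rewrite -[LHS]/(quot_scale k (quot_add _ _)).
rewrite -[RHS]/(quot_add (quot_scale k _) (quot_scale k _)).
by rewrite !(quot_addE, quot_scaleE) scalerDr.
Qed.
Fact quot_scaleDl u : {morph quot_scale^~ u : k l / k + l}.
Proof.
move=> k l; elim/quot_ind: u => ?.
rewrite -[RHS]/(quot_add (quot_scale k _) (quot_scale l _)).
by rewrite !(quot_scaleE, quot_addE) scalerDl.
Qed.

HB.instance Definition _ := GRing.Zmodule_isLmodule.Build K alg_quot
  quot_scaleA quot_scale1 quot_scaleDr quot_scaleDl.

Fact quot_scalerAl k (u v : alg_quot) : k *: (u * v) = (k *: u) * v.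
Proof.
elim/quot_ind: u => x; elim/quot_ind: v => y.
rewrite -[LHS]/(quot_scale k (quot_mul _ _)).
rewrite -[RHS]/(quot_mul (quot_scale k _) _).
by rewrite !(quot_scaleE, quot_mulE) scalerAl.
Qed.
Fact quot_scalerAr k (u v : alg_quot) : k *: (u * v) = u * (k *: v).
Proof.
elim/quot_ind: u => x; elim/quot_ind: v => y.
rewrite -[LHS]/(quot_scale k (quot_mul _ _)).
rewrite -[RHS]/(quot_mul _ (quot_scale k _)).
by rewrite !(quot_scaleE, quot_mulE) scalerAr.
Qed.

HB.instance Definition _ :=
  GRing.Lmodule_isLalgebra.Build K alg_quot quot_scalerAl.
HB.instance Definition _ :=
  GRing.Lalgebra_isAlgebra.Build K alg_quot quot_scalerAr.

End QuotientAlgebra.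

Section QuotPi.
Variables (K : fieldType) (A : algType K) (R : relations A).

Fact quot_pi_is_zmod_morphism : zmod_morphism (quot_pi R).
Proof.
by move=> x y; rewrite -quot_addE -quot_oppE.
Qed.
Fact quot_pi_is_monoid_morphism : monoid_morphism (quot_pi R).
Proof. by split=> // x y; rewrite -quot_mulE. Qed.
Fact quot_pi_is_scalable : scalable (quot_pi R).
Proof. by move=> k x; rewrite -quot_scaleE. Qed.

HB.instance Definition _ := GRing.isZmodMorphism.Build A (alg_quot R)
  (quot_pi R) quot_pi_is_zmod_morphism.
HB.instance Definition _ := GRing.isMonoidMorphism.Build A (alg_quot R)
  (quot_pi R) quot_pi_is_monoid_morphism.
HB.instance Definition _ := GRing.isScalable.Build K A (alg_quot R) *:%R
  (quot_pi R) quot_pi_is_scalable.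
End QuotPi.

Record quiver := Quiver {
  vert : finType;
  arr : finType;
  src : arr -> vert;
  tgt : arr -> vert;
  vert_inhabited : (0 < #|vert|)%N
}.

Section Paths.
Variable Q : quiver.

(* A path is its source together with its sequence of arrows, composed left
   to right; (v, [::]) is the trivial path at v. *)
Fixpoint composable (v : vert Q) (s : seq (arr Q)) : bool :=
  if s is a :: s' then (src a == v) && composable (tgt a) s' else true.

Record qpath := QPath {
  qpval : vert Q * seq (arr Q);
  qpvalP : composable qpval.1 qpval.2
}.

HB.instance Definition _ := [isSub for qpval].
HB.instance Definition _ := [Choice of qpath by <:].

Definition qsrc (p : qpath) : vert Q := (val p).1.
Definition qarrs (p : qpath) : seq (arr Q) := (val p).2.
Definition qtgt (p : qpath) : vert Q := last (qsrc p) (map (@tgt Q) (qarrs p)).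

Definition qtriv (v : vert Q) : qpath := @QPath (v, [::]) isT.

Fact composable1 (a : arr Q) : composable (src a) [:: a].
Proof. by rewrite /= eqxx. Qed.
Definition qarr (a : arr Q) : qpath := @QPath (src a, [:: a]) (composable1 a).

Definition qcat (p q : qpath) : option qpath :=
  if qtgt p == qsrc q then insub (qsrc p, qarrs p ++ qarrs q) else None.

Fact composable_cat v s t : composable v (s ++ t) =
  composable v s && composable (last v (map (@tgt Q) s)) t.
Proof. by elim: s v => //= a s IHs v; rewrite IHs andbA. Qed.

Fact qcat_some p q : qtgt p = qsrc q ->
  exists2 r, qcat p q = Some r & val r = (qsrc p, qarrs p ++ qarrs q).
Proof.
move=> E; rewrite /qcat E eqxx.
have C : composable (qsrc p) (qarrs p ++ qarrs q).
  by rewrite composable_cat (valP p) -/(qtgt p) E (valP q).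
by exists (@QPath (_, _) C); rewrite ?insubT.
Qed.

Fact qcat_none p q : qtgt p <> qsrc q -> qcat p q = None.
Proof. by rewrite /qcat; case: eqP. Qed.

Fact qcatP p q r : qcat p q = Some r ->
  qtgt p = qsrc q /\ val r = (qsrc p, qarrs p ++ qarrs q).
Proof.
have [E|/eqP/qcat_none-> //] := eqVneq (qtgt p) (qsrc q).
by have [r' -> <-] := qcat_some E; case=> <-.
Qed.

Fact qsrc_cat p q r : qcat p q = Some r -> qsrc r = qsrc p.
Proof. by move/qcatP => [_ E]; rewrite /qsrc E. Qed.

Fact qtgt_cat p q r : qcat p q = Some r -> qtgt r = qtgt q.
Proof.
move/qcatP => [E F]; rewrite /qtgt /qsrc /qarrs F /= map_cat last_cat.
by rewrite -/(qtgt p) E.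
Qed.

Fact qcatA p q r :
  obind (qcat^~ r) (qcat p q) = obind (qcat p) (qcat q r).
Proof.
case Epq: (qcat p q) => [pq|]; case Eqr: (qcat q r) => [qr|] //=.
- have [Tpq Vpq] := qcatP Epq; have [Tqr Vqr] := qcatP Eqr.
  have [|x -> Vx] := @qcat_some pq r; first by rewrite (qtgt_cat Epq).
  have [|y -> Vy] := @qcat_some p qr; first by rewrite (qsrc_cat Eqr).
  congr Some; apply: val_inj.
  by rewrite Vx Vy /qsrc /qarrs Vpq Vqr /= catA.
- apply: qcat_none; rewrite (qtgt_cat Epq) => /qcat_some[s].
  by rewrite Eqr.
- symmetry; apply: qcat_none; rewrite (qsrc_cat Eqr) => /qcat_some[s].
  by rewrite Epq.
Qed.

Fact qcat1p p : qcat (qtriv (qsrc p)) p = Some p.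
Proof.
have [|r -> V] := @qcat_some (qtriv (qsrc p)) p; first by [].
by congr Some; apply: val_inj; rewrite V; case: p {r V} => -[].
Qed.

Fact qcatp1 p : qcat p (qtriv (qtgt p)) = Some p.
Proof.
have [|r -> V] := @qcat_some p (qtriv (qtgt p)); first by [].
by congr Some; apply: val_inj; rewrite V cats0; case: p {r V} => -[].
Qed.

End Paths.

Arguments qpath : clear implicits.
Arguments qtriv {Q} v.

(* The operations are locked to keep unification from unfolding finitely
   supported functions. *)
Definition pathalg (Q : quiver) (K : fieldType) : Type := {malg K[qpath Q]}.
HB.instance Definition _ Q K := Choice.on (pathalg Q K).

HB.lock Definition pa_zero (Q : quiver) (K : fieldType) : pathalg Q K :=
  (0 : {malg K[qpath Q]}).
HB.lock Definition pa_add (Q : quiver) (K : fieldType) (x y : pathalg Q K) :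
  pathalg Q K := ((x : {malg K[qpath Q]}) + (y : {malg K[qpath Q]})).
HB.lock Definition pa_opp (Q : quiver) (K : fieldType) (x : pathalg Q K) :
  pathalg Q K := - (x : {malg K[qpath Q]}).
HB.lock Definition pa_scale (Q : quiver) (K : fieldType) (k : K)
  (x : pathalg Q K) : pathalg Q K := k *: (x : {malg K[qpath Q]}).
HB.lock Definition pa_path (Q : quiver) (K : fieldType) (p : qpath Q) :
  pathalg Q K := (<< p >> : {malg K[qpath Q]}).
HB.lock Definition pa_coef (Q : quiver) (K : fieldType) (p : qpath Q)
  (x : pathalg Q K) : K := (x : {malg K[qpath Q]})@_p.
HB.lock Definition pa_supp (Q : quiver) (K : fieldType) (x : pathalg Q K) :
  {fset qpath Q} := msupp (x : {malg K[qpath Q]}).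

Arguments pa_path {Q} K p.
Arguments pa_coef {Q K} p x.
Arguments pa_supp {Q K} x.

Section PathModule.
Variables (Q : quiver) (K : fieldType).
Local Notation zero := (pa_zero Q K).
Local Notation add := (@pa_add Q K).
Local Notation opp := (@pa_opp Q K).
Local Notation scale := (@pa_scale Q K).

Fact pa_addA : associative add.
Proof. by move=> x y z; rewrite pa_add.unlock; exact: addrA. Qed.
Fact pa_addC : commutative add.
Proof. by move=> x y; rewrite pa_add.unlock; exact: addrC. Qed.
Fact pa_add0 : left_id zero add.
Proof. by move=> x; rewrite pa_add.unlock pa_zero.unlock; exact: add0r. Qed.
Fact pa_addN : left_inverse zero opp add.
Proof.
by move=> x; rewrite pa_add.unlock pa_opp.unlock pa_zero.unlock; exact: addNr.
Qed.
HB.instance Definition _ :=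
  GRing.isZmodule.Build (pathalg Q K) pa_addA pa_addC pa_add0 pa_addN.

Fact pa_scaleA k l x : scale k (scale l x) = scale (k * l) x.
Proof. by rewrite pa_scale.unlock; exact: scalerA. Qed.
Fact pa_scale1 : left_id 1 scale.
Proof. by move=> x; rewrite pa_scale.unlock; exact: scale1r. Qed.
Fact pa_scaleDr : right_distributive scale add.
Proof.
by move=> k x y; rewrite pa_scale.unlock pa_add.unlock; exact: scalerDr.
Qed.
Fact pa_scaleDl x k l : scale (k + l) x = add (scale k x) (scale l x).
Proof. by rewrite pa_scale.unlock pa_add.unlock; exact: scalerDl. Qed.
HB.instance Definition _ := GRing.Zmodule_isLmodule.Build K (pathalg Q K)
  pa_scaleA pa_scale1 pa_scaleDr pa_scaleDl.

Implicit Types x y : pathalg Q K.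

Fact pa_coef0 p : pa_coef p (0 : pathalg Q K) = 0.
Proof. by rewrite -[0]/zero pa_coef.unlock pa_zero.unlock; exact: mcoeff0. Qed.
Fact pa_coefD p x y : pa_coef p (x + y) = pa_coef p x + pa_coef p y.
Proof.
by rewrite -[x + y]/(add x y) pa_coef.unlock pa_add.unlock; exact: mcoeffD.
Qed.
Fact pa_coefZ p k x : pa_coef p (k *: x) = k * pa_coef p x.
Proof.
by rewrite -[k *: x]/(scale k x) pa_coef.unlock pa_scale.unlock; exact: mcoeffZ.
Qed.
Fact pa_coefB p x y : pa_coef p (x - y) = pa_coef p x - pa_coef p y.
Proof. by rewrite -scaleN1r pa_coefD pa_coefZ mulN1r. Qed.
Fact pa_coef_path (p q : qpath Q) : pa_coef p (pa_path K q) = (q == p)%:R.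
Proof. by rewrite pa_coef.unlock pa_path.unlock; exact: mcoeffU. Qed.

Fact pa_coef_sum (I : Type) (s : seq I) (F : I -> pathalg Q K) p :
  pa_coef p (\sum_(i <- s) F i) = \sum_(i <- s) pa_coef p (F i).
Proof. exact: (big_morph (pa_coef p) (pa_coefD p) (pa_coef0 p)). Qed.

Fact pa_coefP x y : (forall p, pa_coef p x = pa_coef p y) -> x = y.
Proof. by rewrite pa_coef.unlock => E; apply/malgP. Qed.

Fact pa_suppP x p : (p \in pa_supp x) = (pa_coef p x != 0).
Proof. by rewrite pa_coef.unlock pa_supp.unlock; exact/esym/mcoeff_neq0. Qed.

Fact pa_coef_out x p : p \notin pa_supp x -> pa_coef p x = 0.
Proof. by rewrite pa_suppP negbK => /eqP. Qed.

Fact pa_supp0 : pa_supp (0 : pathalg Q K) = fset0.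
Proof. by apply/fsetP => p; rewrite pa_suppP pa_coef0 eqxx in_fset0. Qed.

Fact pa_suppD x y : (pa_supp (x + y)%R `<=` pa_supp x `|` pa_supp y)%fset.
Proof.
apply/fsubsetP => p; rewrite in_fsetU !pa_suppP pa_coefD.
by apply: contraNT; rewrite negb_or !negbK => /andP[/eqP-> /eqP->]; rewrite addr0.
Qed.

Fact pa_suppZ k x : (pa_supp (k *: x)%R `<=` pa_supp x)%fset.
Proof.
apply/fsubsetP => p; rewrite !pa_suppP pa_coefZ.
by apply: contraNN => /eqP->; rewrite mulr0.
Qed.

Fact pa_supp_path (p : qpath Q) : (pa_supp (pa_path K p) `<=` [fset p])%fset.
Proof.
apply/fsubsetP => q; rewrite pa_suppP pa_coef_path in_fset1 [q == p]eq_sym.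
by case: (p == q); rewrite //= eqxx.
Qed.

Fact pa_expand x : x = \sum_(p <- pa_supp x) pa_coef p x *: pa_path K p.
Proof.
apply: pa_coefP => q; rewrite pa_coef_sum.
have [qx|qx] := boolP (q \in pa_supp x); last first.
  rewrite (pa_coef_out qx) big_seq big1 // => p px.
  rewrite pa_coefZ pa_coef_path; case: eqP => [E|_]; last by rewrite mulr0.
  by rewrite -E px in qx.
rewrite (big_fsetD1 q) //= pa_coefZ pa_coef_path eqxx mulr1.
rewrite big_seq big1 ?addr0 // => p; rewrite in_fsetD1 => /andP[ne _].
by rewrite pa_coefZ pa_coef_path (negbTE ne) mulr0.
Qed.

Fact pa_ind (P : pathalg Q K -> Prop) : P 0 ->
  (forall k p, P (k *: pa_path K p)) ->
  (forall x y, P x -> P y -> P (x + y)) -> forall x, P x.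
Proof.
move=> P0 PZ PD x; rewrite (pa_expand x).
by elim/big_ind: _ => //.
Qed.

End PathModule.

Definition pa_idem (Q : quiver) (K : fieldType) (v : vert Q) : pathalg Q K :=
  pa_path K (qtriv v).
Definition pa_arr (Q : quiver) (K : fieldType) (a : arr Q) : pathalg Q K :=
  pa_path K (qarr a).
Arguments pa_idem {Q} K v.
Arguments pa_arr {Q} K a.

Definition pa_cat (Q : quiver) (K : fieldType) (p q : qpath Q) : pathalg Q K :=
  if qcat p q is Some r then pa_path K r else 0.
Arguments pa_cat {Q} K p q.

HB.lock Definition pa_mul (Q : quiver) (K : fieldType) (x y : pathalg Q K) :
  pathalg Q K :=
  \sum_(p <- pa_supp x) \sum_(q <- pa_supp y)
    (pa_coef p x * pa_coef q y) *: pa_cat K p q.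
HB.lock Definition pa_one (Q : quiver) (K : fieldType) : pathalg Q K :=
  \sum_(v : vert Q) pa_idem K v.

Section PathAlgebra.
Variables (Q : quiver) (K : fieldType).
Local Notation qpath := (qpath Q).
Local Notation pathalg := (pathalg Q K).
Local Notation pa_path := (@pa_path Q K).
Local Notation pa_idem := (@pa_idem Q K).
Local Notation pa_arr := (@pa_arr Q K).
Local Notation pa_cat := (@pa_cat Q K).
Local Notation pa_mul := (@pa_mul Q K).
Local Notation pa_one := (pa_one Q K).
Implicit Types x y z : pathalg.

Fact pa_mulw (d e : {fset qpath}) x y :
  (pa_supp x `<=` d)%fset -> (pa_supp y `<=` e)%fset ->
  pa_mul x y =
    \sum_(p <- d) \sum_(q <- e) (pa_coef p x * pa_coef q y) *: pa_cat p q.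
Proof.
move=> sd se; rewrite pa_mul.unlock (big_fset_incl _ sd) /=.
  apply/eq_bigr=> p _; apply/big_fset_incl => // q _ /pa_coef_out ->.
  by rewrite mulr0 scale0r.
move=> p _ /pa_coef_out xp.
by rewrite big1 => // q _; rewrite xp mul0r scale0r.
Qed.

Fact pa_mulDl : left_distributive pa_mul +%R.
Proof.
move=> x y z; have sz := fsubset_refl (pa_supp z).
rewrite (pa_mulw (fsubsetUl (pa_supp x) (pa_supp y)) sz).
rewrite (pa_mulw (fsubsetUr (pa_supp x) (pa_supp y)) sz).
rewrite (pa_mulw (pa_suppD _ _) sz) -big_split; apply/eq_bigr => p _.
rewrite -big_split; apply/eq_bigr => q _ /=.
by rewrite pa_coefD mulrDl scalerDl.
Qed.

Fact pa_mulDr : right_distributive pa_mul +%R.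
Proof.
move=> z x y; have sz := fsubset_refl (pa_supp z).
rewrite (pa_mulw sz (fsubsetUl (pa_supp x) (pa_supp y))).
rewrite (pa_mulw sz (fsubsetUr (pa_supp x) (pa_supp y))).
rewrite (pa_mulw sz (pa_suppD _ _)) -big_split; apply/eq_bigr => p _.
rewrite -big_split; apply/eq_bigr => q _ /=.
by rewrite pa_coefD mulrDr scalerDl.
Qed.

Fact pa_mul0l : left_zero 0 pa_mul.
Proof. by move=> x; rewrite pa_mul.unlock pa_supp0 big_seq_fset0. Qed.

Fact pa_mul0r : right_zero 0 pa_mul.
Proof.
move=> x; rewrite pa_mul.unlock pa_supp0 big1 // => p _.
by rewrite big_seq_fset0.
Qed.

Fact pa_mulZl k x y : k *: pa_mul x y = pa_mul (k *: x) y.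
Proof.
rewrite (pa_mulw (pa_suppZ k x) (fsubset_refl (pa_supp y))) pa_mul.unlock.
rewrite scaler_sumr; apply/eq_bigr => p _; rewrite scaler_sumr.
by apply/eq_bigr => q _; rewrite pa_coefZ scalerA mulrA.
Qed.

Fact pa_mulZr k x y : k *: pa_mul x y = pa_mul x (k *: y).
Proof.
rewrite (pa_mulw (fsubset_refl (pa_supp x)) (pa_suppZ k y)) pa_mul.unlock.
rewrite scaler_sumr; apply/eq_bigr => p _; rewrite scaler_sumr.
by apply/eq_bigr => q _; rewrite pa_coefZ scalerA mulrCA.
Qed.

Fact pa_mulPP p q : pa_mul (pa_path p) (pa_path q) = pa_cat p q.
Proof.
rewrite (pa_mulw (pa_supp_path K p) (pa_supp_path K q)) !big_seq_fset1.
by rewrite !pa_coef_path !eqxx mulr1 scale1r.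
Qed.

Fact pa_mul_suml (I : Type) (s : seq I) (F : I -> pathalg) y :
  pa_mul (\sum_(i <- s) F i) y = \sum_(i <- s) pa_mul (F i) y.
Proof.
exact: (big_morph (pa_mul^~ y) (fun u v => pa_mulDl u v y) (pa_mul0l y)).
Qed.

Fact pa_mul_sumr (I : Type) (s : seq I) (F : I -> pathalg) x :
  pa_mul x (\sum_(i <- s) F i) = \sum_(i <- s) pa_mul x (F i).
Proof. exact: (big_morph (pa_mul x) (pa_mulDr x) (pa_mul0r x)). Qed.

Fact pa_mul_cat p q r :
  pa_mul (pa_cat p q) (pa_path r) = pa_mul (pa_path p) (pa_cat q r).
Proof.
have := qcatA p q r; rewrite /pa_cat.
case: (qcat p q) => [pq|]; case: (qcat q r) => [qr|] /= E;
  rewrite ?pa_mul0l ?pa_mul0r ?pa_mulPP /pa_cat ?E -?E //.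
Qed.

Fact pa_mulA : associative pa_mul.
Proof.
move=> x y z.
elim/pa_ind: x => [|a p|x x' IH IH']; first by rewrite !pa_mul0l.
  rewrite -!pa_mulZl; congr (_ *: _).
  elim/pa_ind: y => [|b q|y y' IH IH'].
  - by rewrite pa_mul0l !pa_mul0r pa_mul0l.
  - rewrite -pa_mulZr -!pa_mulZl -pa_mulZr; congr (_ *: _).
    elim/pa_ind: z => [|c r|z z' IH IH']; first by rewrite !pa_mul0r.
      by rewrite -!pa_mulZr !pa_mulPP pa_mul_cat.
    by rewrite !pa_mulDr IH IH'.
  - by rewrite pa_mulDl !pa_mulDr pa_mulDl IH IH'.
by rewrite !pa_mulDl IH IH'.
Qed.

Fact pa_cat_triv v p : pa_cat (qtriv v) p = if v == qsrc p then pa_path p else 0.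
Proof.
rewrite /pa_cat; have [->|/eqP ne] := eqVneq v (qsrc p); first by rewrite qcat1p.
by rewrite qcat_none.
Qed.

Fact pa_cat_trivr v p : pa_cat p (qtriv v) = if v == qtgt p then pa_path p else 0.
Proof.
rewrite /pa_cat; have [->|/eqP ne] := eqVneq v (qtgt p); first by rewrite qcatp1.
by rewrite qcat_none //; apply: nesym.
Qed.

Fact pa_mul1l : left_id pa_one pa_mul.
Proof.
elim/pa_ind => [|k p|x y IHx IHy]; first by rewrite pa_mul0r.
  rewrite -pa_mulZr; congr (_ *: _); rewrite pa_one.unlock pa_mul_suml.
  rewrite (bigD1 (qsrc p)) //= pa_mulPP pa_cat_triv eqxx big1 ?addr0 // => v ne.
  by rewrite pa_mulPP pa_cat_triv (negbTE ne).
by rewrite pa_mulDr IHx IHy.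
Qed.

Fact pa_mul1r : right_id pa_one pa_mul.
Proof.
elim/pa_ind => [|k p|x y IHx IHy]; first by rewrite pa_mul0l.
  rewrite -pa_mulZl; congr (_ *: _); rewrite pa_one.unlock pa_mul_sumr.
  rewrite (bigD1 (qtgt p)) //= pa_mulPP pa_cat_trivr eqxx big1 ?addr0 // => v ne.
  by rewrite pa_mulPP pa_cat_trivr (negbTE ne).
by rewrite pa_mulDl IHx IHy.
Qed.

Definition pa_aug (v : vert Q) (x : pathalg) : K := pa_coef (qtriv v) x.

Fact pa_augB v x y : pa_aug v (x - y) = pa_aug v x - pa_aug v y.
Proof. exact: pa_coefB. Qed.

Fact pa_augZ v k x : pa_aug v (k *: x) = k * pa_aug v x.
Proof. exact: pa_coefZ. Qed.

Fact pa_aug_one v : pa_aug v pa_one = 1.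
Proof.
rewrite /pa_aug pa_one.unlock pa_coef_sum (bigD1 v) //= pa_coef_path eqxx.
rewrite big1 ?addr0 // => w ne; rewrite pa_coef_path.
by case: eqP => // -[] E; rewrite E eqxx in ne.
Qed.

Fact pa_one_neq0 : pa_one != 0.
Proof.
have /card_gt0P[v _] := vert_inhabited Q.
apply/eqP => /(congr1 (pa_aug v)); rewrite pa_aug_one.
by rewrite /pa_aug pa_coef0 => /eqP; rewrite oner_eq0.
Qed.

HB.instance Definition _ := GRing.Zmodule_isNzRing.Build pathalg
  pa_mulA pa_mul1l pa_mul1r pa_mulDl pa_mulDr pa_one_neq0.
HB.instance Definition _ := GRing.Lmodule_isLalgebra.Build K pathalg pa_mulZl.
HB.instance Definition _ := GRing.Lalgebra_isAlgebra.Build K pathalg pa_mulZr.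

Fact pa_pathM p q : pa_path p * pa_path q = pa_cat p q.
Proof. exact: pa_mulPP. Qed.

Fact pa_oneE : 1 = \sum_(v : vert Q) pa_idem v :> pathalg.
Proof. by rewrite -[1]/pa_one pa_one.unlock. Qed.

Fact pa_aug_cat v p q :
  pa_aug v (pa_cat p q) = (p == qtriv v)%:R * (q == qtriv v)%:R.
Proof.
rewrite -natrM mulnb /pa_cat; case E: (qcat p q) => [r|]; last first.
  rewrite /pa_aug pa_coef0; case: eqP => [Ep|//]; case: eqP => [Eq|//].
  have /qcat_some[r] : qtgt p = qsrc q by rewrite Ep Eq.
  by rewrite E.
have [Tpq V] := qcatP E; rewrite /pa_aug pa_coef_path.
congr (nat_of_bool _)%:R.
apply/eqP/andP => [Er|[/eqP Ep /eqP Eq]]; last by apply: val_inj; rewrite V Ep Eq.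
move: V; rewrite Er => -[]; case: p Tpq {E Er} => -[vp [|? ?]] // Cp.
case: q => -[vq [|? ?]] // Cq; rewrite /qtgt /qsrc /= => <- -> _.
by split; apply/eqP/val_inj.
Qed.

Fact pa_augM v (x y : pathalg) : pa_aug v (x * y) = pa_aug v x * pa_aug v y.
Proof.
rewrite /pa_aug; elim/pa_ind: x => [|a p|x x' IH IH'].
- by rewrite mul0r !pa_coef0 mul0r.
- elim/pa_ind: y => [|b q|y y' IH IH'].
  + by rewrite mulr0 !pa_coef0 mulr0.
  + rewrite -scalerAl -scalerAr !pa_coefZ !pa_coef_path pa_pathM.
    by rewrite -/(pa_aug _ _) pa_aug_cat mulrACA mulrA.
  + by rewrite mulrDr !pa_coefD IH IH' mulrDr.
by rewrite mulrDl !pa_coefD IH IH' mulrDl.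
Qed.

Fact pa_aug_arr v a : pa_aug v (pa_arr a) = 0.
Proof. by rewrite /pa_aug pa_coef_path; case: eqP. Qed.

Fact pa_aug_proper v (R : pathalg -> Prop) :
  (forall r, R r -> pa_aug v r = 0) -> ~ ideal_gen R 1.
Proof.
move=> R0 /(_ (fun x => pa_aug v x = 0)) I1.
have: pa_aug v 1 = 0.
  apply: I1 => //; split=> [|x y|a x b].
  - exact: pa_coef0.
  - by rewrite /pa_aug pa_coefD => -> ->; rewrite addr0.
  - by rewrite !pa_augM => ->; rewrite mulr0 mul0r.
by rewrite pa_aug_one => /eqP; rewrite oner_eq0.
Qed.

End PathAlgebra.

(* A right A-module is a left module over the converse algebra A^c. *)
Notation rmodType A := (lmodType A^c).

Section DirectSum.
Variables (R : pzRingType) (I : finType) (V : I -> lmodType R).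

Definition dsum : Type := {dffun forall i : I, V i}.
HB.instance Definition _ := Choice.on dsum.

Definition dsum_mk (F : forall i, V i) : dsum := [ffun i : I => F i].
Definition dsum_proj (x : dsum) (i : I) : V i := x i.

Fact dsumP (x y : dsum) : (forall i, dsum_proj x i = dsum_proj y i) <-> x = y.
Proof. by split=> [E|->//]; apply/ffunP. Qed.

Fact dsumE (F : forall i, V i) i : dsum_proj (dsum_mk F) i = F i.
Proof. by rewrite /dsum_proj /dsum_mk ffunE. Qed.

Definition dsum_add (x y : dsum) := dsum_mk (fun i => dsum_proj x i + dsum_proj y i).
Definition dsum_opp (x : dsum) := dsum_mk (fun i => - dsum_proj x i).
Definition dsum_scale (a : R) (x : dsum) := dsum_mk (fun i => a *: dsum_proj x i).

Fact dsum_addA : associative dsum_add.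
Proof. by move=> x y z; apply/dsumP => i; rewrite !dsumE addrA. Qed.
Fact dsum_addC : commutative dsum_add.
Proof. by move=> x y; apply/dsumP => i; rewrite !dsumE addrC. Qed.
Fact dsum_add0 : left_id (dsum_mk (fun=> 0)) dsum_add.
Proof. by move=> x; apply/dsumP => i; rewrite !dsumE add0r. Qed.
Fact dsum_addN : left_inverse (dsum_mk (fun=> 0)) dsum_opp dsum_add.
Proof. by move=> x; apply/dsumP => i; rewrite !dsumE addNr. Qed.
HB.instance Definition _ :=
  GRing.isZmodule.Build dsum dsum_addA dsum_addC dsum_add0 dsum_addN.

Fact dsum_scaleA a b x : dsum_scale a (dsum_scale b x) = dsum_scale (a * b) x.
Proof. by apply/dsumP => i; rewrite !dsumE scalerA. Qed.
Fact dsum_scale1 : left_id 1 dsum_scale.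
Proof. by move=> x; apply/dsumP => i; rewrite !dsumE scale1r. Qed.
Fact dsum_scaleDr : right_distributive dsum_scale +%R.
Proof. by move=> a x y; apply/dsumP => i; rewrite !dsumE scalerDr. Qed.
Fact dsum_scaleDl x : {morph dsum_scale^~ x : a b / a + b}.
Proof. by move=> a b; apply/dsumP => i; rewrite !dsumE scalerDl. Qed.
HB.instance Definition _ := GRing.Zmodule_isLmodule.Build R dsum
  dsum_scaleA dsum_scale1 dsum_scaleDr dsum_scaleDl.
End DirectSum.

Definition surj (T U : Type) (h : T -> U) : Prop := forall y, exists x, h x = y.

Section Modules.
Variables (K : fieldType) (A : algType K).
Implicit Types M N P X : rmodType A.

Definition ract M (v : M) (a : A) : M := (a : A^c) *: v.

Definition regmod : rmodType A := (A^c)^o.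

Fact regmodE (x a : A) : ract (x : regmod) a = x * a.
Proof. by []. Qed.

Definition fin_dim M : Prop :=
  exists s : seq M, forall v : M, exists k : 'I_(size s) -> K,
    v = \sum_(i < size s) ract s`_i (k i)%:A.

Definition mod_iso M N : Prop := exists phi : {linear M -> N}, bijective phi.

Definition in_add M N : Prop :=
  exists (n : nat) (N' : rmodType A), mod_iso (N * N')%type {ffun 'I_n -> M}.

Definition projective P : Prop :=
  forall (X Y : rmodType A) (p : {linear X -> Y}) (h : {linear P -> Y}),
    surj p -> exists h' : {linear P -> X}, forall x, p (h' x) = h x.

Definition projective_cover P M (p : {linear P -> M}) : Prop :=
  [/\ projective P, surj p
    & forall (X : rmodType A) (h : {linear X -> P}), surj (p \o h) -> surj h].

Definition is_syzygy M N : Prop :=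
  exists (P : rmodType A) (p : {linear P -> M}) (i : {linear N -> P}),
    [/\ projective_cover p, injective i
      & forall x, p x = 0 <-> exists y, i y = x].

Definition is_syzygy2 M N : Prop :=
  exists M1, is_syzygy M M1 /\ is_syzygy M1 N.

Record proj_resolution M := ProjResolution {
  pr_obj : nat -> rmodType A;
  pr_diff : forall n, {linear pr_obj n.+1 -> pr_obj n};
  pr_eps : {linear pr_obj 0 -> M};
  pr_projective : forall n, projective (pr_obj n);
  pr_eps_surj : surj pr_eps;
  pr_exact0 : forall x, pr_eps x = 0 <-> exists y, pr_diff 0 y = x;
  pr_exact : forall n x, pr_diff n x = 0 <-> exists y, pr_diff n.+1 y = x
}.

Definition ext_cocycle M N (P : proj_resolution M) n
    (phi : {linear pr_obj P n -> N}) : Prop :=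
  forall x, phi (pr_diff P n x) = 0.

Definition ext_coboundary M N (P : proj_resolution M) n :
    {linear pr_obj P n -> N} -> Prop :=
  if n is n'.+1 then fun phi =>
    exists psi : {linear pr_obj P n' -> N}, forall x, phi x = psi (pr_diff P n' x)
  else fun phi => forall x, phi x = 0.

(* Ext^n(M, N) = 0, i.e. the n-th cohomology of Hom(P, N) vanishes; this does
   not depend on the projective resolution P of M. *)
Definition ext_zero n M N : Prop :=
  forall (P : proj_resolution M) (phi : {linear pr_obj P n -> N}),
    ext_cocycle phi -> ext_coboundary phi.

(* The category in question is that of finite-dimensional modules. *)
Definition cluster_tilting3 M : Prop :=
  forall N, fin_dim N ->
    (in_add M N <-> ext_zero 1 M N /\ ext_zero 2 M N) /\
    (in_add M N <-> ext_zero 1 N M /\ ext_zero 2 N M).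

End Modules.

Section BoundQuiver.
Variables (K : fieldType) (Q : quiver) (R : relations (pathalg Q K)).

(* A presentation of the simple module at v, determined up to isomorphism. *)
Definition is_simple_at (v : vert Q) (S : rmodType (alg_quot R)) : Prop :=
  exists x : S, [/\ x <> 0, forall y, exists k : K, y = ract x k%:A,
    ract x (quot_pi R (pa_idem K v)) = x
    & forall a : arr Q, ract x (quot_pi R (pa_arr K a)) = 0].

End BoundQuiver.

Record triangulation_quiver := TriangulationQuiver {
  tq_quiver :> quiver;
  tq_f : {perm arr tq_quiver};
  tq_connected : forall u v : vert tq_quiver,
    connect (fun x y => [exists a : arr tq_quiver,
      ((src a == x) && (tgt a == y)) || ((src a == y) && (tgt a == x))]) u v;
  tq_out : forall v, #|[set a : arr tq_quiver | src a == v]| = 2%N;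
  tq_in : forall v, #|[set a : arr tq_quiver | tgt a == v]| = 2%N;
  tq_fP : forall a, tgt a = src (tq_f a);
  tq_f3 : forall a, tq_f (tq_f (tq_f a)) = a
}.

Section TriangulationQuiver.
Variable Q : triangulation_quiver.
Implicit Types a b : arr Q.

Definition tq_bar a : arr Q := odflt a [pick b | (src b == src a) && (b != a)].
Definition tq_g a : arr Q := tq_bar (tq_f Q a).
(* As g permutes the arrows, this is the length of the g-cycle of a. *)
Definition tq_n a : nat := fingraph.order tq_g a.
Definition is_loop a : bool := src a == tgt a.
End TriangulationQuiver.

Record weighted_tq (K : fieldType) := WeightedTQ {
  wq :> triangulation_quiver;
  wm : arr wq -> nat;
  wc : arr wq -> K;
  wm_gt0 : forall a, (0 < wm a)%N;
  wc_neq0 : forall a, wc a != 0;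
  wm_g : forall a, wm (tq_g a) = wm a;
  wc_g : forall a, wc (tq_g a) = wc a;
  wmn_ge2 : forall a, (2 <= wm a * tq_n a)%N;
  wmn_ge3 : forall a, (wm (tq_bar a) * tq_n (tq_bar a))%N = 2%N ->
    ~~ is_loop (tq_bar a) -> (3 <= wm a * tq_n a)%N;
  wmn_ge4 : forall a, (wm (tq_bar a) * tq_n (tq_bar a))%N = 2%N ->
    is_loop (tq_bar a) -> (4 <= wm a * tq_n a)%N;
  wq_ge3 : (3 <= #|vert wq|)%N
}.

Section WeightedSurfaceAlgebra.
Variables (K : fieldType) (W : weighted_tq K).
Implicit Types a : arr W.

Local Notation f := (tq_f W).
Local Notation g := (@tq_g W).
Local Notation bar := (@tq_bar W).
Local Notation m := (@wm K W).
Local Notation n := (@tq_n W).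
Local Notation c := (@wc K W).
Local Notation "[ a ]" := (pa_arr K a).

Definition virtual a : bool := (m a * n a == 2)%N.

Definition wsa_A a : pathalg W K :=
  \prod_(0 <= k < (m a * n a).-1) [iter k g a].

Inductive wsa_rel : pathalg W K -> Prop :=
| WsaRel1 a : wsa_rel ([a] * [f a] - c (bar a) *: wsa_A (bar a))
| WsaRel2 a of ~~ virtual (f (f a))
    & ~~ [&& virtual (f (bar a)), (m (bar a) == 1)%N & (n (bar a) == 3)%N] :
    wsa_rel ([a] * [f a] * [g (f a)])
| WsaRel3 a of ~~ virtual (f a)
    & ~~ [&& virtual (f (f a)), (m (f a) == 1)%N & (n (f a) == 3)%N] :
    wsa_rel ([a] * [g a] * [f (g a)]).

Fact wsa_rel_proper : ~ ideal_gen wsa_rel 1.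
Proof.
have /card_gt0P[v _] := vert_inhabited W.
have aug1 a (x : pathalg W K) : pa_aug v ([a] * x) = 0.
  by rewrite pa_augM pa_aug_arr mul0r.
apply: (pa_aug_proper (v := v)) => _ [a|a _ _|a _ _]; last first.
- by rewrite -mulrA aug1.
- by rewrite -mulrA aug1.
rewrite pa_augB pa_augZ aug1 /wsa_A.
have := wmn_ge2 (tq_bar a).
case: (_ * _)%N => [|[|k]] // _; rewrite [_.-1]/= big_ltn // aug1.
by rewrite mulr0 subr0.
Qed.

Definition wsa_relations : relations (pathalg W K) := Relations wsa_rel_proper.
Definition wsa : algType K := alg_quot wsa_relations.

(* The Gabriel quiver of the algebra is Q without its virtual arrows. *)
Definition gabriel_bipartite : Prop :=
  exists X : {set vert W}, forall a, ~~ virtual a ->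
    (src a \in X) != (tgt a \in X).

Definition wsa_Gamma : {set vert W} :=
  [set v | [forall a, virtual a ==> (src a != v) && (tgt a != v)]].

End WeightedSurfaceAlgebra.

(* The vertex labelled i of the quivers below is the ordinal i - 1. *)
Local Notation "''v3_' i" := (@Ordinal 3 i.-1 isT) (at level 8, i at level 2).
Local Notation "''v6_' i" := (@Ordinal 6 i.-1 isT) (at level 8, i at level 2).

Fact vert_inhabited_ord n : (0 < #|'I_n.+1|)%N.
Proof. by rewrite card_ord. Qed.

(* Arrows in the order alpha, beta, gamma, delta. *)
Definition triangle_quiver : quiver := @Quiver 'I_3 'I_4
  (fun a => tnth [tuple 'v3_1; 'v3_2; 'v3_2; 'v3_3] a)
  (fun a => tnth [tuple 'v3_2; 'v3_1; 'v3_3; 'v3_2] a)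
  (vert_inhabited_ord 2).

(* Arrows in the order alpha, beta, nu, delta, rho, omega, gamma, sigma. *)
Definition spherical_quiver : quiver := @Quiver 'I_6 'I_8
  (fun a => tnth [tuple 'v6_1; 'v6_2; 'v6_3; 'v6_5; 'v6_1; 'v6_6; 'v6_3; 'v6_4] a)
  (fun a => tnth [tuple 'v6_2; 'v6_3; 'v6_5; 'v6_1; 'v6_6; 'v6_3; 'v6_4; 'v6_1] a)
  (vert_inhabited_ord 5).

Section TriangleSpherical.
Variables (K : fieldType) (lambda : K).

Definition triangle_rels : seq (pathalg triangle_quiver K) :=
  let x i Hi := @pa_arr triangle_quiver K (@Ordinal 4 i Hi) in
  let alpha := x 0 isT in let beta := x 1 isT in
  let gamma := x 2 isT in let delta := x 3 isT in
  [:: alpha * beta * alpha - alpha * gamma * delta;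
      delta * beta * alpha - lambda *: (delta * gamma * delta);
      beta * alpha * beta - gamma * delta * beta;
      beta * alpha * gamma - lambda *: (gamma * delta * gamma);
      alpha * beta * alpha * gamma;
      beta * alpha * beta * alpha * beta;
      delta * gamma * delta * beta;
      gamma * delta * gamma * delta * gamma;
      alpha * beta * alpha * beta * alpha;
      delta * gamma * delta * gamma * delta;
      delta * beta * alpha * beta].

Definition spherical_rels : seq (pathalg spherical_quiver K) :=
  let x i Hi := @pa_arr spherical_quiver K (@Ordinal 8 i Hi) in
  let alpha := x 0 isT in let beta := x 1 isT in
  let nu := x 2 isT in let delta := x 3 isT in
  let rho := x 4 isT in let omega := x 5 isT in
  let gamma := x 6 isT in let sigma := x 7 isT in
  [:: alpha * beta * nu - rho * omega * nu;
      beta * nu * delta - lambda *: (beta * gamma * sigma);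
      nu * delta * alpha - lambda *: (gamma * sigma * alpha);
      delta * alpha * beta - delta * rho * omega;
      gamma * sigma * rho - nu * delta * rho;
      sigma * rho * omega - lambda *: (sigma * alpha * beta);
      rho * omega * gamma - lambda *: (alpha * beta * gamma);
      omega * gamma * sigma - omega * nu * delta;
      alpha * beta * nu * delta * alpha;
      beta * nu * delta * rho;
      nu * delta * alpha * beta * nu;
      delta * alpha * beta * gamma;
      gamma * sigma * rho * omega * gamma;
      sigma * rho * omega * nu;
      rho * omega * gamma * sigma * rho;
      omega * gamma * sigma * alpha;
      beta * gamma * sigma * rho;
      sigma * alpha * beta * nu;
      delta * rho * omega * gamma;
      omega * nu * delta * alpha;
      beta * nu * delta * alpha * beta;
      delta * alpha * beta * nu * delta;
      sigma * rho * omega * gamma * sigma;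
      omega * gamma * sigma * rho * omega].

Fact rels_proper (Q : quiver) (v : vert Q) (s : seq (pathalg Q K)) :
  all (fun r => pa_aug v r == 0) s -> ~ ideal_gen (fun r => r \in s) 1.
Proof.
by move=> /allP s0; apply: (pa_aug_proper (v := v)) => r /s0 /eqP.
Qed.

Fact triangle_proper : ~ ideal_gen (fun r => r \in triangle_rels) 1.
Proof.
apply: (@rels_proper triangle_quiver 'v3_1).
rewrite /triangle_rels [all _ _]/=.
by rewrite !(pa_augB, pa_augZ, pa_augM, pa_aug_arr, mul0r, mulr0, subrr, eqxx).
Qed.

Fact spherical_proper : ~ ideal_gen (fun r => r \in spherical_rels) 1.
Proof.
apply: (@rels_proper spherical_quiver 'v6_1).
rewrite /spherical_rels [all _ _]/=.
by rewrite !(pa_augB, pa_augZ, pa_augM, pa_aug_arr, mul0r, mulr0, subrr, eqxx).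
Qed.

Definition triangle_alg : algType K := alg_quot (Relations triangle_proper).
Definition spherical_alg : algType K := alg_quot (Relations spherical_proper).

End TriangleSpherical.

(* This is non-singularity for algebras with bipartite Gabriel quiver only. *)
Definition non_singular (K : fieldType) (A : algType K) : Prop :=
  ~ alg_iso A (triangle_alg 1) /\ ~ alg_iso A (spherical_alg 1).

(* Main.v *)
(** As the Gabriel quiver is bipartite, every f-orbit contains exactly one virtual
arrow. The other arrows are therefore of two types: [y] has type I if [f y] is
virtual, and type II if [f (f y)] is; type I arrows leave Gamma, type II arrows
enter it, [g] exchanges the two types, and m n is even and at least 4 on them.

If m n = 4 for some [y] of type I and for [bar y], connectedness forces the
g-orbits of [y] and [bar y] to contain all nonvirtual arrows. Eliminating the
virtual arrows and rescaling identifies Lambda with a triangle or a spherical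
algebra whose parameter is nonzero; these have been excluded.

Otherwise some [y0] of type I has m n >= 6. Let U be the uniserial module of
length 3 along [y0] and [g y0]. The start of explicit projective resolutions of
the simple modules shows that Ext^1(M, U) = Ext^2(M, U) = 0. On the other hand
every composite U -> M -> U kills the top of U, so U is not in add M. *)

From HB Require Import structures.
From mathcomp Require Import all_boot all_fingroup all_algebra.
From mathcomp Require Import boolp finmap zify ring.
From mathcomp.multinomials Require Import monalg.
Require Import Defs.

Set Implicit Arguments.
Unset Strict Implicit.
Unset Printing Implicit Defensive.

Import GRing.Theory.
Local Open Scope ring_scope.

(** * Homological algebra *)

(** The length 3 of U comes from the resolutions. Degrees 1 and 2 for a simple module at a vertex of
    Gamma, and degrees 3 and 4 for one outside Gamma (degrees 1 and 2 for its second syzygy), only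
    involve projectives at vertices outside Gamma. There U has at most its middle basis vector,
    which is the image of the top under [y0] and is not killed by [g y0]. Both Ext groups vanish by
    these two facts.

    The bound 6 enters twice. The generator of the second syzygy has two terms; multiplied by a path
    along [bar y], one of them is an unwanted tail, which is harmless unless m n = 4 for both [y]
    and [bar y]. For [y0] itself the bound yields a uniserial module of length 4, which detects the
    top coefficient on second syzygies.

    The relations only give spanning sets. Independence comes from an explicit matrix
    representation, and kernels of left multiplications from splitting off the first arrow of each
    relation. Since Ext is quantified over all resolutions and syzygies are given by unspecified
    covers, these are compared degree by degree with the explicit truncated complexes. *)

Section Linear.
Variables (R : pzRingType) (V W : lmodType R) (h : V -> W) (hL : linear h).

Definition lin_of : {linear V -> W} :=
  HB.pack h (GRing.isLinear.Build R V W *:%R h hL).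

Lemma lin_ofE x : lin_of x = h x.
Proof. by []. Qed.
End Linear.

Section Submodule.
Variables (R : pzRingType) (V : lmodType R).

Record submodule := Submodule {
  sm_set :> V -> Prop;
  sm0 : sm_set 0;
  smD : forall a u v, sm_set u -> sm_set v -> sm_set (a *: u + v)
}.

Definition sm_pred (M : submodule) : {pred V} := fun x => `[< M x >].

Fact sm_pred_closed (M : submodule) : submod_closed (sm_pred M).
Proof.
split; first exact/asboolP/sm0.
by move=> a u v /asboolP Mu /asboolP Mv; apply/asboolP/smD.
Qed.

HB.instance Definition _ (M : submodule) :=
  GRing.isSubmodClosed.Build R V (sm_pred M) (sm_pred_closed M).

Definition smT (M : submodule) : Type := {x : V | x \in sm_pred M}.
HB.instance Definition _ (M : submodule) := Choice.on (smT M).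
HB.instance Definition _ (M : submodule) := SubChoice.on (smT M).
HB.instance Definition _ (M : submodule) :=
  [SubChoice_isSubLmodule of smT M by <:].

Definition smval (M : submodule) (x : smT M) : V := val x.

Fact smval_linear (M : submodule) : linear (@smval M).
Proof. by move=> a x y; rewrite /smval linearP. Qed.
HB.instance Definition _ (M : submodule) :=
  GRing.isLinear.Build R (smT M) V *:%R (@smval M) (@smval_linear M).

Lemma smvalP (M : submodule) (x : smT M) : M (smval x).
Proof. exact/asboolP/(valP x). Qed.

Lemma smval_inj (M : submodule) : injective (@smval M).
Proof. exact: val_inj. Qed.

Lemma sm_lift (M : submodule) (v : V) : M v -> exists x : smT M, smval x = v.
Proof.
move=> Mv; have Mv' : v \in sm_pred M by apply/asboolP.
by exists (exist _ v Mv').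
Qed.

End Submodule.

Section Homology.
Variables (K : fieldType) (A : algType K).
Implicit Types M N P X Y : rmodType A.

(* The lifting property only needs the image of [h] to lie in that of [d]. *)
Lemma projective_lift P X Y (d : {linear X -> Y}) (h : P -> Y) :
  projective P -> linear h -> (forall x, exists x', d x' = h x) ->
  exists h' : {linear P -> X}, forall x, d (h' x) = h x.
Proof.
move=> projP hL hS.
have C0 : exists x, d x = 0 by exists 0; rewrite linear0.
have CD a u v : (exists x, d x = u) -> (exists x, d x = v) ->
    exists x, d x = a *: u + v.
  by move=> [x <-] [y <-]; exists (a *: x + y); rewrite linearP.
pose I := Submodule C0 CD.
have d_lift x : exists y : smT I, smval y = d x by apply: sm_lift; exists x.
have h_lift x : exists y : smT I, smval y = h x by apply: sm_lift; apply: hS.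
have [d' d'E] := choice d_lift; have [h' h'E] := choice h_lift.
have d'L : linear d'.
  by move=> a x y; apply: smval_inj; rewrite smval_linear !d'E linearP.
have h'L : linear h'.
  by move=> a x y; apply: smval_inj; rewrite smval_linear !h'E hL.
have [|k kE] := projP X (smT I) (lin_of d'L) (lin_of h'L).
  move=> y; have [x xE] := smvalP y.
  by exists x; apply: smval_inj; rewrite lin_ofE d'E.
by exists k => x; rewrite -d'E -h'E; congr smval; exact: kE.
Qed.

Lemma projective_prod P X : projective P -> projective X ->
  projective (P * X)%type.
Proof.
move=> projP projX Y Z p h p_surj.
have L1 : linear (fun x : P => h (x, 0)).
  by move=> a x y; rewrite -linearP; congr (h (_, _)); rewrite /= scaler0 addr0.
have L2 : linear (fun x : X => h (0, x)).
  by move=> a x y; rewrite -linearP; congr (h (_, _)); rewrite /= scaler0 addr0.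
have [h1 h1E] := projP _ _ p (lin_of L1) p_surj.
have [h2 h2E] := projX _ _ p (lin_of L2) p_surj.
have L : linear (fun x : P * X => h1 x.1 + h2 x.2).
  by move=> a x y /=; rewrite !linearP scalerDr addrACA.
exists (lin_of L) => -[x y]; rewrite lin_ofE /= linearD h1E h2E /= -linearD.
by congr (h (_, _)); rewrite /= ?addr0 ?add0r.
Qed.

(** * Free modules and free resolutions *)

Section Free.
Variable X : rmodType A.

Definition free_mod : rmodType A := {malg A^c[X]}.

Definition free_ev (Y : rmodType A) (y : X -> Y) (s : free_mod) : Y :=
  \sum_(x <- msupp s) s@_x *: y x.

Lemma free_evw Y (y : X -> Y) (s : free_mod) (d : {fset X}) :
  (msupp s `<=` d)%fset -> free_ev y s = \sum_(x <- d) s@_x *: y x.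
Proof.
move=> sd; rewrite /free_ev (big_fset_incl _ sd) //= => x _ /mcoeff_outdom ->.
by rewrite scale0r.
Qed.

Lemma free_ev_linear Y (y : X -> Y) : linear (free_ev y).
Proof.
move=> a s t.
have sub : (msupp (a *: s + t)%R `<=` msupp s `|` msupp t)%fset.
  apply/fsubsetP => x; rewrite in_fsetU -!mcoeff_neq0.
  have -> : (a *: s + t)@_x = a * s@_x + t@_x by rewrite mcoeffD mcoeffZ.
  apply: contraNT; rewrite negb_or !negbK => /andP[/eqP-> /eqP->].
  by rewrite mulr0 addr0.
rewrite (free_evw _ sub) (free_evw _ (fsubsetUl (msupp s) (msupp t))).
rewrite (free_evw _ (fsubsetUr (msupp s) (msupp t))) scaler_sumr -big_split /=.
apply: eq_bigr => x _.
have -> : (a *: s + t)@_x = a * s@_x + t@_x by rewrite mcoeffD mcoeffZ.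
by rewrite scalerDl scalerA.
Qed.

Lemma free_ev_gen Y (y : X -> Y) (x : X) :
  free_ev y (<< x >> : free_mod) = y x.
Proof.
rewrite (@free_evw _ _ _ [fset x]%fset); last first.
  by apply/fsubsetP => z; rewrite -mcoeff_neq0 mcoeffU in_fset1 [z == x]eq_sym;
    case: (x == z); rewrite //= eqxx.
by rewrite big_seq_fset1 mcoeffU eqxx scale1r.
Qed.

Lemma free_hom Y (h : {linear free_mod -> Y}) (s : free_mod) :
  h s = free_ev (fun x => h << x >>) s.
Proof.
rewrite /free_ev {1}(monalgE s) linear_sum /=; apply: eq_bigr => x _.
rewrite -linearZ /=; congr (h _); apply/malgP => z.
by rewrite mcoeffZ !mcoeffU; case: (x == z); rewrite ?mulr1 ?mulr0.
Qed.

Lemma free_projective : projective free_mod.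
Proof.
move=> Y Z p h p_surj.
have [y yE] := choice (fun x : X => p_surj (h << x >>)).
exists (lin_of (free_ev_linear y)) => s.
rewrite lin_ofE (free_hom h) /free_ev linear_sum /=.
by apply: eq_bigr => x _; rewrite linearZ /= yE.
Qed.

Definition free_eps : {linear free_mod -> X} := lin_of (@free_ev_linear X id).

Lemma free_eps_surj : surj free_eps.
Proof. by move=> x; exists << x >>; rewrite lin_ofE free_ev_gen. Qed.

End Free.

Section Kernel.
Variables (X Y : rmodType A) (h : {linear X -> Y}).
Fact ker0 : h 0 = 0. Proof. exact: linear0. Qed.
Fact kerD a u v : h u = 0 -> h v = 0 -> h (a *: u + v) = 0.
Proof. by move=> hu hv; rewrite linearP hu hv scaler0 addr0. Qed.
Definition ker_mod : submodule X := Submodule ker0 kerD.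
End Kernel.

Section FreeResolution.
Variable X : rmodType A.

Fixpoint free_syz (n : nat) : rmodType A :=
  if n is n'.+1 then smT (ker_mod (free_eps (free_syz n'))) else X.

Definition free_diff n : free_mod (free_syz n.+1) -> free_mod (free_syz n) :=
  fun s => @smval _ _ (ker_mod (free_eps (free_syz n))) (free_eps (free_syz n.+1) s).

Lemma free_diff_linear n : linear (@free_diff n).
Proof. by move=> a x y; rewrite /free_diff !linearP. Qed.

Lemma free_diff_ker n x :
  free_diff (n := n) x = 0 <-> free_eps (free_syz n.+1) x = 0.
Proof.
split=> [E|E]; last by rewrite /free_diff E linear0.
by apply: smval_inj; rewrite [LHS]E linear0.
Qed.

Lemma free_diff_im n x :
  free_eps (free_syz n) x = 0 <-> exists y, free_diff (n := n) y = x.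
Proof.
split=> [E|[y <-]]; last exact: (smvalP (free_eps (free_syz n.+1) y)).
have [z zE] := @sm_lift _ _ (ker_mod (free_eps (free_syz n))) x E.
by have [y yE] := free_eps_surj z; exists y; rewrite /free_diff yE.
Qed.

(** [ext_zero] quantifies over all resolutions, so a hypothesis of this form can only be exploited
    once some resolution exists. This one serves [ext_zero_sum]. *)
Definition free_resolution : proj_resolution X.
Proof.
refine (@ProjResolution _ _ X (fun n => free_mod (free_syz n))
  (fun n => lin_of (@free_diff_linear n)) (free_eps X) _ _ _ _).
- by move=> n; exact: free_projective.
- exact: free_eps_surj.
- exact: free_diff_im.
- move=> n x; rewrite lin_ofE; split=> [/free_diff_ker /free_diff_im //|E].
  by apply/free_diff_ker/free_diff_im.
Defined.

End FreeResolution.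

(* A finite family of complexes [R j], compared with [P] in one degree: the
   last clause says that [sum_j v_j u_j] is homotopic to the identity. *)
Definition comparable (J : finType) (P P' : rmodType A) (dP : {linear P -> P'})
    (R R' : J -> rmodType A) (dR : forall j, {linear R j -> R' j}) : Prop :=
  exists (v : forall j, {linear R j -> P}) (u : forall j, {linear P -> R j})
    (u' : forall j, {linear P' -> R' j}) (h : {linear P' -> P}),
  [/\ forall j x, dR j x = 0 -> dP (v j x) = 0,
      forall j x, dR j (u j x) = u' j (dP x)
    & forall x, dP (x - \sum_j v j (u j x) - h (dP x)) = 0].

(** The new [v] and [u] lift [v e1] and [u d1] through the differentials; the old [u] becomes the
    new [u']. The defect of the old homotopy identity lies in the kernel of [dP], hence in the image
    of [d1], and its lift is the new homotopy. Only exactness in the current degree is used, so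
    truncated complexes can be compared. *)
Lemma comparable_step (J : finType) (P1 P P' : rmodType A)
    (d1 : {linear P1 -> P}) (dP : {linear P -> P'})
    (R1 R R' : J -> rmodType A)
    (e1 : forall j, {linear R1 j -> R j}) (dR : forall j, {linear R j -> R' j}) :
  projective P -> projective P1 -> (forall j, projective (R1 j)) ->
  (forall x, dP x = 0 <-> exists y, d1 y = x) ->
  (forall j x, dR j x = 0 <-> exists y, e1 j y = x) ->
  comparable dP dR -> comparable d1 e1.
Proof.
move=> projP projP1 projR1 exP exR [v [u [u' [h [vker udR uv]]]]].
have {}uv x : exists y, d1 y = x - \sum_j v j (u j x) - h (dP x) by apply/exP.
have v1_ex j : exists w : {linear R1 j -> P1}, forall x, d1 (w x) = v j (e1 j x).
  apply: (projective_lift (h := fun x => v j (e1 j x))) => //.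
    by move=> a x y; rewrite !linearP.
  by move=> x; apply/exP/vker/exR; exists x.
have u1_ex j : exists w : {linear P1 -> R1 j}, forall x, e1 j (w x) = u j (d1 x).
  apply: (projective_lift (h := fun x => u j (d1 x))) => //.
    by move=> a x y; rewrite !linearP.
  move=> x; apply/exR; rewrite udR.
  have /exP-> : exists y, d1 y = d1 x by exists x.
  exact: linear0.
have [h1 h1E] : exists w : {linear P -> P1}, forall x,
    d1 (w x) = x - \sum_j v j (u j x) - h (dP x).
  apply: (projective_lift (h := fun x => x - \sum_j v j (u j x) - h (dP x))) => //.
  move=> a x y; rewrite (linearP dP) (linearP h).
  have -> : \sum_j v j (u j (a *: x + y)) =
      a *: (\sum_j v j (u j x)) + \sum_j v j (u j y).
    rewrite scaler_sumr -big_split /=.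
    by apply: eq_bigr => j _; rewrite !linearP.
  rewrite !scalerBr !opprD (addrACA (a *: x) y); exact: addrACA.
have {}v1_ex := fun j => cid (v1_ex j); have {}u1_ex := fun j => cid (u1_ex j).
exists (fun j => projT1 (v1_ex j)), (fun j => projT1 (u1_ex j)), u, h1; split.
- move=> j x e1x; case: (v1_ex j) => w wE /=.
  by rewrite wE e1x linear0.
- by move=> j x; case: (u1_ex j) => w wE /=.
- move=> x; rewrite !linearB /= h1E linear_sum /=.
  have /exP-> : exists y, d1 y = d1 x by exists x.
  rewrite linear0 subr0 (_ : \sum_j _ = \sum_j v j (u j (d1 x))) ?subrr //.
  apply: eq_bigr => j _; case: (v1_ex j) => w wE /=; case: (u1_ex j) => z zE /=.
  by rewrite wE zE.
Qed.

(** Vanishing of Ext in the degree of [R], with cocycles described as the maps that vanish on the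
    kernel of [d]. No differential into [R] is mentioned, which suits the end of a truncated
    resolution. *)
Definition vanish_at (R R' N : rmodType A) (d : {linear R -> R'}) : Prop :=
  forall psi : {linear R -> N}, (forall x, d x = 0 -> psi x = 0) ->
    exists chi : {linear R' -> N}, forall x, psi x = chi (d x).

(** Each [phi v_j] kills the kernel of [dR j], so it is [chi_j dR_j]. As [phi] kills the defect of
    the homotopy identity, [phi = sum_j chi_j dR_j u_j + phi h dP], and [dR_j u_j = u'_j dP] makes
    both terms factor through [dP]. *)
Lemma comparable_vanish (J : finType) (P P' N : rmodType A)
    (dP : {linear P -> P'}) (R R' : J -> rmodType A)
    (dR : forall j, {linear R j -> R' j}) :
  comparable dP dR -> (forall j, vanish_at N (dR j)) -> vanish_at N dP.
Proof.
move=> [v [u [u' [h [vker udR uv]]]]] vanR phi phi0.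
have chi_ex j : exists chi : {linear R' j -> N},
    forall x, phi (v j x) = chi (dR j x).
  have L : linear (fun x => phi (v j x)) by move=> a x y; rewrite !linearP.
  by have [x /vker/phi0 //|chi chiE] := vanR j (lin_of L); exists chi.
have {}chi_ex := fun j => cid (chi_ex j).
have L : linear (fun x => \sum_j projT1 (chi_ex j) (u' j x) + phi (h x)).
  move=> a x y; rewrite !linearP scalerDr addrACA; congr (_ + _).
  rewrite scaler_sumr -big_split /=; apply: eq_bigr => j _.
  by rewrite !linearP.
exists (lin_of L) => x; rewrite lin_ofE.
have := phi0 _ (uv x); rewrite !linearB /= linear_sum /= => /subr0_eq/eqP.
rewrite subr_eq addrC => /eqP->; congr (_ + _); apply: eq_bigr => j _.
by case: (chi_ex j) => chi /= chiE; rewrite chiE udR.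
Qed.

(** Only [sum_j inj_j prj_j = id] is assumed, so [X] may be a proper direct summand of the sum of
    the [Y j]. The homotopy starts as 0. *)
Lemma comparable_start (J : finType) (X P : rmodType A) (Y R : J -> rmodType A)
    (inj : forall j, {linear Y j -> X}) (prj : forall j, {linear X -> Y j})
    (eps : {linear P -> X}) (eR : forall j, {linear R j -> Y j}) :
  projective P -> (forall j, projective (R j)) -> surj eps ->
  (forall j, surj (eR j)) -> (forall x, \sum_j inj j (prj j x) = x) ->
  comparable eps eR.
Proof.
move=> projP projR epsS eRS idE.
have v_ex j : exists w : {linear R j -> P}, forall x, eps (w x) = inj j (eR j x).
  apply: (projective_lift (h := fun x => inj j (eR j x))) => //.
  by move=> a x y; rewrite !linearP.
have u_ex j : exists w : {linear P -> R j}, forall x, eR j (w x) = prj j (eps x).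
  apply: (projective_lift (h := fun x => prj j (eps x))) => //.
    by move=> a x y; rewrite !linearP.
  by move=> x; apply: eRS.
have {}v_ex := fun j => cid (v_ex j); have {}u_ex := fun j => cid (u_ex j).
have L : linear (fun _ : X => 0 : P) by move=> a x y; rewrite scaler0 addr0.
exists (fun j => projT1 (v_ex j)), (fun j => projT1 (u_ex j)), prj, (lin_of L).
split=> [j x eRx|j x|x].
- by case: (v_ex j) => w wE /=; rewrite wE eRx linear0.
- by case: (u_ex j) => w wE /=.
- rewrite lin_ofE subr0 linearB /= linear_sum /= -[X in X - _]idE -sumrB.
  apply: big1 => j _; case: (v_ex j) => w wE /=; case: (u_ex j) => z zE /=.
  by rewrite wE zE subrr.
Qed.

Lemma comparable_resolution (J : finType) (X : rmodType A) (Y : J -> rmodType A)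
    (inj : forall j, {linear Y j -> X}) (prj : forall j, {linear X -> Y j})
    (P : proj_resolution X) (Q : forall j, proj_resolution (Y j)) n :
  (forall x, \sum_j inj j (prj j x) = x) ->
  comparable (@pr_diff _ _ _ P n) (fun j => @pr_diff _ _ _ (Q j) n).
Proof.
move=> idE; elim: n => [|n IHn]; last first.
  apply: comparable_step IHn => [||j|x|j x]; by [exact: pr_projective|exact: pr_exact].
apply: (@comparable_step _ _ _ _ _ (pr_eps P) _ _ _ _ (fun j => pr_eps (Q j)));
  try by [exact: pr_projective|exact: pr_exact0|move=> j; exact: pr_projective
         |move=> j; exact: pr_exact0].
by apply: (comparable_start (inj := inj) (prj := prj)) => //;
  try by [exact: pr_projective|exact: pr_eps_surj|move=> j; exact: pr_projective
         |move=> j; exact: pr_eps_surj].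
Qed.

Lemma vanish_ext (X N : rmodType A) (P : proj_resolution X) n :
  vanish_at N (@pr_diff _ _ _ P n) ->
  forall phi : {linear pr_obj P n.+1 -> N}, ext_cocycle phi -> ext_coboundary phi.
Proof.
move=> van phi phiC; apply: van => x /pr_exact[y <-]; exact: phiC.
Qed.

Lemma ext_zero_sum (J : finType) (X N : rmodType A) (Y : J -> rmodType A)
    (inj : forall j, {linear Y j -> X}) (prj : forall j, {linear X -> Y j}) n :
  (forall x, \sum_j inj j (prj j x) = x) ->
  (forall j, ext_zero n.+1 (Y j) N) -> ext_zero n.+1 X N.
Proof.
move=> idE extY P; apply: vanish_ext.
apply: (comparable_vanish (comparable_resolution P
  (fun j => free_resolution (Y j)) n idE)) => j psi psi0.
apply: extY => x; apply: psi0; apply/pr_exact; by exists x.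
Qed.

End Homology.

(** * Quotients of path algebras *)

Section QuiverRep.
Variables (Q : quiver) (K : fieldType).
Implicit Types (a b : arr Q) (u v : vert Q).
Local Notation pathalg := (pathalg Q K).
Local Notation idem := (@pa_idem Q K).
Local Notation parr := (@pa_arr Q K).

(** By [path_eval], these data define an algebra morphism from the path algebra to [L]. *)
Record quiver_rep (L : algType K) (E : vert Q -> L) (T : arr Q -> L) : Prop :=
  QuiverRep {
    rep_orth : forall u v, E u * E v = if u == v then E u else 0;
    rep_sum : \sum_v E v = 1;
    rep_src : forall a, E (src a) * T a = T a;
    rep_tgt : forall a, T a * E (tgt a) = T a
  }.

Lemma rep_src0 (L : algType K) (E : vert Q -> L) (T : arr Q -> L) v a :
  quiver_rep E T -> src a != v -> E v * T a = 0.
Proof.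
move=> H ne; rewrite -(rep_src H a) mulrA (rep_orth H) eq_sym (negbTE ne).
exact: mul0r.
Qed.

Lemma rep_tgt0 (L : algType K) (E : vert Q -> L) (T : arr Q -> L) v a :
  quiver_rep E T -> tgt a != v -> T a * E v = 0.
Proof.
move=> H ne; rewrite -(rep_tgt H a) -mulrA (rep_orth H) (negbTE ne).
exact: mulr0.
Qed.

Lemma rep_mul0 (L : algType K) (E : vert Q -> L) (T : arr Q -> L) a b :
  quiver_rep E T -> tgt a != src b -> T a * T b = 0.
Proof.
by move=> H ne; rewrite -(rep_src H b) mulrA (rep_tgt0 H ne) mul0r.
Qed.

Lemma pa_path_cons v a s (C : composable v (a :: s))
    (C' : composable (tgt a) s) :
  pa_path K (@QPath Q (v, a :: s) C) =
  parr a * pa_path K (@QPath Q (tgt a, s) C').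
Proof.
rewrite pa_pathM /pa_cat.
have [|r -> V] := @qcat_some Q (qarr a) (@QPath Q (tgt a, s) C'); first by [].
congr (pa_path K _); apply: val_inj; rewrite V /qsrc /=.
by have /andP[/eqP -> _] := C.
Qed.

Lemma pa_subalg (D : pathalg -> Prop) :
  (forall x y, D x -> D y -> D (x + y)) -> (forall k x, D x -> D (k *: x)) ->
  (forall x y, D x -> D y -> D (x * y)) -> (forall v, D (idem v)) ->
  (forall a, D (parr a)) -> forall x, D x.
Proof.
move=> DD DZ DM DE DT.
have Dp p : D (pa_path K p).
  case: p => -[v s] C; elim: s v C => [|a s IHs] v C.
    have -> : QPath C = qtriv v by apply: val_inj.
    exact: DE.
  have /andP[_ C'] := C.
  by rewrite (pa_path_cons C C'); apply: DM.
apply: pa_ind => [|k p|x y]; [|exact: DZ|exact: DD].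
have /card_gt0P[v _] := vert_inhabited Q.
by rewrite -(scale0r (idem v)); apply: DZ.
Qed.

Lemma rep_id : quiver_rep idem parr.
Proof.
split=> [u v||a|a].
- rewrite pa_pathM pa_cat_triv /qsrc /=.
  by have [->|] := eqVneq u v.
- by rewrite pa_oneE.
- by rewrite pa_pathM pa_cat_triv eqxx.
- by rewrite pa_pathM pa_cat_trivr eqxx.
Qed.

Lemma rep_morph (L L' : algType K) (E : vert Q -> L) (T : arr Q -> L)
    (phi : {lrmorphism L -> L'}) :
  quiver_rep E T -> quiver_rep (phi \o E) (phi \o T).
Proof.
move=> [H1 H2 H3 H4]; split=> [u v||a|a] /=.
- by rewrite -rmorphM H1; case: ifP; rewrite ?rmorph0.
- by rewrite -rmorph_sum H2 rmorph1.
- by rewrite -rmorphM H3.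
- by rewrite -rmorphM H4.
Qed.

Section Evaluation.
Variables (L : algType K) (E : vert Q -> L) (T : arr Q -> L).
Hypothesis ET : quiver_rep E T.

Let pval (p : qpath Q) : L := E (qsrc p) * \prod_(a <- qarrs p) T a.

Let pval_tgt p : pval p * E (qtgt p) = pval p.
Proof.
rewrite /pval /qtgt; case: p => -[v s] C; rewrite /qsrc /qarrs /= in C *.
elim: s v C => [|a s IHs] v /=; first by rewrite !big_nil !mulr1 (rep_orth ET) eqxx.
move=> /andP[/eqP <- C]; rewrite !big_cons -{1 2}(rep_tgt ET a) -!mulrA.
by congr (_ * (_ * _)); rewrite mulrA; exact: IHs.
Qed.

Let pval_cat p q : pval p * pval q = if qcat p q is Some r then pval r else 0.
Proof.
case Er: (qcat p q) => [r|].
  have [Tpq V] := qcatP Er.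
  rewrite -{1}pval_tgt -mulrA /pval [E (qtgt p) * _]mulrA Tpq (rep_orth ET) eqxx.
  rewrite -Tpq mulrA pval_tgt /pval -mulrA -big_cat.
  by rewrite /qsrc /qarrs V.
rewrite -pval_tgt -mulrA /pval [E (qtgt p) * _]mulrA (rep_orth ET).
case: eqP => [/qcat_some[r]|_]; first by rewrite Er.
by rewrite mul0r mulr0.
Qed.

Let ev (x : pathalg) : L := \sum_(p <- pa_supp x) pa_coef p x *: pval p.

Let evw (d : {fset qpath Q}) x : (pa_supp x `<=` d)%fset ->
  ev x = \sum_(p <- d) pa_coef p x *: pval p.
Proof.
move=> sd; rewrite /ev (big_fset_incl _ sd) //= => p _ /pa_coef_out ->.
exact: scale0r.
Qed.

Let evD x y : ev (x + y) = ev x + ev y.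
Proof.
rewrite (evw (pa_suppD x y)) (evw (fsubsetUl (pa_supp x) (pa_supp y))).
rewrite (evw (fsubsetUr (pa_supp x) (pa_supp y))) -big_split.
by apply: eq_bigr => p _ /=; rewrite pa_coefD scalerDl.
Qed.

Let evZ k x : ev (k *: x) = k *: ev x.
Proof.
rewrite (evw (pa_suppZ k x)) scaler_sumr; apply: eq_bigr => p _.
by rewrite pa_coefZ scalerA.
Qed.

Let ev_path p : ev (pa_path K p) = pval p.
Proof.
rewrite (evw (pa_supp_path K p)) big_seq_fset1 pa_coef_path eqxx.
exact: scale1r.
Qed.

Let ev0 : ev 0 = 0.
Proof. by rewrite /ev pa_supp0 big_seq_fset0. Qed.

Let evM x y : ev (x * y) = ev x * ev y.
Proof.
elim/pa_ind: x => [|k p|x x' IH IH'].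
- by rewrite mul0r ev0 mul0r.
- elim/pa_ind: y => [|l q|y y' IH IH'].
  + by rewrite mulr0 ev0 mulr0.
  + rewrite -!scalerAl -!scalerAr !evZ !ev_path -scalerAl -scalerAr.
    congr (_ *: (_ *: _)); rewrite pval_cat pa_pathM /pa_cat.
    by case: (qcat p q) => [r|]; rewrite ?ev_path ?ev0.
  + by rewrite mulrDr !evD IH IH' mulrDr.
- by rewrite mulrDl !evD IH IH' mulrDl.
Qed.

Let ev_idem v : ev (idem v) = E v.
Proof. by rewrite [LHS](ev_path (qtriv v)) /pval /qarrs /= big_nil mulr1. Qed.

Lemma path_eval : exists phi : {lrmorphism pathalg -> L},
  (forall v, phi (idem v) = E v) /\ (forall a, phi (parr a) = T a).
Proof.
have evB : zmod_morphism ev.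
  by move=> x y; rewrite -scaleN1r evD evZ scaleN1r.
have ev1 : monoid_morphism ev.
  split; last exact: evM.
  rewrite pa_oneE (big_morph ev evD ev0) -(rep_sum ET).
  by apply: eq_bigr => v _; rewrite ev_idem.
pose phi : {lrmorphism pathalg -> L} := HB.pack ev
  (GRing.isZmodMorphism.Build pathalg L ev evB)
  (GRing.isMonoidMorphism.Build pathalg L ev ev1)
  (GRing.isScalable.Build K pathalg L *:%R ev evZ).
exists phi; split=> [v|a]; first exact: ev_idem.
rewrite [LHS](ev_path (qarr a)) /pval /qarrs /= big_seq1 /qsrc /=.
exact: rep_src.
Qed.
End Evaluation.

End QuiverRep.

Section QuotientHom.
Variables (K : fieldType) (A L : algType K) (R : relations A).
Variable phi : {lrmorphism A -> L}.
Hypothesis phiR : forall r, R r -> phi r = 0.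

Let phiI x : ideal_gen R x -> phi x = 0.
Proof.
move=> Ix; apply: (Ix (fun y => phi y = 0)) => //.
split=> [|u v uI vI|a u b uI]; first exact: rmorph0.
  by rewrite rmorphD /= uI vI addr0.
by rewrite !rmorphM /= uI mulr0 mul0r.
Qed.

Let psi (u : alg_quot R) : L := phi (quot_repr u).

Let psi_pi x : psi (quot_pi R x) = phi x.
Proof.
rewrite /psi; apply: subr0_eq; rewrite -rmorphB; apply: phiI.
exact: quot_repr_pi.
Qed.

Lemma quot_hom : exists h : {lrmorphism alg_quot R -> L},
  forall x, h (quot_pi R x) = phi x.
Proof.
have psiB : zmod_morphism psi.
  move=> u v; rewrite -(quot_reprK u) -(quot_reprK v) -rmorphB /= !psi_pi.
  exact: rmorphB.
have psi1 : monoid_morphism psi.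
  split=> [|u v]; first by rewrite -(rmorph1 (quot_pi R)) psi_pi rmorph1.
  by rewrite -(quot_reprK u) -(quot_reprK v) -rmorphM /= !psi_pi rmorphM.
have psiZ : scalable psi.
  by move=> k u; rewrite -(quot_reprK u) -linearZ /= !psi_pi linearZ.
pose h : {lrmorphism alg_quot R -> L} := HB.pack psi
  (GRing.isZmodMorphism.Build (alg_quot R) L psi psiB)
  (GRing.isMonoidMorphism.Build (alg_quot R) L psi psi1)
  (GRing.isScalable.Build K (alg_quot R) L *:%R psi psiZ).
by exists h => x; exact: psi_pi.
Qed.

End QuotientHom.

Section BoundQuiverAlgebra.
Variables (K : fieldType) (Q : quiver) (R : relations (pathalg Q K)).
Local Notation Lam := (alg_quot R).
Local Notation pi := (quot_pi R).

Definition qE (v : vert Q) : Lam := pi (pa_idem K v).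
Definition qT (a : arr Q) : Lam := pi (pa_arr K a).

Lemma quot_rep : quiver_rep qE qT.
Proof. exact: (rep_morph (quot_pi R) (rep_id Q K)). Qed.

Lemma quot_rel x : R x -> pi x = 0.
Proof.
move=> Rx; rewrite -(rmorph0 (quot_pi R)); apply/quot_pi_eqP; rewrite subr0.
by move=> J _; apply.
Qed.

Lemma quot_subalg (D : Lam -> Prop) :
  (forall x y, D x -> D y -> D (x + y)) -> (forall k x, D x -> D (k *: x)) ->
  (forall x y, D x -> D y -> D (x * y)) -> (forall v, D (qE v)) ->
  (forall a, D (qT a)) -> forall x, D x.
Proof.
move=> DD DZ DM DE DT x; rewrite -(quot_reprK x).
elim/(@pa_subalg Q K): (quot_repr x) => // [y z Hy Hz|k y Hy|y z Hy Hz].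
- by rewrite rmorphD; apply: DD.
- by rewrite linearZ; apply: DZ.
- by rewrite rmorphM; apply: DM.
Qed.

Lemma quot_right_ideal (D : Lam -> Prop) :
  (forall x y, D x -> D y -> D (x + y)) -> (forall k x, D x -> D (k *: x)) ->
  (forall x v, D x -> D (x * qE v)) -> (forall x a, D x -> D (x * qT a)) ->
  forall x y, D x -> D (x * y).
Proof.
move=> DD DZ DE DT x y; move: y x; apply: quot_subalg => //.
- by move=> y z Hy Hz x Dx; rewrite mulrDr; apply: DD; [apply: Hy|apply: Hz].
- by move=> k y Hy x Dx; rewrite -scalerAr; apply/DZ/Hy.
- by move=> y z Hy Hz x Dx; rewrite mulrA; apply/Hz/Hy.
- by move=> v x Dx; apply: DE.
- by move=> a x Dx; apply: DT.
Qed.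

Lemma quot_hom_ext (L : algType K) (phi psi : {lrmorphism Lam -> L}) :
  (forall v, phi (qE v) = psi (qE v)) -> (forall a, phi (qT a) = psi (qT a)) ->
  phi =1 psi.
Proof.
move=> HE HT; apply: quot_subalg => // [x y Hx Hy|k x Hx|x y Hx Hy].
- by rewrite !rmorphD /= Hx Hy.
- by rewrite !linearZ /= Hx.
- by rewrite !rmorphM /= Hx Hy.
Qed.

Lemma quot_rep_hom (L : algType K) (E : vert Q -> L) (T : arr Q -> L) :
  quiver_rep E T ->
  (forall phi : {lrmorphism pathalg Q K -> L},
     (forall v, phi (pa_idem K v) = E v) -> (forall a, phi (pa_arr K a) = T a) ->
     forall r, R r -> phi r = 0) ->
  exists h : {lrmorphism Lam -> L},
    (forall v, h (qE v) = E v) /\ (forall a, h (qT a) = T a).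
Proof.
move=> /path_eval[phi [phiE phiT]] /(_ _ phiE phiT) /quot_hom[h hE].
by exists h; split=> [v|a]; rewrite hE.
Qed.

(** The elements of this form contain [qE v] and are stable under right multiplication by vertices
    and arrows, so no nilpotency of the arrow ideal enters. That [k] is well defined, for the
    vertices and algebras at hand, follows later from [uni_lead]. *)
Lemma quot_rad v x : exists k w, qE v * x =
  k *: qE v + \sum_(a | src a == v) qT a * w a.
Proof.
pose D x := exists k w, x = k *: qE v + \sum_(a | src a == v) qT a * w a.
have DE : D (qE v).
  exists 1, (fun=> 0); rewrite scale1r big1 ?addr0 // => a _; exact: mulr0.
have DR := quot_rep; move: DE; apply: (quot_right_ideal (D := D)).
- move=> _ _ [k [w ->]] [l [z ->]]; exists (k + l), (fun a => w a + z a).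
  rewrite scalerDl addrACA -big_split; congr (_ + _).
  by apply: eq_bigr => a _; rewrite mulrDr.
- move=> c _ [k [w ->]]; exists (c * k), (fun a => c *: w a).
  rewrite scalerDr scalerA scaler_sumr; congr (_ + _).
  by apply: eq_bigr => a _; rewrite scalerAr.
- move=> _ u [k [w ->]]; exists (k * (v == u)%:R), (fun a => w a * qE u).
  rewrite mulrDl mulr_suml -scalerAl (rep_orth DR) -scalerA; congr (_ + _).
    by case: eqP; rewrite ?scale1r ?scale0r ?scaler0.
  by apply: eq_bigr => a _; rewrite mulrA.
- move=> _ b [k [w ->]].
  exists 0, (fun a => (if a == b then k *: qE (tgt b) else 0) + w a * qT b).
  rewrite scale0r add0r mulrDl mulr_suml -scalerAl.
  under [in RHS]eq_bigr do rewrite mulrDr mulrA.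
  rewrite big_split /=; congr (_ + _).
  have [Eb|ne] := eqVneq (src b) v; last first.
    rewrite (rep_src0 DR ne) scaler0 big1 // => a /eqP Ea.
    have [Eab|_] := eqVneq a b; last by rewrite mulr0.
    by rewrite -Ea Eab eqxx in ne.
  rewrite (bigD1 b) ?Eb //= eqxx -scalerAr (rep_tgt DR) -Eb (rep_src DR).
  by rewrite big1 ?addr0 // => a /andP[_ /negbTE->]; rewrite mulr0.
Qed.

Section Presentation.
Variables (v : vert Q) (D : (arr Q -> Lam) -> Prop).
Hypothesis D0 : D (fun=> 0).
Hypothesis DD : forall w w', D w -> D w' -> D (fun a => w a + w' a).
Hypothesis DM : forall w x, D w -> D (fun a => w a * x).
Hypothesis DR : forall r, R r -> exists Y : arr Q -> pathalg Q K,
  [/\ r = \sum_a pa_arr K a * Y a, forall a, pa_idem K (tgt a) * Y a = Y a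
    & D (fun a => if src a == v then pi (Y a) else 0)].

(** [Y a] is what remains of [X] after its first arrow [a]. The condition [pi X = 0] is carried
    along because the remainder of [b X], for an arrow [b], is essentially [X] itself and has to
    vanish in the quotient. *)
Let J (X : pathalg Q K) : Prop := pi X = 0 /\
  exists Y : arr Q -> pathalg Q K,
    [/\ X = \sum_a pa_arr K a * Y a, forall a, pa_idem K (tgt a) * Y a = Y a
      & D (fun a => if src a == v then pi (Y a) else 0)].

Let J0 : J 0.
Proof.
split; first exact: rmorph0.
exists (fun=> 0); split=> [|a|].
- by rewrite big1 // => a _; rewrite mulr0.
- exact: mulr0.
- rewrite (_ : (fun a => _) = fun=> 0) //; apply: funext => a.
  by rewrite rmorph0; case: ifP.
Qed.

Let JD x y : J x -> J y -> J (x + y).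
Proof.
move=> [x0 [Y [xY tY DY]]] [y0 [Z [yZ tZ DZ]]].
split; first by rewrite rmorphD [X in X + _]x0 [X in _ + X]y0 addr0.
exists (fun a => Y a + Z a); split=> [|a|].
- by rewrite xY yZ -big_split; apply: eq_bigr => a _; rewrite mulrDr.
- by rewrite mulrDr tY tZ.
- have := DD DY DZ; congr D; apply: funext => a.
  by rewrite rmorphD; case: ifP => // _; rewrite addr0.
Qed.

Let JMr x q : J x -> J (x * q).
Proof.
move=> [x0 [Y [xY tY DY]]]; split; first by rewrite rmorphM [X in X * _]x0 mul0r.
exists (fun a => Y a * q); split=> [|a|].
- by rewrite xY mulr_suml; apply: eq_bigr => a _; rewrite mulrA.
- by rewrite mulrA tY.
- have := DM (pi q) DY; congr D; apply: funext => a.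
  by rewrite rmorphM; case: ifP => // _; rewrite mul0r.
Qed.

Let JMl q x : J x -> J (q * x).
Proof.
move: q x; apply: pa_subalg.
- by move=> q r Hq Hr x Jx; rewrite mulrDl; apply: JD; [apply: Hq|apply: Hr].
- by move=> k q Hq x Jx; rewrite -scalerAl scalerAr -mulr_algr mulrA; apply/JMr/Hq.
- by move=> q r Hq Hr x Jx; rewrite -mulrA; apply/Hq/Hr.
- move=> u x [x0 [Y [xY tY DY]]].
  split; first by rewrite rmorphM [X in _ * X]x0 mulr0.
  exists (fun a => if src a == u then Y a else 0); split=> [|a|].
  + rewrite xY mulr_sumr; apply: eq_bigr => a _; rewrite mulrA.
    case: ifPn => [/eqP <-|ne]; first by rewrite (rep_src (rep_id Q K)).
    by rewrite (rep_src0 (rep_id Q K) ne) mul0r mulr0.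
  + by case: ifP; rewrite ?mulr0.
  + have [<-|ne] := eqVneq v u.
      by move: DY; congr D; apply: funext => a; case: ifP.
    move: D0; congr D; apply: funext => a.
    by case: eqP => // ->; rewrite (negbTE ne) rmorph0.
- move=> b x [x0 _]; split; first by rewrite rmorphM [X in _ * X]x0 mulr0.
  exists (fun a => if a == b then pa_idem K (tgt b) * x else 0); split=> [|a|].
  + rewrite (bigD1 b) //= eqxx mulrA (rep_tgt (rep_id Q K)) big1 ?addr0 //.
    by move=> a /negbTE->; rewrite mulr0.
  + case: eqP => [->|]; last by rewrite mulr0.
    by rewrite mulrA (rep_orth (rep_id Q K)) eqxx.
  + move: D0; congr D; apply: funext => a; case: ifP => // _.
    by case: ifP; rewrite ?rmorph0 // rmorphM [X in _ * X]x0 mulr0.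
Qed.

Let J_ideal x : ideal_gen R x -> J x.
Proof.
move=> Ix; apply: (Ix J); first by split=> // a y b Jy; apply/JMr/JMl.
by move=> r Rr; split; [exact: quot_rel|exact: DR].
Qed.

Let coef_cons a s (C : composable (src a) (a :: s)) (C' : composable (tgt a) s)
    b (Y : pathalg Q K) :
  pa_coef (@QPath Q (src a, a :: s) C) (pa_arr K b * Y) =
  if a == b then pa_coef (@QPath Q (tgt a, s) C') Y else 0.
Proof.
elim/pa_ind: Y => [|k p|x y IHx IHy].
- by rewrite mulr0 !pa_coef0; case: ifP.
- rewrite -scalerAr !pa_coefZ pa_pathM /pa_cat.
  case E: (qcat (qarr b) p) => [r|]; last first.
    rewrite pa_coef0 mulr0 pa_coef_path; case: eqP => // <-{b} in E *.
    case: eqP => [Ep|]; rewrite ?mulr0 //.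
    have /qcat_some[r] : qtgt (qarr a) = qsrc p by rewrite Ep.
    by rewrite E.
  have [Tp V] := qcatP E; rewrite !pa_coef_path.
  case: p E Tp V => -[w t] Ct E Tp V.
  have [Eab|ne] := eqVneq a b; last first.
    case: eqP => [Er|]; rewrite ?mulr0 //; move: V; rewrite Er => -[_ Eab _].
    by rewrite Eab eqxx in ne.
  congr (_ * (nat_of_bool _)%:R); apply/eqP/eqP => [Er|[Ew Es]].
    apply: val_inj => /=; move: V; rewrite Er => -[_ _ ->].
    by move: Tp; rewrite /qtgt /qsrc /= Eab => ->.
  by apply: val_inj; rewrite V /qsrc /qarrs /= Es Eab.
- by rewrite mulrDr !pa_coefD IHx IHy; case: ifP => // _; rewrite addr0.
Qed.

(** The coefficient of [Y a] at a path [s] is that of the sum at the path [a :: s]. Thus the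
    remainders after the first arrow are unique. *)
Let arrow_free (Y : arr Q -> pathalg Q K) :
  (forall a, pa_idem K (tgt a) * Y a = Y a) ->
  \sum_a pa_arr K a * Y a = 0 -> forall a, Y a = 0.
Proof.
move=> tY sY a; apply: pa_coefP => -[[w s] C]; rewrite pa_coef0.
have [Ew|ne] := eqVneq (tgt a) w; last first.
  rewrite -tY; elim/pa_ind: (Y a) => [|k p|x y IHx IHy].
  - by rewrite mulr0 pa_coef0.
  - rewrite -scalerAr pa_coefZ pa_pathM pa_cat_triv.
    case: eqP => [E|_]; last by rewrite pa_coef0 mulr0.
    rewrite pa_coef_path; case: eqP => [Ep|_]; last by rewrite mulr0.
    by rewrite Ep /qsrc /= in E; rewrite E eqxx in ne.
  - by rewrite mulrDr pa_coefD IHx IHy addr0.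
move: C; rewrite -{}Ew /= => C.
have C' : composable (src a) (a :: s) by rewrite /= eqxx.
have := congr1 (pa_coef (@QPath Q (src a, a :: s) C')) sY.
rewrite pa_coef0 pa_coef_sum (bigD1 a) //= (coef_cons C' C) eqxx big1 ?addr0 //.
by move=> b ne; rewrite (coef_cons C' C) eq_sym (negbTE ne).
Qed.

(** The beginning of the resolution of a simple module: the syzygies between the arrows that start
    at [v] are generated, as a right module, by the remainders of the relations after their first
    arrow. A syzygy lifts to an element of the ideal, all of whose elements satisfy [J], and
    [arrow_free] identifies the two families of remainders. *)
Lemma quot_presentation (w : arr Q -> Lam) :
  (forall a, qE (tgt a) * w a = w a) -> (forall a, src a != v -> w a = 0) ->
  \sum_a qT a * w a = 0 -> D w.
Proof.
move=> tw w0 sw.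
pose Y a := pa_idem K (tgt a) * quot_repr (w a).
have piY a : pi (Y a) = w a by rewrite rmorphM /= quot_reprK; exact: tw.
have : J (\sum_a pa_arr K a * Y a).
  apply: J_ideal; rewrite -[X in ideal_gen _ X]subr0; apply/quot_pi_eqP.
  rewrite rmorph0 rmorph_sum -[RHS]sw; apply: eq_bigr => a _.
  by rewrite rmorphM /= piY.
move=> [_ [Z [YZ tZ DZ]]].
have tY a : pa_idem K (tgt a) * Y a = Y a.
  by rewrite mulrA (rep_orth (rep_id Q K)) eqxx.
have YZE a : Y a = Z a.
  apply/eqP; rewrite -subr_eq0; apply/eqP.
  apply: (arrow_free (Y := fun a => Y a - Z a)) => [b|].
    by rewrite mulrBr tY tZ.
  under eq_bigr do rewrite mulrBr.
  by rewrite sumrB YZ subrr.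
move: DZ; congr D; apply: funext => a; rewrite -YZE piY.
by case: ifPn => // /w0.
Qed.

End Presentation.

End BoundQuiverAlgebra.

(** * Bipartite triangulation quivers *)

Section TriangulationQuiverTheory.
Variable Q : triangulation_quiver.
Implicit Types a b : arr Q.
Local Notation f := (tq_f Q).
Local Notation g := (@tq_g Q).
Local Notation bar := (@tq_bar Q).

Lemma out_arrows a : exists b, [/\ b != a, src b = src a &
  forall x, (src x == src a) = (x == a) || (x == b)].
Proof.
move/eqP: (tq_out (src a)) => /cards2P[x [y [xy E]]].
have mem z : (src z == src a) = (z == x) || (z == y).
  by have /setP/(_ z) := E; rewrite !inE.
have : (a == x) || (a == y) by rewrite -mem.
case/orP=> /eqP Ea.
  exists y; split=> [||z]; rewrite ?Ea ?[y == x]eq_sym //.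
    by apply/eqP; rewrite -{1}Ea mem eqxx orbT.
  by rewrite -{1}Ea mem.
exists x; split=> [||z]; rewrite ?Ea //.
  by apply/eqP; rewrite -{1}Ea mem eqxx.
by rewrite -{1}Ea mem orbC.
Qed.

Lemma barP a : src (bar a) = src a /\ bar a != a.
Proof.
rewrite /tq_bar; case: pickP => [b /andP[/eqP-> ->] //|none].
by have [b [ne Eb _]] := out_arrows a; have := none b; rewrite Eb eqxx ne.
Qed.

Lemma src_bar a : src (bar a) = src a. Proof. by case: (barP a). Qed.
Lemma bar_neq a : (bar a == a) = false. Proof. by case: (barP a) => _ /negbTE. Qed.
Lemma neq_bar a : (a == bar a) = false. Proof. by rewrite eq_sym bar_neq. Qed.

Lemma src_eq a b : (src b == src a) = (b == a) || (b == bar a).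
Proof.
have [c [ne Ec mem]] := out_arrows a.
suff -> : bar a = c by [].
have := mem (bar a); rewrite src_bar eqxx bar_neq /= => /esym/eqP; exact.
Qed.

Lemma barK : involutive bar.
Proof.
move=> a; have := src_eq (bar a) a; rewrite src_bar eqxx neq_bar /=.
by move=> /esym/eqP.
Qed.

Lemma bar_eq a b : (bar a == b) = (a == bar b).
Proof. exact: (inv_eq barK). Qed.

Lemma gE a : g a = bar (f a). Proof. by []. Qed.
Lemma barg a : bar (g a) = f a. Proof. exact: barK. Qed.
Lemma src_f a : src (f a) = tgt a. Proof. by rewrite tq_fP. Qed.
Lemma src_g a : src (g a) = tgt a. Proof. by rewrite src_bar src_f. Qed.
Lemma f_neq_g a : (f a == g a) = false. Proof. exact: neq_bar. Qed.

Lemma g_inj : injective g.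
Proof. by move=> a b /(can_inj barK)/perm_inj. Qed.

Lemma iter_n a : iter (tq_n a) g a = a.
Proof. exact: (iter_order g_inj). Qed.

Lemma n_g a : tq_n (g a) = tq_n a.
Proof.
rewrite /tq_n /order; apply: eq_card => x; apply/idP/idP => H.
  by apply: connect_trans H; exact: fconnect1.
rewrite inE in H *; apply: connect_trans H.
by rewrite fconnect_sym ?fconnect1 //; exact: g_inj.
Qed.

(** Connectedness, phrased with arrows. The arrows starting at a vertex are exchanged by [bar], and
    [f] passes from the source of an arrow to its target; since [f] has order dividing 3, the
    converse passage is available too. *)
Lemma arrow_ind (D : arr Q -> Prop) a0 :
  D a0 -> (forall a, D a -> D (bar a)) -> (forall a, D a -> D (f a)) ->
  forall a, D a.
Proof.
move=> D0 Db Df.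
have Df' a : D (f a) -> D a by move=> /Df/Df; rewrite tq_f3.
have Dsrc a b : src a = src b -> D a -> D b.
  move=> E Da; have := src_eq a b; rewrite E eqxx => /esym/orP[]/eqP-> //.
  exact: Db.
pose P v := exists2 a, src a = v & D a.
have stepP a : P (src a) <-> P (tgt a).
  split=> [[b E Db']|[b E Db']].
    exists (f a); rewrite ?src_f //; apply: Df.
    exact: Dsrc Db'.
  exists a => //; apply: Df'.
  by apply: (Dsrc b) Db'; rewrite src_f.
move=> a; suff [b E Db'] : P (src a) by exact: Dsrc Db'.
have /connectP[s] := tq_connected (src a0) (src a).
have : P (src a0) by exists a0.
elim: s (src a0) => [v Pv _ -> //|w s IHs v Pv /= /andP[/existsP[b] H]].
apply: IHs; move: H Pv.
by case/orP=> /andP[/eqP<- /eqP<-] /stepP.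
Qed.

End TriangulationQuiverTheory.

Section BipartiteWeighted.
Variables (K : fieldType) (W : weighted_tq K).
Hypothesis bip : gabriel_bipartite W.
Implicit Types a b y z : arr W.
Local Notation f := (tq_f W).
Local Notation g := (@tq_g W).
Local Notation bar := (@tq_bar W).
Local Notation virt := (@virtual K W).

Definition arrN a : nat := (wm a * tq_n a)%N.
Local Notation N := arrN.

Definition typI a := virt (f a).
Definition typII a := virt (f (f a)).

Lemma N_g a : N (g a) = N a.
Proof. by rewrite /N wm_g n_g. Qed.
Lemma virt_g a : virt (g a) = virt a.
Proof. by rewrite /virtual -/(N _) N_g. Qed.

Lemma f3 a : f (f (f a)) = a. Proof. exact: tq_f3. Qed.

Lemma virt_bar a : virt a -> ~~ virt (bar a).
Proof.
move=> va; apply/negP; have N2 := va; rewrite /virtual in N2.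
move=> /eqP Nb; have [nl|l] := boolP (is_loop (bar a)).
  by have := wmn_ge4 Nb nl; rewrite (eqP N2).
by have := wmn_ge3 Nb l; rewrite (eqP N2).
Qed.

Lemma virt_f a : virt a -> ~~ virt (f a).
Proof. by rewrite -virt_g => /virt_bar; rewrite barg. Qed.

Lemma virt_ff a : virt a -> ~~ virt (f (f a)).
Proof. by move=> va; apply/negP => /virt_f; rewrite f3 va. Qed.

(** Three nonvirtual arrows in succession under [f] would be a closed walk of odd length in the
    bipartite Gabriel quiver. *)
Lemma typ_ex a : [|| virt a, typI a | typII a].
Proof.
have [X XE] := bip; apply/norP; rewrite negb_or /typI /typII => -[v0 /andP[v1 v2]].
have := XE _ v0; have := XE _ v1; have := XE _ v2.
rewrite !tq_fP f3.
by do 3!case: (_ \in X).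
Qed.

Lemma typP a : [\/ [/\ virt a, typI a = false & typII a = false],
  [/\ virt a = false, typI a & typII a = false]
  | [/\ virt a = false, typI a = false & typII a]].
Proof.
case/or3P: (typ_ex a) => H.
- by apply: Or31; rewrite /typI /typII (negbTE (virt_f H)) (negbTE (virt_ff H)).
- apply: Or32; rewrite /typII (negbTE (virt_f H)) H.
  by have := virt_ff H; rewrite f3 => /negbTE->.
- apply: Or33; rewrite /typI H; have := virt_f H; have := virt_ff H.
  by rewrite !f3 => /negbTE-> /negbTE->.
Qed.

Lemma typIN a : typI a -> (virt a = false) * (typII a = false).
Proof. by case: (typP a) => -[-> -> ->]. Qed.
Lemma typIIN a : typII a -> (virt a = false) * (typI a = false).
Proof. by case: (typP a) => -[-> -> ->]. Qed.
Lemma virtN a : virt a -> (typI a = false) * (typII a = false).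
Proof. by case: (typP a) => -[-> -> ->]. Qed.

Lemma typI_f a : typI (f a) = typII a. Proof. by []. Qed.
Lemma typII_barV a : virt a -> typII (bar a).
Proof.
move=> va; rewrite /typII -virt_g.
by rewrite gE f3 barK.
Qed.

Lemma virt_barII a : typII a -> virt (bar a).
Proof. by rewrite /typII -virt_g gE f3. Qed.

Lemma typI_bar a : typI (bar a) = typI a.
Proof.
wlog suff: a / typI a -> typI (bar a).
  by move=> H; apply/idP/idP => /H; rewrite ?barK.
move=> Ia; case: (typP (bar a)) => -[] // vb _ IIb.
  by have := typII_barV vb; rewrite barK (typIN Ia).
by have := virt_barII IIb; rewrite barK (typIN Ia).
Qed.

Lemma typII_g a : typI a -> typII (g a).
Proof. exact: typII_barV. Qed.
Lemma typI_g a : typII a -> typI (g a).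
Proof. by rewrite gE typI_bar. Qed.
Lemma typI_gg a : typI a -> typI (g (g a)).
Proof. by move=> /typII_g/typI_g. Qed.

Lemma typI_iter a k : typI a -> typI (iter k g a) = ~~ odd k.
Proof.
move=> Ia; suff: if odd k then typII (iter k g a) else typI (iter k g a).
  by case: (odd k) => // /typIIN ->.
elim: k => //= k; case: (odd k) => /=; [exact: typI_g|exact: typII_g].
Qed.

Lemma typI_n a : typI a -> ~~ odd (tq_n a).
Proof. by move=> Ia; rewrite -(typI_iter _ Ia) iter_n. Qed.

Lemma N_even a : typI a -> ~~ odd (N a).
Proof. by move=> /typI_n no; rewrite /N oddM negb_and no orbT. Qed.

Lemma N_ge4 a : virt a = false -> (4 <= N a)%N.
Proof.
wlog Ia : a / typI a => [H va|va].
  case: (typP a) => -[] // va' Ia IIa; try by rewrite va' in va.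
    exact: H.
  by rewrite -N_g; apply: H (typI_g IIa) _; rewrite virt_g.
have := N_even Ia; have := wmn_ge2 a.
have : N a != 2%N by move: va => /negbT.
by rewrite -/(N a); case: (N a) => [|[|[|[|k]]]].
Qed.

Lemma typI_N_neq4 a : typI a -> N a != 4%N -> (6 <= N a)%N.
Proof.
move=> Ia; have := N_ge4 (typIN Ia).1.
have := N_even Ia.
by case: (N a) => [|[|[|[|[|[|k]]]]]].
Qed.

Lemma N_virt a : virt a -> N a = 2%N.
Proof. by move/eqP. Qed.

Lemma iter_N a : iter (N a) g a = a.
Proof.
rewrite /N; elim: (wm a) => [|k IHk]; first by rewrite mul0n.
by rewrite mulSn iterD IHk iter_n.
Qed.

Lemma virt_gg a : virt a -> g (g a) = a.
Proof. by move=> /N_virt E; have := iter_N a; rewrite E. Qed.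

Lemma c_g a : wc (g a) = wc a. Proof. exact: wc_g. Qed.
Lemma N_iter a k : N (iter k g a) = N a.
Proof. by elim: k => //= k IHk; rewrite N_g. Qed.

Lemma f_g a : f (g a) = bar (g (g a)). Proof. by rewrite barg. Qed.

Lemma gff a : g (f (f a)) = bar a. Proof. by rewrite gE f3. Qed.

(** Since [g] squared fixes the virtual arrow [f y], the triangles of [y] and of [g y] are glued
    along [f y] and [g (f y)], and the latter is the virtual arrow in the triangle of [g y]. The
    next two identities express the same gluing. *)
Lemma gf_typI y : typI y -> g (f y) = f (f (g y)).
Proof.
move=> Iy; apply: (@perm_inj _ f); rewrite f3; apply: (can_inj (@barK W)).
by rewrite -gE virt_gg // gE barK.
Qed.

Lemma gfg_typI y : typI y -> g (f (g y)) = f (f y).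
Proof. by move=> Iy; rewrite gE -gf_typI // gE barK. Qed.

Lemma fgf_typI y : typI y -> f (g (f y)) = g y.
Proof. by move=> Iy; rewrite gf_typI // f3. Qed.

Lemma typI_cases a : exists2 y, typI y & [\/ a = y, a = g y | a = f y].
Proof.
case: (typP a) => -[va Ia IIa].
- exists (f (f a)); first by rewrite /typI f3.
  by apply: Or33; rewrite f3.
- by exists a => //; apply: Or31.
- exists (f (f (bar a))); first by rewrite /typI f3 virt_barII.
  by apply: Or32; rewrite gff barK.
Qed.

Lemma typI_ex : exists y, typI y.
Proof.
have /card_gt0P[v _] := vert_inhabited W.
have /card_gt0P[a _] : (0 < #|[set a : arr W | src a == v]|)%N by rewrite tq_out.
by have [y Iy _] := typI_cases a; exists y.
Qed.

(** Of the two arrows starting at [tgt y] only [f y] is virtual. Together with [vert_cases], the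
    type I arrows are in bijection with the vertices outside Gamma. *)
Lemma typI_tgt_inj y y' : typI y -> typI y' -> (tgt y == tgt y') = (y == y').
Proof.
move=> Iy Iy'; apply/eqP/eqP => [|-> //]; rewrite !tq_fP => /eqP.
rewrite src_eq => /orP[/eqP/perm_inj-> //|/eqP E].
have := virt_bar Iy'; rewrite -E.
by move: Iy; rewrite /typI => ->.
Qed.

Lemma src_typI_g y z : typI y -> typI z -> src y != tgt z.
Proof.
move=> Iy Iz; rewrite tq_fP src_eq; apply/norP; split; apply/eqP => E.
  by move: (typIN Iy).1; rewrite E; move: Iz; rewrite /typI => ->.
by move: (typIN Iy).2; rewrite E -gE typII_g.
Qed.

Lemma Gamma_typI y : typI y -> src y \in wsa_Gamma W.
Proof.
move=> Iy; rewrite inE; apply/forallP => a; apply/implyP => va.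
apply/andP; split.
  rewrite eq_sym src_eq; apply/norP; split; apply/eqP => E.
    by move: (typIN Iy).1; rewrite E va.
  by move: (typIN Iy).2; rewrite E typII_barV.
rewrite tq_fP eq_sym src_eq; apply/norP; split; apply/eqP => E.
  by move: (typIN Iy).2; rewrite E /typII f3 va.
by move: (typIN Iy).1; rewrite E -gE virt_g va.
Qed.

Lemma nGamma_typI y : typI y -> tgt y \notin wsa_Gamma W.
Proof.
move=> Iy; rewrite inE; apply/negP => /forallP/(_ (f y))/implyP/(_ Iy).
by rewrite src_f eqxx.
Qed.

Lemma vert_cases v : exists2 y, typI y &
  (v \in wsa_Gamma W /\ v = src y) \/ (v \notin wsa_Gamma W /\ v = tgt y).
Proof.
have /card_gt0P[a] : (0 < #|[set a : arr W | src a == v]|)%N by rewrite tq_out.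
rewrite inE => /eqP<-; have [y Iy [->|->|->]] := typI_cases a.
- by exists y => //; left; rewrite Gamma_typI.
- by exists y => //; right; rewrite src_g nGamma_typI.
- by exists y => //; right; rewrite src_f nGamma_typI.
Qed.

End BipartiteWeighted.

(** * Identities in weighted surface algebras *)

Section GPath.
Variables (Q : triangulation_quiver) (K : fieldType) (L : algType K).
Variables (E : vert Q -> L) (T : arr Q -> L).
Local Notation g := (@tq_g Q).
Implicit Types a b : arr Q.

(** Length [N a - 1] gives the element [A_a] of the defining relations. For a type I arrow, length
    [N a] gives a full cycle, which every arrow kills from the right. *)
Fixpoint gpath a (k : nat) : L :=
  if k is k'.+1 then T a * gpath (g a) k' else E (src a).

Lemma gpathS a k : gpath a k.+1 = T a * gpath (g a) k. Proof. by []. Qed.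
Lemma gpath0 a : gpath a 0 = E (src a). Proof. by []. Qed.

Hypothesis ET : quiver_rep E T.

Lemma src_gpath a k : E (src a) * gpath a k = gpath a k.
Proof.
case: k => [|k] /=; first by rewrite (rep_orth ET) eqxx.
by rewrite mulrA (rep_src ET).
Qed.

Lemma gpath1 a : gpath a 1 = T a.
Proof. by rewrite /= src_g (rep_tgt ET). Qed.

Lemma gpathD a k l : gpath a (k + l) = gpath a k * gpath (iter k g a) l.
Proof.
elim: k a => [|k IHk] a; first by rewrite add0n src_gpath.
by rewrite addSn [LHS]/= [gpath a k.+1]/= IHk mulrA iterSr.
Qed.

Lemma gpathSr a k : gpath a k.+1 = gpath a k * T (iter k g a).
Proof. by rewrite -addn1 gpathD gpath1. Qed.

Lemma gpath2 a : gpath a 2 = T a * T (g a).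
Proof. by rewrite gpathSr gpath1. Qed.

Lemma gpath_prod a k :
  gpath a k.+1 = \prod_(0 <= i < k.+1) T (iter i g a).
Proof.
elim: k => [|k IHk]; first by rewrite gpath1 big_nat1.
by rewrite gpathSr IHk [in RHS]big_nat_recr.
Qed.

Lemma gpath_tgt a k : gpath a k * E (src (iter k g a)) = gpath a k.
Proof.
case: k => [|k]; first by rewrite /= (rep_orth ET) eqxx.
by rewrite gpathSr -mulrA /= src_g (rep_tgt ET).
Qed.

Lemma gpath_mul0 a b k : src b != src (iter k g a) -> gpath a k * T b = 0.
Proof.
move=> ne; rewrite -gpath_tgt -mulrA (rep_src0 ET ne); exact: mulr0.
Qed.

End GPath.

Arguments gpath : simpl never.

Lemma gpath_morph (Q : triangulation_quiver) (K : fieldType) (L L' : algType K)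
    (E : vert Q -> L) (T : arr Q -> L) (E' : vert Q -> L') (T' : arr Q -> L')
    (phi : {lrmorphism L -> L'}) a k :
  (forall v, phi (E v) = E' v) -> (forall b, phi (T b) = T' b) ->
  phi (gpath E T a k) = gpath E' T' a k.
Proof.
move=> phiE phiT; elim: k a => [|k IHk] a; first exact: phiE.
by rewrite !gpathS rmorphM /= phiT IHk.
Qed.

Section WsaRep.
Variables (K : fieldType) (W : weighted_tq K).
Implicit Types a b y z : arr W.
Local Notation f := (tq_f W).
Local Notation g := (@tq_g W).
Local Notation bar := (@tq_bar W).
Local Notation virt := (@virtual K W).
Local Notation c := (@wc K W).
Local Notation N := (@arrN K W).

(** The exceptions to the zero relations for m = 1 and n = 3 are left out: in the bipartite case
    they never occur, by [N_neq3]. *)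
Record wsa_rep (L : algType K) (E : vert W -> L) (T : arr W -> L) : Prop :=
  WsaRep {
    wsa_quiver_rep : quiver_rep E T;
    wsa_rep1 : forall a,
      T a * T (f a) = c (bar a) *: gpath E T (bar a) (N (bar a)).-1;
    wsa_rep2 : forall a, ~~ typII a -> T a * T (f a) * T (g (f a)) = 0;
    wsa_rep3 : forall a, ~~ typI a -> T a * T (g a) * T (f (g a)) = 0
  }.

Lemma wsa_rep_hom (L : algType K) (E : vert W -> L) (T : arr W -> L) :
  wsa_rep E T -> exists h : {lrmorphism wsa W -> L},
    (forall v, h (qE (wsa_relations W) v) = E v) /\
    (forall a, h (qT (wsa_relations W) a) = T a).
Proof.
move=> [HR H1 H2 H3]; apply: quot_rep_hom => // phi phiE phiT r.
case=> [a|a va _|a va _].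
- rewrite rmorphB /= rmorphM /= linearZ /= !phiT H1 /wsa_A rmorph_prod.
  have := wmn_ge2 (bar a); rewrite /N.
  case: (_ * _)%N => [|[|k]] // _; rewrite !succnK (gpath_prod HR).
  apply/eqP; rewrite subr_eq0; apply/eqP; congr (_ *: _).
  by apply: eq_bigr => i _; rewrite -phiT.
- by rewrite rmorphM /= rmorphM /= !phiT H2.
- by rewrite rmorphM /= rmorphM /= !phiT H3.
Qed.

Hypothesis bip : gabriel_bipartite W.

Lemma N_neq3 a : (wm a == 1%N) && (tq_n a == 3)%N = false.
Proof.
apply/negP => /andP[/eqP m1 /eqP n3].
have N3 : N a = 3%N by rewrite /N m1 n3.
by case va : (virt a); [have := N_virt va|have := N_ge4 bip va]; rewrite N3.
Qed.

Lemma quot_wsa_rep :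
  wsa_rep (qE (wsa_relations W)) (qT (wsa_relations W)).
Proof.
have HR := quot_rep (wsa_relations W); split=> // a.
- have /(quot_rel (R := wsa_relations W)) := WsaRel1 a.
  rewrite rmorphB /= rmorphM /= linearZ /= /wsa_A rmorph_prod => /subr0_eq ->.
  congr (_ *: _); have := wmn_ge2 (bar a); rewrite /N.
  by case: (_ * _)%N => [|[|k]] // _; rewrite !succnK (gpath_prod HR).
- move=> va; have := @WsaRel2 K W a va; rewrite N_neq3 andbF => /(_ isT).
  by move/(quot_rel (R := wsa_relations W)); rewrite !rmorphM.
- move=> va; have := @WsaRel3 K W a va; rewrite N_neq3 andbF => /(_ isT).
  by move/(quot_rel (R := wsa_relations W)); rewrite !rmorphM.
Qed.

Section Identities.
Variables (L : algType K) (E : vert W -> L) (T : arr W -> L).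
Hypothesis H : wsa_rep E T.
Local Notation P := (gpath E T).
Let HR := wsa_quiver_rep H.

Lemma cneq0 a : c a != 0. Proof. exact: wc_neq0. Qed.

(** As [N (f y) = 2], the path [A] of the virtual arrow [f y] is that arrow itself. This makes the
    virtual arrows redundant as generators. *)
Lemma rel_II y : typI y -> T (g y) * T (bar (g (g y))) = c (f y) *: T (f y).
Proof.
by move=> Iy; rewrite -f_g (wsa_rep1 H) barg (N_virt Iy) (gpath1 HR).
Qed.

Lemma rel_V y : T (f y) * T (f (f y)) = c y *: P (g y) (N y).-1.
Proof. by rewrite (wsa_rep1 H) -gE c_g N_g. Qed.

Lemma rel_ffV y : typI y -> T (f (f y)) * T y = c (f y) *: T (g (f y)).
Proof.
move=> Iy; have := wsa_rep1 H (f (f y)); rewrite f3 -gE c_g N_g.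
by rewrite (N_virt Iy) (gpath1 HR).
Qed.

Lemma zero_II y : typI y -> T (g y) * T (g (g y)) * T (f (g (g y))) = 0.
Proof.
by move=> Iy; apply: (wsa_rep3 H); rewrite (typIIN bip (typII_g Iy)).
Qed.

Lemma zero_V y : typI y -> T (f y) * T (f (f y)) * T (bar y) = 0.
Proof.
move=> Iy; rewrite -gff; apply: (wsa_rep2 H).
by rewrite (virtN bip Iy).
Qed.

Lemma zero_V' y : typI y -> T (f y) * T (g (f y)) * T (g y) = 0.
Proof.
move=> Iy; rewrite -[in T (g y)](fgf_typI Iy); apply: (wsa_rep3 H).
by rewrite (virtN bip Iy).
Qed.

Lemma zero_I y : typI y -> T y * T (f y) * T (g (f y)) = 0.
Proof. by move=> Iy; apply: (wsa_rep2 H); rewrite (typIN bip Iy). Qed.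

Lemma typI_prev z : typII z -> exists2 y, typI y & g y = z.
Proof.
move=> IIz; exists (f (f (bar z))); last by rewrite gff barK.
by rewrite /typI f3 virt_barII.
Qed.

(** If [k] is even, the arrow leaving the orbit is virtual, and [zero_II] applies to it and the last
    two arrows of the path. If [k] is odd, the last arrow and the leaving one combine by [rel_II]
    into the virtual arrow that leaves one step earlier, which is the even case. *)
Lemma gpath_II_turn z k : typII z -> (2 <= k)%N ->
  P z k * T (bar (iter k g z)) = 0.
Proof.
move=> IIz k2; have [y Iy yz] := typI_prev IIz.
have Iyk j : typI (iter j g y) = ~~ odd j by exact: typI_iter.
have zk j : iter j g z = iter j.+1 g y by rewrite -yz iterSr.
have even_case j : (2 <= j)%N -> ~~ odd j -> P z j * T (bar (iter j g z)) = 0.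
  case: j => [|[|j]] // _; rewrite /= negbK => oj.
  have Ij : typI (iter j g y) by rewrite Iyk.
  have -> : bar (g (g (iter j g z))) = f (g (g (iter j g y))).
    by rewrite barg zk.
  rewrite !(gpathSr HR) -!mulrA mulrA iterS zk -iterS.
  by have := zero_II Ij; rewrite -mulrA /= -!mulrA => ->; rewrite mulr0.
have [/even_case->//|/negbNE ok] := boolP (~~ odd k).
case: k k2 ok => [|[|[|j]]] // _ ok.
rewrite (gpathSr HR) -mulrA zk.
have Ij : typI (iter j.+2 g y) by rewrite Iyk /= negbK; move: ok; rewrite /= negbK.
have -> : bar (iter j.+3 g z) = bar (g (g (iter j.+2 g y))) by rewrite zk.
rewrite (rel_II Ij) -scalerAr.
have -> : f (iter j.+2 g y) = bar (iter j.+2 g z) by rewrite zk barg.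
by rewrite even_case ?scaler0 //=; move: ok; rewrite /= !negbK.
Qed.

(** The first arrow is split off to reach a path of type II. Leaving after one or two steps gives
    multiples of [A] of the other orbit instead, as the next two lemmas show. *)
Lemma gpath_I_turn y k : typI y -> (3 <= k)%N ->
  P y k * T (bar (iter k g y)) = 0.
Proof.
case: k => // k Iy k2; rewrite gpathS -mulrA iterSr.
by rewrite gpath_II_turn ?mulr0 // typII_g.
Qed.

Lemma gpath_I_turn1 y : typI y ->
  P y 1 * T (f y) = c (bar y) *: P (bar y) (N (bar y)).-1.
Proof. by move=> _; rewrite (gpath1 HR) (wsa_rep1 H). Qed.

Lemma gpath_I_turn2 y : typI y ->
  P y 2 * T (bar (g (g y))) =
  (c (f y) * c (bar y)) *: P (bar y) (N (bar y)).-1.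
Proof.
move=> Iy; rewrite (gpath2 HR) -mulrA rel_II // -scalerAr (wsa_rep1 H).
by rewrite scalerA.
Qed.

Lemma iter_N1 a : iter (N a).-1 g (g a) = a.
Proof.
rewrite -iterSr prednK ?iter_N //.
by have := wmn_ge2 a; rewrite -/(N a); case: (N a).
Qed.

Lemma iter_N1' a : iter (N a).-1 g a = f (f (bar a)).
Proof.
apply: (@g_inj W); rewrite gff barK -iterS prednK ?iter_N //.
by have := wmn_ge2 a; rewrite -/(N a); case: (N a).
Qed.

Lemma N_prednK a : (N a).-1.+1 = N a.
Proof. by have := wmn_ge2 a; rewrite -/(N a); case: (N a). Qed.

Lemma gpath_N a : P a (N a) = T a * P (g a) (N a).-1.
Proof. by rewrite -{1}N_prednK. Qed.

Lemma gpath_Nr a : P a (N a) = P a (N a).-1 * T (f (f (bar a))).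
Proof. by rewrite -{1}N_prednK (gpathSr HR) iter_N1'. Qed.

(** The last two arrows of the triangle are combined here. Combining the first two instead gives the
    cycle of [bar y], whence [soc_bar]: the two cycles at [src y] are proportional. *)
Lemma soc_triangle y : T y * T (f y) * T (f (f y)) = c y *: P y (N y).
Proof. by rewrite -mulrA rel_V -scalerAr gpath_N. Qed.

Lemma soc_bar y : c y *: P y (N y) = c (bar y) *: P (bar y) (N (bar y)).
Proof.
by rewrite -soc_triangle (wsa_rep1 H) -scalerAl gpath_Nr barK.
Qed.

Lemma iter_Ng y : iter (N y) g (g y) = g y.
Proof. by rewrite -{1}N_g iter_N. Qed.

Lemma soc_mul y : typI y -> P y (N y) * T y = 0.
Proof.
move=> Iy; apply: (scalerI (cneq0 y)); rewrite scaler0 scalerAl -soc_triangle.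
by rewrite -(mulrA (T y * T (f y))) rel_ffV // -scalerAr zero_I // scaler0.
Qed.

Lemma soc_mul_bar y : typI y -> P y (N y) * T (bar y) = 0.
Proof.
move=> Iy; apply: (scalerI (cneq0 y)); rewrite scaler0 scalerAl soc_bar.
by rewrite -scalerAl soc_mul ?scaler0 ?typI_bar.
Qed.

Lemma gpath_ge y k : typI y -> (N y < k)%N -> P y k = 0.
Proof.
move=> Iy lt; rewrite -(subnKC lt) addSn -addnS (gpathD HR) gpathS.
by rewrite iter_N mulrA soc_mul // mul0r.
Qed.

(** Shifted by one arrow, the product is [T (g y)] times the cycle of [g (g y)]. That cycle is, up
    to a scalar, a triangle, whose first two arrows are killed by [T (g y)] through [zero_II]. *)
Lemma socII_mul y : typI y -> P (g y) (N y) * T (g y) = 0.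
Proof.
move=> Iy; have IIz := typII_g Iy.
have -> : P (g y) (N y) * T (g y) = P (g y) (N y).+1.
  by rewrite (gpathSr HR) iter_Ng.
have -> : P (g y) (N y).+1 = T (g y) * P (g (g y)) (N y) by [].
apply: (scalerI (cneq0 (g (g y)))); rewrite scaler0 scalerAr.
have -> : P (g (g y)) (N y) = P (g (g y)) (N (g (g y))) by rewrite !N_g.
rewrite -soc_triangle !mulrA.
by rewrite zero_II // mul0r.
Qed.

Lemma gpath_II_ge y k : typI y -> (N y < k)%N -> P (g y) k = 0.
Proof.
move=> Iy lt; rewrite -(subnKC lt) addSn -addnS (gpathD HR) gpathS.
by rewrite iter_Ng mulrA socII_mul // mul0r.
Qed.

Lemma socII_r y : P (g y) (N y) = P (g y) (N y).-1 * T y.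
Proof. by rewrite -{1}N_prednK (gpathSr HR) iter_N1. Qed.

Lemma virt_pair y : typI y ->
  T (f y) * T (g (f y)) = (c y / c (f y)) *: P (g y) (N y).
Proof.
move=> Iy; apply: (scalerI (cneq0 (f y))).
rewrite scalerAr -rel_ffV // mulrA rel_V -scalerAl -socII_r scalerA.
by rewrite mulrCA mulfV ?mulr1 ?cneq0.
Qed.

(* The generator of the second syzygy of the simple module at [tgt y]. *)
Definition syz_gen y : L :=
  (c (f y))^-1 *: (T (f (g y)) * T (f (f y))) - c y *: P (g (g y)) (N y).-2.

(** Both terms of [syz_gen y] become [T (f y) * T (f (f y))], the first by [rel_II] and the second
    by [rel_V]. Multiplying by [T y] on the right in [syz_gen_mul], both become
    [T (f (g y)) * T (g (f y))]. *)
Lemma mul_syz_gen y : typI y -> T (g y) * syz_gen y = 0.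
Proof.
move=> Iy; rewrite /syz_gen mulrBr -!scalerAr mulrA f_g rel_II // -scalerAl.
rewrite scalerA mulVf ?cneq0 // scale1r rel_V.
have := N_ge4 bip (typIN bip Iy).1.
by case: (N y) => [|[|k]] // _; rewrite subrr.
Qed.

Lemma syz_gen_mul y : typI y -> syz_gen y * T y = 0.
Proof.
move=> Iy; rewrite /syz_gen mulrBl -!scalerAl -mulrA rel_ffV // -scalerAr scalerA.
rewrite mulVf ?cneq0 // scale1r gf_typI // (wsa_rep1 H).
have -> : bar (f (g y)) = g (g y) by [].
rewrite !c_g !N_g; have := N_ge4 bip (typIN bip Iy).1.
have E2 : iter (N y).-2 g (g (g y)) = y -> P (g (g y)) (N y).-2 * T y =
    P (g (g y)) (N y).-2.+1 by move=> EE; rewrite (gpathSr HR) EE.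
rewrite E2; first by case: (N y) => [|[|k]] // _; rewrite subrr.
have E3 : (N y).-2.+2 = N y.
  by have := N_ge4 bip (typIN bip Iy).1; case: (N y) => [|[|k]].
by rewrite -!iterSr E3 iter_N.
Qed.

End Identities.
End WsaRep.

(** * Uniserial and projective modules *)

Section RowBasis.
Variables (K : fieldType) (n : nat).

(* Zero when [k] is out of range. *)
Definition bvec (k : nat) : 'rV[K]_n.+1 := \row_j (j == k :> nat)%:R.

Lemma bvec_out k : (n < k)%N -> bvec k = 0.
Proof.
move=> lt; apply/rowP => j; rewrite !mxE; case: eqP => // E.
by have := ltn_ord j; rewrite E ltnS leqNgt lt.
Qed.

Lemma bvec_delta (i : 'I_n.+1) : bvec i = delta_mx 0 i.
Proof. by apply/rowP => j; rewrite !mxE eqxx. Qed.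

Lemma bvec_row (i : 'I_n.+1) m (A : 'M[K]_(n.+1, m)) : bvec i *m A = row i A.
Proof. by rewrite bvec_delta rowE. Qed.

Lemma bvec_eq m (A B : 'M[K]_(n.+1, m)) :
  (forall i : 'I_n.+1, bvec i *m A = bvec i *m B) -> A = B.
Proof. by move=> H; apply/row_matrixP => i; rewrite -!bvec_row. Qed.

End RowBasis.

Arguments bvec {K n} k.

Section Uniserial.
Variables (K : fieldType) (W : weighted_tq K).
Implicit Types a b y : arr W.
Local Notation f := (tq_f W).
Local Notation g := (@tq_g W).
Local Notation bar := (@tq_bar W).
Local Notation N := (@arrN K W).

Variables (y : arr W) (n : nat).
Hypothesis short : (n.+2 <= N y)%N.

Let E (v : vert W) : 'M[K]_n.+1 :=
  \matrix_(i, j) ((src (iter i g y) == v) && (i == j))%:R.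
Let T (a : arr W) : 'M[K]_n.+1 :=
  \matrix_(i, j) ((a == iter i g y) && (j == i.+1 :> nat))%:R.

Let bvecE v k : bvec k *m E v = (src (iter k g y) == v)%:R *: bvec k.
Proof.
have [lt|ge] := ltnP k n.+1; last by rewrite bvec_out // mul0mx scaler0.
rewrite (bvec_row (Ordinal lt)); apply/rowP => j; rewrite !mxE /= -val_eqE /=.
by rewrite [k == j]eq_sym; case: (_ == v); case: (_ == _);
  rewrite /= ?mulr1 ?mulr0.
Qed.

Let bvecT a k : bvec k *m T a = (a == iter k g y)%:R *: bvec k.+1.
Proof.
have [lt|ge] := ltnP k n.+1; last by rewrite !bvec_out ?mul0mx ?scaler0 // ltnW.
rewrite (bvec_row (Ordinal lt)); apply/rowP => j; rewrite !mxE /=.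
by case: (_ == _); case: (_ == _); rewrite /= ?mulr1 ?mulr0.
Qed.

Let quiverT : quiver_rep E T.
Proof.
split=> [u v||a|a]; apply: bvec_eq => i.
- rewrite mulmxA bvecE -scalemxAl bvecE scalerA -natrM mulnb.
  have [->|ne] := eqVneq u v; first by rewrite andbb bvecE.
  rewrite mulmx0; case: eqP => [->|_]; last by rewrite scale0r.
  by rewrite (negbTE ne) scale0r.
- rewrite mulmx_sumr mulmx1 (bigD1 (src (iter i g y))) //= bvecE eqxx scale1r.
  rewrite big1 ?addr0 // => v ne; rewrite bvecE eq_sym (negbTE ne).
  exact: scale0r.
- rewrite mulmxA bvecE -scalemxAl bvecT; have [->|_] := eqVneq a _.
    by rewrite eqxx scale1r.
  by rewrite scale0r scaler0.
- rewrite mulmxA bvecT -scalemxAl bvecE; have [->|_] := eqVneq a _.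
    by rewrite /= src_g eqxx scale1r.
  by rewrite !scale0r.
Qed.

Let bvec_gpath a k l : bvec k *m gpath E T a l.+1 =
  (a == iter k g y)%:R *: bvec (k + l.+1).
Proof.
elim: l a k => [|l IHl] a k; first by rewrite (gpath1 quiverT) bvecT addn1.
rewrite gpathS mulmxA bvecT -scalemxAl IHl addSnnS.
have [->|_] := eqVneq a _; first by rewrite /= eqxx scale1r.
by rewrite !scale0r.
Qed.

Let turn0 a : T a * T (f a) = 0.
Proof.
apply: bvec_eq => i; rewrite mulmx0 mulmxA bvecT -scalemxAl bvecT.
have [->|_] := eqVneq a _; last by rewrite scale0r.
by rewrite scale1r /= f_neq_g scale0r.
Qed.

(** Every product [T a * T (f a)] leaves the orbit of [y] and is zero. The path [A] on the other
    side of relation (1) has length [N y - 1] if it acts at all, and by [short] this exceeds the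
    largest index [n]. *)
Lemma uniserial_rep : exists rho : {lrmorphism wsa W -> 'M[K]_n.+1},
  (forall v k, bvec k *m rho (qE (wsa_relations W) v) =
     (src (iter k g y) == v)%:R *: bvec k) /\
  (forall a k, bvec k *m rho (qT (wsa_relations W) a) =
     (a == iter k g y)%:R *: bvec k.+1).
Proof.
have /wsa_rep_hom[rho [rhoE rhoT]] : wsa_rep E T.
  split=> // [a|a _|a _].
  - rewrite turn0; apply: bvec_eq => i; rewrite mulmx0 -scalemxAr.
    have := wmn_ge2 (bar a); rewrite -/(N _).
    case EN : (N (bar a)) => [|[|k]] // _; rewrite succnK bvec_gpath.
    have [Ea|_] := eqVneq (bar a) _; last by rewrite scale0r scaler0.
    rewrite bvec_out ?scaler0 //; move: short EN; rewrite Ea N_iter => le Ek.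
    lia.
  - by rewrite turn0 mul0r.
  - by rewrite -mulrA turn0 mulr0.
by exists rho; split=> [v k|a k]; rewrite ?rhoE ?rhoT.
Qed.

End Uniserial.

(** * A matrix model of the projective module at a vertex of Gamma *)

Section ProjectiveRep.
Variables (K : fieldType) (W : weighted_tq K).
Hypothesis bip : gabriel_bipartite W.
Implicit Types a b : arr W.
Local Notation f := (tq_f W).
Local Notation g := (@tq_g W).
Local Notation bar := (@tq_bar W).
Local Notation c := (@wc K W).
Local Notation N := (@arrN K W).

Variable y : arr W.
Hypothesis Iy : typI y.

Definition both (s : bool) : arr W := if s then bar y else y.
Local Notation yy := both.
Let NN s := N (yy s).
(** The dimension [n + 1] is 1 for the idempotent, [NN s - 1] for each of the two orbits, and 1 for
    the common socle. *)
Let n := (NN false + NN true).-1.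

Lemma typI_both s : typI (yy s).
Proof. by case: s; rewrite //= typI_bar. Qed.

Lemma bar_both s : bar (yy s) = yy (~~ s).
Proof. by case: s; rewrite /= ?barK. Qed.

Let NN4 s : (4 <= NN s)%N.
Proof. by apply: (N_ge4 bip); rewrite (typIN bip (typI_both s)). Qed.

(* A basis of the right ideal of [E (src y)] is formed by the idempotent, at index
   0, the paths of length [0 < k < NN s] along [both s], and the common socle, at
   index [n]; [ww s k] is the coordinate vector of the path of length [k]. *)
Let idx s k : nat :=
  if k == 0%N then 0%N else if (k < NN s)%N then (if s then (NN false).-1 + k else k)%N
  else if k == NN s then n else n.+1.

(** A section of [idx]. The indices 0 and [n], shared by both orbits, are decoded along the orbit
    [false]. *)
Let dec (i : nat) : bool * nat :=
  if (i < NN false)%N then (false, i)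
  else if (i < n)%N then (true, i - (NN false).-1)%N else (false, NN false).

(** The factor at [k = NN s] is forced by [soc_bar]: each cycle times its parameter has to be the
    same vector. *)
Let ww s k : 'rV[K]_n.+1 :=
  (if k == NN s then (c (yy s))^-1 else 1) *: bvec (idx s k).

Let ww_out s k : (NN s < k)%N -> ww s k = 0.
Proof.
move=> lt; rewrite /ww bvec_out ?scaler0 // /idx.
have := NN4 s; case: eqP; first lia.
by rewrite [(k < _)%N]ltnNge (ltnW lt) /= gtn_eqF.
Qed.

Let ww0 s : ww s 0 = bvec 0.
Proof. by rewrite /ww; have := NN4 s; case: (NN s) => // k _; rewrite scale1r. Qed.

Let soc_ww s : c (yy s) *: ww s (NN s) = bvec n.
Proof.
rewrite /ww eqxx scalerA mulfV ?wc_neq0 // scale1r /idx ltnn eqxx.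
by have := NN4 s; case: eqP => [->|].
Qed.

Let ww_dec (i : 'I_n.+1) : exists2 x, x != 0 &
  bvec i = x *: ww (dec i).1 (dec i).2 :> 'rV[K]_n.+1.
Proof.
have nE : n = (NN false + NN true).-1 by [].
have n0 := NN4 false; have n1 := NN4 true; have := ltn_ord i; rewrite ltnS.
rewrite /dec; case: ltnP => [lt _|ge le].
  exists 1; rewrite ?oner_eq0 // scale1r /ww /idx /= ltn_eqF // scale1r lt.
  by case: eqP => [->|].
case: ltnP => [lt|ge']; last first.
  exists (c y); rewrite ?wc_neq0 //= (soc_ww false); congr bvec.
  by apply/eqP; rewrite eqn_leq le.
exists 1; rewrite ?oner_eq0 // scale1r /ww /idx /=.
have -> : (i - (NN false).-1 == NN true)%N = false by apply/eqP; lia.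
have -> : (i - (NN false).-1 == 0)%N = false by apply/eqP; lia.
have -> : (i - (NN false).-1 < NN true)%N by lia.
by rewrite scale1r; congr bvec; lia.
Qed.

Let idx_le s k : (k <= NN s)%N -> (idx s k < n.+1)%N.
Proof.
have nE : n = (NN false + NN true).-1 by [].
have n0 := NN4 false; have n1 := NN4 true; rewrite /idx.
move=> le; case: eqP => // _; case: (ltnP k (NN s)) => [lt|ge].
  by case: s lt {le} => lt; lia.
have -> : k = NN s by apply/eqP; rewrite eqn_leq le ge.
by rewrite eqxx.
Qed.

Let dec_idx s k : (k <= NN s)%N -> dec (idx s k) =
  if k == 0%N then (false, 0%N) else if k == NN s then (false, NN false)
  else (s, k).
Proof.
have nE : n = (NN false + NN true).-1 by [].
have n0 := NN4 false; have n1 := NN4 true; have s4 := NN4 s; rewrite /idx /dec.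
have [->|k0] := eqVneq k 0%N; first by rewrite (leq_trans _ n0).
rewrite leq_eqVlt => /orP[/eqP->|lt].
  rewrite ltnn eqxx ltnn; case: ltnP => //; lia.
rewrite lt ltn_eqF //; case: s lt s4 => lt s4; last by rewrite lt.
have -> : ((NN false).-1 + k < NN false)%N = false by apply/negbTE; rewrite -leqNgt; lia.
have -> : ((NN false).-1 + k < n)%N by lia.
by congr (_, _); lia.
Qed.

(** Besides the step along the orbit there are the two nonzero ways of leaving it, with the
    coefficients of [gpath_I_turn1] and [gpath_I_turn2]. *)
Let act s k b : 'rV[K]_n.+1 :=
  if k == 0%N then (b == yy s)%:R *: ww s 1 + (b == yy (~~ s))%:R *: ww (~~ s) 1
  else if (k < NN s)%N then
    (b == iter k g (yy s))%:R *: ww s k.+1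
    + (((k == 1%N) && (b == f (yy s)))%:R * c (yy (~~ s))) *:
        ww (~~ s) (NN (~~ s)).-1
    + (((k == 2%N) && (b == bar (iter 2 g (yy s))))%:R *
         (c (f (yy s)) * c (yy (~~ s)))) *: ww (~~ s) (NN (~~ s)).-1
  else 0.

Let E (v : vert W) : 'M[K]_n.+1 := \matrix_i
  ((src (iter (dec i).2 g (yy (dec i).1)) == v)%:R *: bvec i).
Let T (b : arr W) : 'M[K]_n.+1 := \matrix_i act (dec i).1 (dec i).2 b.

Let src_both s : src (yy s) = src y.
Proof. by case: s; rewrite /= ?src_bar. Qed.

Let iterNN s : iter (NN s) g (yy s) = yy s. Proof. exact: iter_N. Qed.

Let wwE s k v : ww s k *m E v = (src (iter k g (yy s)) == v)%:R *: ww s k.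
Proof.
have [gt|le] := ltnP (NN s) k; first by rewrite ww_out // mul0mx scaler0.
rewrite /ww -scalemxAl scalerA mulrC -scalerA; congr (_ *: _).
rewrite (bvec_row (Ordinal (idx_le le))) rowK /= dec_idx //.
have [->|_] := eqVneq k 0%N; first by rewrite /= src_both.
have [->|_] := eqVneq k (NN s); last by [].
by rewrite [in LHS]/= !iterNN (src_both s).
Qed.

Let wwT s k b : ww s k *m T b = act s k b.
Proof.
have [gt|le] := ltnP (NN s) k.
  rewrite ww_out // mul0mx /act; case: eqP gt => [->|_ gt]; first by rewrite ltn0.
  by rewrite ltnNge (ltnW gt).
rewrite {1}/ww -scalemxAl (bvec_row (Ordinal (idx_le le))) rowK /= dec_idx //.
have s4 := NN4 s; have f4 := NN4 false.
have [k0|k0] := eqVneq k 0%N.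
  by rewrite k0 ltn_eqF ?scale1r ?(leq_trans _ s4) // /act /=; case: (s) => //=;
    rewrite addrC.
case: eqP => [->|_] /=; last by rewrite scale1r.
by rewrite /act !ltnn !gtn_eqF ?scaler0 ?(leq_trans _ s4) ?(leq_trans _ f4).
Qed.

Let ww_eq (A B : 'M[K]_n.+1) :
  (forall s k, (k <= NN s)%N -> ww s k *m A = ww s k *m B) -> A = B.
Proof.
move=> AB; apply: bvec_eq => i; have [x _ ->] := ww_dec i.
rewrite -[LHS]scalemxAl -[RHS]scalemxAl; congr (_ *: _).
have [gt|le] := ltnP (NN (dec i).1) (dec i).2; last exact: AB.
by rewrite (ww_out gt) !mul0mx.
Qed.

Let act_src s k a : src (iter k g (yy s)) != src a -> act s k a = 0.
Proof.
move=> ne; have N0 x : src x = src (iter k g (yy s)) -> (a == x)%:R = 0 :> K.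
  by move=> Ex; case: eqP => // Ea; rewrite Ea Ex eqxx in ne.
rewrite /act; case: eqP => [k0|_].
  by rewrite !N0 ?k0 //= ?src_both // !scale0r addr0.
case: ltnP => // _; rewrite N0 // scale0r add0r.
have -> : ((k == 1%N) && (a == f (yy s)))%:R = 0 :> K.
  by case: eqP => //= k1; rewrite N0 // k1 /= src_g src_f.
have -> : ((k == 2%N) && (a == bar (iter 2 g (yy s))))%:R = 0 :> K.
  by case: eqP => //= k2; rewrite N0 // k2 /= src_bar.
by rewrite !mul0r !scale0r addr0.
Qed.

Let src_last s : src (iter (NN (~~ s)).-1 g (yy (~~ s))) = tgt (f (yy s)).
Proof. by rewrite iter_N1' bar_both negbK src_f. Qed.

Let act_tgt s k a : act s k a *m E (tgt a) = act s k a.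
Proof.
have wE s' k' x : (a == x) -> src (iter k' g (yy s')) = tgt x ->
    ww s' k' *m E (tgt a) = ww s' k'.
  by move=> /eqP-> Ex; rewrite wwE Ex eqxx scale1r.
have step (d : bool) s' k' (x : K) : (d -> src (iter k' g (yy s')) = tgt a) ->
    (d%:R * x) *: ww s' k' *m E (tgt a) = (d%:R * x) *: ww s' k'.
  case: d => [/(_ isT) Ex|_]; last by rewrite mul0r !scale0r mul0mx.
  by rewrite mul1r -scalemxAl wwE Ex eqxx scale1r.
have step' (d : bool) s' k' : (d -> src (iter k' g (yy s')) = tgt a) ->
    d%:R *: ww s' k' *m E (tgt a) = d%:R *: ww s' k'.
  by move=> Hd; have := step d s' k' 1 Hd; rewrite mulr1.
rewrite /act; case: eqP => _.
  by rewrite mulmxDl !step' // => /eqP->; rewrite /= src_g.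
case: ltnP => _; last by rewrite mul0mx.
rewrite !mulmxDl step'; last by move=> /eqP->; rewrite /= src_g.
rewrite !step // => /andP[_ /eqP->]; rewrite src_last //=.
rewrite barg -!src_f -gf_typI ?src_g ?src_f //; exact: typI_both.
Qed.

Let quiverT : quiver_rep E T.
Proof.
split=> [u v||a|a]; apply: ww_eq => s k _.
- rewrite mulmxA wwE -scalemxAl wwE scalerA -natrM mulnb.
  have [->|ne] := eqVneq u v; first by rewrite andbb wwE.
  rewrite mulmx0; case: eqP => [->|_]; last by rewrite scale0r.
  by rewrite (negbTE ne) scale0r.
- rewrite mulmx_sumr mulmx1 (bigD1 (src (iter k g (yy s)))) //= wwE eqxx scale1r.
  rewrite big1 ?addr0 // => v ne; rewrite wwE eq_sym (negbTE ne).
  exact: scale0r.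
- rewrite mulmxA wwE -scalemxAl wwT; case: eqP => [_|/eqP ne].
    by rewrite scale1r.
  by rewrite act_src ?scaler0.
- by rewrite mulmxA wwT act_tgt.
Qed.

Let ww_g s k : ww s k *m T (iter k g (yy s)) = ww s k.+1.
Proof.
have s4 := NN4 s; rewrite wwT /act; case: eqP => [->|k0] /=.
  by rewrite -bar_both neq_bar eqxx scale1r scale0r addr0.
case: ltnP => [lt|ge]; last by rewrite ww_out.
rewrite eqxx scale1r.
have -> : (k == 1%N) && (iter k g (yy s) == f (yy s)) = false.
  by case: eqP => //= ->; rewrite eq_sym f_neq_g.
have -> : (k == 2%N) && (iter k g (yy s) == bar (g (g (yy s)))) = false.
  by case: eqP => //= ->; rewrite neq_bar.
by rewrite !mul0r !scale0r !addr0.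
Qed.

Let ww_soc s k b : (NN s <= k)%N -> ww s k *m T b = 0.
Proof.
move=> le; rewrite wwT /act ltnNge le /=; have := NN4 s.
by case: eqP le => [->|//]; rewrite leqn0 => /eqP->.
Qed.

Let ww_turn s k b : (2 < k)%N -> b != iter k g (yy s) -> ww s k *m T b = 0.
Proof.
move=> k3 ne; rewrite wwT /act !gtn_eqF ?(leq_trans _ k3) //= (negbTE ne).
by rewrite !mul0r !scale0r !addr0; case: ifP.
Qed.

Let ww1 s : ww s 1 *m T (f (yy s)) = c (yy (~~ s)) *: ww (~~ s) (NN (~~ s)).-1.
Proof.
rewrite wwT /act /= (leq_trans _ (NN4 s)) // f_neq_g eqxx.
by rewrite mul0r !scale0r add0r mul1r addr0.
Qed.

Let ww2 s : ww s 2 *m T (bar (g (g (yy s)))) =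
  (c (f (yy s)) * c (yy (~~ s))) *: ww (~~ s) (NN (~~ s)).-1.
Proof.
rewrite wwT /act /= (leq_trans _ (NN4 s)) // bar_neq eqxx.
by rewrite mul0r !scale0r !add0r mul1r.
Qed.

Let ww_path s k l : ww s k *m gpath E T (iter k g (yy s)) l = ww s (k + l)%N.
Proof.
elim: l k => [|l IHl] k; first by rewrite addn0 gpath0 wwE eqxx scale1r.
by rewrite gpathS mulmxA ww_g (IHl k.+1) addSnnS.
Qed.

Let ww_last s b : b != f (f (yy s)) ->
  ww (~~ s) (NN (~~ s)).-1 *m T b = 0.
Proof.
move=> ne; apply: ww_turn; first by have := NN4 (~~ s); lia.
by rewrite iter_N1' bar_both negbK.
Qed.

Let ww_last_ff s : ww (~~ s) (NN (~~ s)).-1 *m T (f (f (yy s))) = ww (~~ s) (NN (~~ s)).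
Proof.
have {1}-> : f (f (yy s)) = iter (NN (~~ s)).-1 g (yy (~~ s)).
  by rewrite iter_N1' bar_both negbK.
by rewrite ww_g prednK // (leq_trans _ (NN4 (~~ s))).
Qed.

Let two_arrows s k a (X Y : 'rV[K]_n.+1) :
  (src a != src (iter k g (yy s)) -> X = Y) ->
  (a = iter k g (yy s) -> X = Y) -> (a = bar (iter k g (yy s)) -> X = Y) -> X = Y.
Proof.
move=> H0 H1 H2; have [E1|/H0//] := eqVneq (src a) (src (iter k g (yy s))).
have := src_eq (iter k g (yy s)) a; rewrite E1 eqxx => /esym/orP[]/eqP.
  exact: H1.
exact: H2.
Qed.

Let wsT1 a : T a * T (f a) = c (bar a) *: gpath E T (bar a) (N (bar a)).-1.
Proof.
apply: ww_eq => s k le; have Iyy := typI_both s.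
have N'E : N (yy (~~ s)) = NN (~~ s) by [].
have gE1 b : gpath E T b (N b).-1 = T b * gpath E T (g b) (N b).-2.
  by have := wmn_ge2 b; rewrite -/(N _); case: (N b) => [|[|m]].
rewrite -scalemxAr mulmxA; apply: (@two_arrows s k a) => [ne|Ea|Ea].
- rewrite wwT act_src 1?eq_sym // mul0mx gE1 mulmxA wwT act_src ?mul0mx ?scaler0 //.
  by rewrite src_bar eq_sym.
- rewrite Ea ww_g; case: k le Ea => [|[|[|k]]] le Ea.
  + rewrite ww1 /= bar_both ww0 -(ww0 (~~ s)).
    by rewrite (ww_path (~~ s) 0).
  + rewrite /= f_g ww2 /= barg (N_virt Iyy) (gpath1 quiverT) ww1.
    by rewrite [RHS]scalerA.
  + rewrite ww_turn //=; last by rewrite f_neq_g.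
    rewrite gE1 mulmxA ww2 -scalemxAl /= -f_g gfg_typI //.
    have -> : f (f (yy s)) = iter (NN (~~ s)).-1 g (yy (~~ s)).
      by rewrite iter_N1' bar_both negbK.
    rewrite ww_path ww_out ?scaler0 //.
    (* The turn lands on index [NN (~~ s) - 1], and at least two arrows of the path [A] remain, one
       more than this vector survives. *)
    have : (4 <= N (f (g (yy s))))%N.
      by apply: (N_ge4 bip); rewrite f_g (typIN bip) // typI_bar // typI_gg.
    have := NN4 (~~ s); move: (NN _) (N _) => p q; lia.
  + rewrite ww_turn //=; last by rewrite f_neq_g.
    rewrite gE1 mulmxA ww_turn ?mul0mx ?scaler0 //=.
    by rewrite bar_neq.
- rewrite Ea barK; case: k le Ea => [|[|[|k]]] le Ea.
  + rewrite /= bar_both ww0 -(ww0 (~~ s)) (ww_g (~~ s) 0) ww1 negbK ww0 -(ww0 s).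
    by rewrite (ww_path s 0).
  + rewrite /= barg ww1 -scalemxAl ww_last_ff N_g c_g.
    rewrite (ww_path s 1) add1n prednK ?(leq_trans _ (NN4 s)) //.
    by rewrite !soc_ww.
  + rewrite ww2 -scalemxAl /= -f_g ww_last; last first.
      by rewrite -gf_typI // gE bar_neq.
    rewrite scaler0 !N_g (ww_path s 2) ww_out ?scaler0 //.
    by have := NN4 s; rewrite /NN; lia.
  + rewrite ww_turn ?mul0mx //=; last by rewrite bar_neq.
    rewrite -!iterS N_iter ww_path ww_out ?scaler0 //.
    by have := NN4 s; rewrite /NN; lia.
Qed.

Let ww_last_g s : ww (~~ s) (NN (~~ s)).-1 *m T (g (f (yy s))) = 0.
Proof.
apply: ww_last; rewrite gf_typI; last exact: typI_both.
by rewrite -gf_typI ?typI_both // gE bar_neq.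
Qed.

Let wsT2 a : ~~ typII a -> T a * T (f a) * T (g (f a)) = 0.
Proof.
move=> nII; apply: ww_eq => s k le; have Iyy := typI_both s.
rewrite mulmx0 !mulmxA; apply: (@two_arrows s k a) => [ne|Ea|Ea].
- by rewrite wwT act_src 1?eq_sym // !mul0mx.
- rewrite Ea in nII *; rewrite ww_g; case: k le Ea nII => [|[|k]] le Ea nII.
  + by rewrite ww1 -scalemxAl ww_last_g scaler0.
  + by rewrite typII_g in nII.
  + by rewrite ww_turn ?mul0mx //= f_neq_g.
- rewrite Ea; case: k le Ea => [|[|[|k]]] le Ea.
  + rewrite /= bar_both ww0 -(ww0 (~~ s)) (ww_g (~~ s) 0) ww1 -scalemxAl.
    by rewrite ww_last_g scaler0.
  + by rewrite /= barg ww1 -scalemxAl ww_last_ff -scalemxAl ww_soc ?scaler0.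
  + rewrite ww2 -2!scalemxAl /= -f_g ww_last ?mul0mx ?scaler0 //.
    by rewrite -gf_typI // gE bar_neq.
  + by rewrite ww_turn ?mul0mx //= bar_neq.
Qed.

Let wsT3 a : ~~ typI a -> T a * T (g a) * T (f (g a)) = 0.
Proof.
move=> nI; apply: ww_eq => s k le; have Iyy := typI_both s.
rewrite mulmx0 !mulmxA; apply: (@two_arrows s k a) => [ne|Ea|Ea].
- by rewrite wwT act_src 1?eq_sym // !mul0mx.
- rewrite Ea in nI *; rewrite ww_g; case: k le Ea nI => [|k] le Ea nI.
    by rewrite Iyy in nI.
  rewrite -iterS ww_g.
  by rewrite ww_turn //= f_neq_g.
- rewrite Ea in nI *; case: k le Ea nI => [|[|[|k]]] le Ea nI.
  + by rewrite (typI_bar bip) Iyy in nI.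
  + by rewrite /= barg ww1 -2!scalemxAl ww_last_g mul0mx scaler0.
  + by rewrite (typI_bar bip) (typI_iter bip) in nI.
  + by rewrite ww_turn ?mul0mx //= bar_neq.
Qed.

Let ww_coord s k s' k' : (k <= NN s)%N -> (k' <= NN s')%N ->
  (if k == NN s then c (yy s) else 1) * ww s' k' 0 (inord (idx s k)) =
  if k == 0%N then (k' == 0%N)%:R
  else if k == NN s then if k' == NN s' then c (yy s) / c (yy s') else 0
  else ((s == s') && (k == k'))%:R.
Proof.
move=> le le'; rewrite /ww !mxE inordK ?idx_le //.
have := dec_idx le; have := dec_idx le'; case: (idx s k =P idx s' k') => [->|ne].
  move=> -> /eqP; have s4 := NN4 s; have s4' := NN4 s'; have f4 := NN4 false.
  have [->|k'0] := eqVneq k' 0%N; have [->|k0] := eqVneq k 0%N => /=.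
  - by rewrite !ltn_eqF ?mulr1 // (leq_trans _ s4, leq_trans _ s4').
  - case: (eqVneq k (NN s)) => [_|_]; rewrite xpair_eqE /=.
      by rewrite ltn_eqF // (leq_trans _ f4).
    by rewrite [0%N == k]eq_sym (negbTE k0) andbF.
  - case: (eqVneq k' (NN s')) => [_|_]; rewrite xpair_eqE /=.
      by rewrite gtn_eqF // (leq_trans _ f4).
    by rewrite (negbTE k'0) andbF.
  - have [Ek|kN] := eqVneq k (NN s); have [Ek'|kN'] := eqVneq k' (NN s') => //=.
    + by rewrite mulr1.
    + by move=> /eqP[Es Ek2]; rewrite Es Ek2 eqxx in kN'.
    + by move=> /eqP[Es Ek2]; rewrite -Es -Ek2 eqxx in kN.
    + by move=> /eqP[-> ->]; rewrite !eqxx !mulr1.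
move=> _ _; rewrite mulr0n mulr0 mulr0; case: (eqVneq k 0%N) => [k0|k0].
  case: eqP => // k'0; case: ne; by rewrite /idx k0 k'0.
case: (eqVneq k (NN s)) => [kN|kN].
  case: (eqVneq k' (NN s')) => // kN'; case: ne; rewrite /idx kN kN' !ltnn !eqxx.
  by rewrite !gtn_eqF // (leq_trans _ (NN4 _)).
by case: eqP => //= ss; case: eqP => // kk; case: ne; rewrite ss kk.
Qed.

(** The forms are the coordinates of the image of the generator [bvec 0]. They make the spanning set
    of [spanI_full] independent, apart from its double idempotent. The quotient
    [c (yy s) / c (yy s')] reflects the proportionality of the two cycles. *)
Lemma proj_coord : exists phi : bool -> nat -> {linear wsa W -> K^o},
  forall s k s' k', (k <= N (yy s))%N -> (k' <= N (yy s'))%N ->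
  phi s k (gpath (qE (wsa_relations W)) (qT (wsa_relations W)) (yy s') k') =
  if k == 0%N then (k' == 0%N)%:R
  else if k == N (yy s) then if k' == N (yy s') then c (yy s) / c (yy s') else 0
  else ((s == s') && (k == k'))%:R.
Proof.
have /wsa_rep_hom[rho [rhoE rhoT]] : wsa_rep E T by split.
pose phi s k (x : wsa W) : K^o :=
  (if k == NN s then c (yy s) else 1) * (bvec 0 *m rho x) 0 (inord (idx s k)).
have phiL s k : linear (phi s k).
  move=> a x x'; rewrite /phi linearP /= mulmxDr -scalemxAr !mxE mulrDr.
  by rewrite mulrCA.
exists (fun s k => lin_of (phiL s k)) => s k s' k' le le'; rewrite lin_ofE.
rewrite /phi (gpath_morph _ _ rhoE rhoT) -(ww0 s') (ww_path s' 0) add0n.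
exact: ww_coord.
Qed.

End ProjectiveRep.

(** * Kernels of left multiplications *)

Section Kernels.
Variables (K : fieldType) (W : weighted_tq K).
Hypothesis bip : gabriel_bipartite W.
Implicit Types (a b y z : arr W) (u v q : wsa W).
Local Notation f := (tq_f W).
Local Notation g := (@tq_g W).
Local Notation bar := (@tq_bar W).
Local Notation c := (@wc K W).
Local Notation N := (@arrN K W).
Local Notation E := (qE (wsa_relations W)).
Local Notation T := (qT (wsa_relations W)).
Local Notation P := (gpath E T).
Local Notation pP := (gpath (@pa_idem W K) (@pa_arr W K)).
Local Notation both := (@both K W).
Let H : wsa_rep E T := quot_wsa_rep bip.
Let HR : quiver_rep E T := wsa_quiver_rep H.

Lemma N_bar4 y : typI y -> (4 <= N y)%N /\ (4 <= N (bar y))%N.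
Proof.
by move=> Iy; split; apply: (N_ge4 bip); rewrite (typIN bip) ?typI_bar.
Qed.

Lemma gpath_I_mul y k b : typI y -> exists x s j, P y k * T b = x *: P (both y s) j.
Proof.
move=> Iy; have [E1|ne] := eqVneq (src b) (src (iter k g y)); last first.
  by exists 0, false, 0%N; rewrite (gpath_mul0 HR) ?scale0r.
have := src_eq (iter k g y) b; rewrite E1 eqxx => /esym/orP[]/eqP->.
  by exists 1, false, k.+1; rewrite scale1r -(gpathSr HR).
case: k {E1} => [|[|[|k]]].
- exists 1, true, 1%N; rewrite scale1r (gpath1 HR) /= gpath0 -(src_bar y).
  exact: (rep_src HR).
- exists (c (bar y)), true, (N (bar y)).-1.
  by rewrite /= barg (gpath_I_turn1 H).
- exists (c (f y) * c (bar y)), true, (N (bar y)).-1.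
  by rewrite /= (gpath_I_turn2 H).
- by exists 0, false, 0%N; rewrite (gpath_I_turn bip H) ?scale0r.
Qed.

(** The idempotent occurs in both sums, as length 0. The socle occurs only in the first, since the
    two cycles are proportional. *)
Definition spanI y u : Prop := exists a b : nat -> K,
  u = \sum_(k < (N y).+1) a k *: P y k + \sum_(k < N (bar y)) b k *: P (bar y) k.

Lemma spanI_add y u v : spanI y u -> spanI y v -> spanI y (u + v).
Proof.
move=> [a [b ->]] [a' [b' ->]].
exists (fun k => a k + a' k), (fun k => b k + b' k); rewrite addrACA -!big_split.
by congr (_ + _); apply: eq_bigr => k _; rewrite scalerDl.
Qed.

Lemma spanI_scale y x u : spanI y u -> spanI y (x *: u).
Proof.
move=> [a [b ->]]; exists (fun k => x * a k), (fun k => x * b k).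
rewrite scalerDr !scaler_sumr.
by congr (_ + _); apply: eq_bigr => k _; rewrite scalerA.
Qed.

Lemma spanI0 y : spanI y 0.
Proof.
exists (fun=> 0), (fun=> 0).
by rewrite !big1 ?addr0 // => k _; rewrite scale0r.
Qed.

Lemma sum_pick n (k : 'I_n) (F : nat -> wsa W) :
  \sum_(i < n) (i == k :> nat)%:R *: F i = F k.
Proof.
rewrite (bigD1 k) //= eqxx scale1r big1 ?addr0 // => i ne.
by rewrite (negbTE (_ : val i != val k)) ?scale0r.
Qed.

Lemma spanI_path y s k : typI y -> spanI y (P (both y s) k).
Proof.
move=> Iy; have Iy' : typI (bar y) by rewrite typI_bar.
have path_y j : spanI y (P y j).
  have [le|gt] := leqP j (N y); last first.
    by rewrite (gpath_ge bip H) //; exact: spanI0.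
  exists (fun i => (i == j)%:R), (fun=> 0).
  rewrite [X in _ + X]big1 ?addr0; last by move=> i _; rewrite scale0r.
  by rewrite (sum_pick (Ordinal (le : j < (N y).+1)%N)).
case: s => //=; have [lt|] := ltnP k (N (bar y)).
  exists (fun=> 0), (fun i => (i == k)%:R).
  rewrite [X in X + _]big1 ?add0r; last by move=> i _; rewrite scale0r.
  by rewrite (sum_pick (Ordinal lt)).
rewrite leq_eqVlt => /orP[/eqP<-|gt]; last first.
  by rewrite (gpath_ge bip H) //; exact: spanI0.
have -> : P (bar y) (N (bar y)) = ((c (bar y))^-1 * c y) *: P y (N y).
  by rewrite -scalerA (soc_bar H) scalerA mulVf ?scale1r ?wc_neq0.
exact: spanI_scale.
Qed.

Lemma big_span (D : wsa W -> Prop) n (a : 'I_n -> K) (F : 'I_n -> wsa W) :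
  D 0 -> (forall u v, D u -> D v -> D (u + v)) ->
  (forall x u, D u -> D (x *: u)) -> (forall k, D (F k)) ->
  D (\sum_(k < n) a k *: F k).
Proof.
move=> D0 DD DZ DF; elim/big_ind: _ => // k _; exact/DZ/DF.
Qed.

Lemma spanI_full y u : typI y -> spanI y (E (src y) * u).
Proof.
move=> Iy; have Iy' : typI (bar y) by rewrite typI_bar.
have span_sum (X : wsa W) : (forall s k, spanI y (P (both y s) k * X)) ->
    forall v, spanI y v -> spanI y (v * X).
  move=> HX v [a [b ->]]; rewrite mulrDl; apply: spanI_add; rewrite mulr_suml.
    under eq_bigr do rewrite -scalerAl.
    apply: (@big_span (spanI y)) => [|||k];
    [exact: spanI0|exact: spanI_add|exact: spanI_scale|].
    exact: (HX false).
  under eq_bigr do rewrite -scalerAl.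
  apply: (@big_span (spanI y)) => [|||k];
    [exact: spanI0|exact: spanI_add|exact: spanI_scale|].
  exact: (HX true).
apply: (quot_right_ideal (D := spanI y)).
- exact: spanI_add.
- exact: spanI_scale.
- move=> v w; apply: span_sum => s k; rewrite -(gpath_tgt HR) -mulrA (rep_orth HR).
  case: eqP => [_|_]; last by rewrite mulr0; exact: spanI0.
  by rewrite (gpath_tgt HR); exact: spanI_path.
- move=> v b; apply: span_sum => s k.
  have Is : typI (both y s) by case: (s).
  have [x [s' [j ->]]] := gpath_I_mul k b Is; apply: spanI_scale.
  have -> : both (both y s) s' = both y (s (+) s').
    by case: (s); case: (s'); rewrite //= barK.
  exact: spanI_path.
- exact: (spanI_path false 0 Iy).
Qed.

Definition spanII y u : Prop := exists (a : nat -> K) (d : K),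
  u = \sum_(k < (N y).+1) a k *: P (g y) k + d *: T (f y).

(** A path along [g y] that leaves its orbit at once or after one step gives a multiple of
    [T (f y)], and later it gives 0. From [T (f y)] one arrow leads to [A] by [rel_V] and the other
    one to the socle by [virt_pair]. *)
Lemma spanII_full y u : typI y -> spanII y (E (tgt y) * u).
Proof.
move=> Iy; have IIz := typII_g Iy.
have D0 : spanII y 0.
  exists (fun=> 0), 0; rewrite scale0r addr0 big1 // => k _; exact: scale0r.
have DD v w : spanII y v -> spanII y w -> spanII y (v + w).
  move=> [a [d ->]] [a' [d' ->]]; exists (fun k => a k + a' k), (d + d').
  rewrite addrACA -big_split scalerDl; congr (_ + _).
  by apply: eq_bigr => k _; rewrite scalerDl.
have DZ x v : spanII y v -> spanII y (x *: v).
  move=> [a [d ->]]; exists (fun k => x * a k), (x * d).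
  rewrite scalerDr scaler_sumr scalerA; congr (_ + _).
  by apply: eq_bigr => k _; rewrite scalerA.
have Df x : spanII y (x *: T (f y)).
  exists (fun=> 0), x; rewrite big1 ?add0r // => k _; exact: scale0r.
have Dp k : spanII y (P (g y) k).
  have [le|gt] := leqP k (N y); last by rewrite (gpath_II_ge bip H).
  exists (fun i => (i == k)%:R), 0; rewrite scale0r addr0.
  by rewrite (sum_pick (Ordinal (le : k < (N y).+1)%N)).
have span_sum (X : wsa W) : (forall k, spanII y (P (g y) k * X)) ->
    spanII y (T (f y) * X) -> forall v, spanII y v -> spanII y (v * X).
  move=> HX HX' v [a [d ->]]; rewrite mulrDl; apply/DD; last first.
    by rewrite -scalerAl; apply/DZ.
  rewrite mulr_suml; under eq_bigr do rewrite -scalerAl.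
  by apply: (@big_span (spanII y) _ _ _ D0 DD DZ) => k; exact: HX.
apply: (quot_right_ideal (D := spanII y)) => //.
- move=> v w; apply: span_sum => [k|].
    rewrite -(gpath_tgt HR) -mulrA (rep_orth HR).
    case: eqP => [_|_]; last by rewrite mulr0.
    by rewrite (gpath_tgt HR).
  rewrite -(rep_tgt HR) -mulrA (rep_orth HR); case: eqP => [_|_].
    by rewrite (rep_tgt HR) -[T _]scale1r.
  by rewrite mulr0.
- move=> v b; apply: span_sum => [k|].
    have [E1|ne] := eqVneq (src b) (src (iter k g (g y))); last first.
      by rewrite (gpath_mul0 HR).
    have := src_eq (iter k g (g y)) b; rewrite E1 eqxx => /esym/orP[]/eqP->.
      by rewrite -(gpathSr HR).
    case: k {E1} => [|[|k]]; last by rewrite (gpath_II_turn bip H).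
      rewrite gpath0 /= barg src_g -src_f (rep_src HR) -[T _]scale1r; exact: Df.
    by rewrite (gpath1 HR) /= (rel_II H).
  have [E1|ne] := eqVneq (src b) (src (f (f y))); last first.
    by rewrite (rep_mul0 HR) // -src_f eq_sym.
  have := src_eq (f (f y)) b; rewrite E1 eqxx => /esym/orP[]/eqP->.
    by rewrite (rel_V H); apply: DZ.
  have -> : bar (f (f y)) = g (f y) by [].
  by rewrite (virt_pair H) //; apply: DZ.
- by rewrite -src_g; exact: (Dp 0%N).
Qed.

Lemma sum_delta n (a : nat -> K) k : (k < n)%N ->
  \sum_(i < n) a i * (i == k :> nat)%:R = a k.
Proof.
move=> lt; rewrite (bigD1 (Ordinal lt)) //= eqxx mulr1 big1 ?addr0 // => i ne.
by rewrite (negbTE (_ : val i != k)) ?mulr0.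
Qed.

(* [P (g y) (N y)] spans the socle of the right ideal of [E (tgt y)]. *)
Lemma ker_mul_I y u : typI y -> E (tgt y) * u = u -> T y * u = 0 ->
  exists x, u = x *: P (g y) (N y).
Proof.
move=> Iy uE yu; have [n4 n4'] := N_bar4 Iy.
have [a [d Eu]] := spanII_full u Iy; rewrite uE in Eu.
have [phi phiE] := proj_coord bip Iy.
have yuE : \sum_(k < N y) a k *: P y k.+1 +
    (d * c (bar y)) *: P (bar y) (N (bar y)).-1 = 0.
  have soc0 : T y * P (g y) (N y) = 0 by rewrite -gpathS (gpath_ge bip H).
  rewrite -[RHS]yu Eu mulrDr mulr_sumr big_ord_recr /= -!scalerAr soc0.
  rewrite scaler0 addr0 (wsa_rep1 H) scalerA.
  by congr (_ + _); apply: eq_bigr => k _; rewrite -scalerAr.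
have a0 k : (k < N y)%N -> a k = 0.
  move=> lt; have := congr1 (phi false k.+1) yuE.
  rewrite linearD linear_sum linear0 linearZ /=.
  rewrite (phiE false k.+1 true) ?leq_pred //=.
  rewrite (eq_bigr (fun i : 'I_(N y) => a i * (i == k :> nat)%:R)); last first.
    move=> i _; rewrite linearZ /= (phiE false k.+1 false) //= eqSS.
    case: (eqVneq k.+1 (N y)) => [kN|_]; last by rewrite [k == i]eq_sym.
    rewrite -[X in _ == X]kN eqSS.
    by case: eqP => // _; rewrite divff ?wc_neq0.
  rewrite sum_delta //.
  have -> : ((N (bar y)).-1 == N (bar y)) = false by apply/eqP; lia.
  by case: ifP => _; rewrite scaler0 addr0.
have d0 : d = 0.
  have := congr1 (phi true (N (bar y)).-1) yuE.
  rewrite linearD linear_sum linear0 linearZ /= big1; last first.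
    by move=> i _; rewrite a0 // scale0r linear0.
  rewrite (phiE true _ true) ?leq_pred //=.
  have -> : ((N (bar y)).-1 == N (bar y)) = false by apply/eqP; lia.
  have -> : ((N (bar y)).-1 == 0)%N = false by apply/eqP; lia.
  rewrite eqxx add0r -[_ *: _]/(_ * _) mulr1 => dc0.
  by apply: (mulIf (wc_neq0 (bar y))); rewrite mul0r.
exists (a (N y)); rewrite Eu d0 scale0r addr0 big_ord_recr /= big1 ?add0r // => i _.
by rewrite a0 ?scale0r.
Qed.

(** [quot_presentation] at [src a0], where only [a0] and [bar a0] start. The six conditions on [D]
    that name arrows are the pairs of remainders of the relations starting there; the two with sums
    come from relation (1) at [a0] and at [bar a0]. *)
Lemma wsa_presentation a0 (D : wsa W -> wsa W -> Prop) :
  D 0 0 ->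
  (forall u v u' v', D u u' -> D v v' -> D (u + v) (u' + v')) ->
  (forall u u' q, D u u' -> D (u * q) (u' * q)) ->
  D (T (f a0)) (- (c (bar a0) *: P (g (bar a0)) (N (bar a0)).-2)) ->
  D (- (c a0 *: P (g a0) (N a0).-2)) (T (f (bar a0))) ->
  (~~ typII a0 -> D (T (f a0) * T (g (f a0))) 0) ->
  (~~ typII (bar a0) -> D 0 (T (f (bar a0)) * T (g (f (bar a0))))) ->
  (~~ typI a0 -> D (T (g a0) * T (f (g a0))) 0) ->
  (~~ typI (bar a0) -> D 0 (T (g (bar a0)) * T (f (g (bar a0))))) ->
  forall u u', E (tgt a0) * u = u -> E (tgt (bar a0)) * u' = u' ->
    T a0 * u + T (bar a0) * u' = 0 -> D u u'.
Proof.
move=> D0 DD DM D1 D1' D2 D2' D3 D3' u u' uE uE' uu'.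
pose D' (w : arr W -> wsa W) := D (w a0) (w (bar a0)).
have pid := rep_id W K.
have pi_pP a k : quot_pi (wsa_relations W) (pP a k) = P a k.
  exact: (gpath_morph (phi := quot_pi (wsa_relations W))).
have b0 : bar a0 != a0 by rewrite bar_neq.
pose w a := if a == a0 then u else if a == bar a0 then u' else 0.
suff : D' w by rewrite /D' /w eqxx bar_neq eqxx.
apply: (@quot_presentation _ _ (wsa_relations W) (src a0) D').
- exact: D0.
- by move=> x x' Dx Dx'; apply: DD.
- by move=> x q Dx; apply: DM.
- have src_mem b : src b == src a0 -> b = a0 \/ b = bar a0.
    by rewrite src_eq => /orP[]/eqP; [left|right].
  have one b (X : pathalg W K) : pa_idem K (tgt b) * X = X ->
      (b = a0 -> D (quot_pi (wsa_relations W) X) 0) ->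
      (b = bar a0 -> D 0 (quot_pi (wsa_relations W) X)) ->
      exists Y : arr W -> pathalg W K,
        [/\ pa_arr K b * X = \sum_a pa_arr K a * Y a,
            forall a, pa_idem K (tgt a) * Y a = Y a
          & D' (fun a => if src a == src a0 then
              quot_pi (wsa_relations W) (Y a) else 0)].
    move=> XE H0 H1; exists (fun a => if a == b then X else 0); split.
    + rewrite (bigD1 b) //= eqxx big1 ?addr0 // => a /negbTE->.
      exact: mulr0.
    + by move=> a; case: eqP => [->|_]; rewrite ?mulr0.
    + rewrite /D' src_bar eqxx; have [E0|n0] := eqVneq a0 b.
        by rewrite -E0 bar_neq rmorph0; apply: H0.
      have [E1|n1] := eqVneq (bar a0) b; first by rewrite rmorph0; apply: H1.
      by rewrite rmorph0.
  move=> r; case=> [b|b nv nn|b nv nn].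
  + have N2 := wmn_ge2 (bar b); rewrite -/(N _) in N2.
    have AE : wsa_A (bar b) = pa_arr K (bar b) * pP (g (bar b)) (N (bar b)).-2.
      rewrite -gpathS; move: N2; rewrite /wsa_A -/(N _).
      by case: (N (bar b)) => [|[|k]] // _; rewrite (gpath_prod pid).
    exists (fun a => if a == b then pa_arr K (f b) else if a == bar b then
      - (c (bar b) *: pP (g (bar b)) (N (bar b)).-2) else 0); split.
    * rewrite (bigD1 b) //= eqxx (bigD1 (bar b)) /= ?bar_neq // eqxx.
      rewrite big1 ?addr0; last by move=> a /andP[/negbTE-> /negbTE->]; rewrite mulr0.
      by rewrite AE scalerAr mulrN.
    * move=> a; case: eqP => [->|_]; first by rewrite -src_f (rep_src pid).
      case: eqP => [->|_]; last by rewrite mulr0.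
      by rewrite mulrN -scalerAr -src_g (src_gpath pid).
    * rewrite /D' src_bar eqxx; have [E0|n0] := eqVneq a0 b.
        rewrite -E0 bar_neq eqxx rmorphN /= linearZ /= pi_pP; exact: D1.
      have [E1|n1] := eqVneq (bar a0) b.
        rewrite -E1 barK eqxx rmorphN /= linearZ /= pi_pP; exact: D1'.
      rewrite -bar_eq (negbTE n1).
      by rewrite (inj_eq (can_inj (@barK W))) (negbTE n0) rmorph0.
  + rewrite -mulrA; apply: one; first by rewrite mulrA -src_f (rep_src pid).
      by move=> Eb; rewrite Eb in nv *; rewrite rmorphM; apply: D2.
    by move=> Eb; rewrite Eb in nv *; rewrite rmorphM; apply: D2'.
  + rewrite -mulrA; apply: one; first by rewrite mulrA -src_g (rep_src pid).
      by move=> Eb; rewrite Eb in nv *; rewrite rmorphM; apply: D3.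
    by move=> Eb; rewrite Eb in nv *; rewrite rmorphM; apply: D3'.
- move=> a; rewrite /w; case: eqP => [->//|_].
  by case: eqP => [->//|_]; rewrite mulr0.
- move=> a; rewrite /w; have [->|_] := eqVneq a a0; first by rewrite eqxx.
  by have [->|//] := eqVneq a (bar a0); rewrite src_bar eqxx.
- rewrite (bigD1 a0) //= (bigD1 (bar a0)) //= big1.
    by rewrite /w eqxx bar_neq eqxx addr0.
  by move=> a /andP[/negbTE n0 /negbTE n1]; rewrite /w n0 n1 mulr0.
Qed.

Lemma soc_mulT y b : typI y -> P y (N y) * T b = 0.
Proof.
move=> Iy; have [E1|ne] := eqVneq (src b) (src y); last first.
  by rewrite (gpath_mul0 HR) // iter_N.
have := src_eq y b; rewrite E1 eqxx => /esym/orP[]/eqP->.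
  exact: (soc_mul bip H).
exact: (soc_mul_bar bip H).
Qed.

Lemma A_mulT y b : typI y -> exists x, P y (N y).-1 * T b = x *: P y (N y).
Proof.
move=> Iy; have [E1|ne] := eqVneq (src b) (src (iter (N y).-1 g y)); last first.
  by exists 0; rewrite (gpath_mul0 HR) // scale0r.
have := src_eq (iter (N y).-1 g y) b; rewrite E1 eqxx => /esym/orP[]/eqP->.
  by exists 1; rewrite scale1r -(gpathSr HR) N_prednK.
exists 0; rewrite scale0r (gpath_I_turn bip H) //.
by have [] := N_bar4 Iy; lia.
Qed.

Lemma soc_mul_gpath y b k : typI y -> P y (N y) * P b k.+1 = 0.
Proof. by move=> Iy; rewrite gpathS mulrA soc_mulT // mul0r. Qed.

(** * The second syzygy of a simple module outside Gamma *)

Section Syz.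
Variable y : arr W.
Hypothesis Iy : typI y.
Local Notation Y := (f (g y)).
Local Notation Z := (g (g y)).
Local Notation w := (syz_gen E T y).

Lemma typI_Y : typI Y. Proof. by rewrite typI_f typII_g. Qed.
Lemma barZ : bar Z = Y. Proof. by rewrite barg. Qed.
Lemma gY : g Y = f (f y). Proof. exact: gfg_typI. Qed.
Lemma ggY : g (g Y) = bar y. Proof. by rewrite gY gff. Qed.
Lemma N_Y : N Y = N (bar y). Proof. by rewrite -ggY !N_g. Qed.

Lemma iter_Z : iter (N y).-2 g Z = y.
Proof.
have E3 : (N y).-2.+2 = N y by have [] := N_bar4 Iy; case: (N y) => [|[|k]].
by rewrite -!iterSr E3 iter_N.
Qed.

Lemma gpathY k : P Y k.+2 = P Y 2 * P (bar y) k.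
Proof. by rewrite -add2n (gpathD HR) /= ggY. Qed.

Lemma syz_genE : w = (c (f y))^-1 *: P Y 2 - c y *: P Z (N y).-2.
Proof. by rewrite /syz_gen (gpath2 HR) gY. Qed.

(** Here [y] is two steps after [Z], so [bar y] leaves the orbit of [Z] after exactly two steps, the
    last case in which this need not vanish. *)
Lemma syz_tail1 : N y = 4%N ->
  P Z 2 * T (bar y) = (c (f Z) * c Y) *: P Y (N Y).-1.
Proof.
move=> N4; have Ey : g (g Z) = y by have := iter_Z; rewrite N4.
have -> : bar y = bar (g (g Z)) by rewrite Ey.
by rewrite (gpath_I_turn2 H) ?barZ // typI_gg.
Qed.

(** If [N y] is at least 6, the orbit of [Z] is left after at least four steps. If [N y = 4], the
    first arrow leads to a multiple of [A_Y], the second one into the socle, and the third one kills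
    it. *)
Lemma syz_tail k : (0 < k)%N -> (6 <= N y)%N \/ (3 <= k)%N ->
  P Z (N y).-2 * P (bar y) k = 0.
Proof.
case: k => // k _; have IZ : typI Z by exact: typI_gg.
have [N4|N4] := eqVneq (N y) 4%N.
  case=> [|k2]; first by rewrite N4.
  rewrite N4 /= [P (bar y) _]gpathS mulrA syz_tail1 // -scalerAl.
  case: k k2 => [|[|k]] // _; rewrite gpathS mulrA.
  have [x ->] := A_mulT (g (bar y)) typI_Y.
  by rewrite -scalerAl soc_mul_gpath ?scaler0 // typI_Y.
move=> _; have N6 := typI_N_neq4 bip Iy N4; rewrite [P (bar y) _]gpathS mulrA.
have -> : bar y = bar (iter (N y).-2 g Z) by rewrite iter_Z.
by rewrite (gpath_I_turn bip H) ?mul0r //; lia.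
Qed.

Hypothesis big : (6 <= N y)%N \/ (6 <= N (bar y))%N.

Lemma A_in_syz : exists q, P Y (N Y).-1 = w * q.
Proof.
have [n4 n4'] := N_bar4 Iy.
(* The term [P Y 2] of [w] is prolonged along [bar y] to length [N Y - 1]. The other term dies by
   [syz_tail]: if [N y] is 4, then [big] gives [N (bar y) - 3] at least 3. With both orbits at 4
   this would be length 1, where the tail survives. *)
exists (c (f y) *: P (bar y) (N (bar y) - 3)).
rewrite syz_genE -scalerAr mulrBl -!scalerAl syz_tail ?scaler0 ?subr0 //; last 2 first.
- by lia.
- by case: big => [|le]; [left|right; lia].
rewrite scalerA mulfV ?wc_neq0 // scale1r -gpathY N_Y; congr (P Y _).
by lia.
Qed.

Lemma soc_in_syz : exists q, P Y (N Y) = w * q.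
Proof.
have [q Eq] := A_in_syz; exists (q * T (iter (N Y).-1 g Y)).
by rewrite mulrA -Eq -(gpathSr HR) N_prednK.
Qed.

Lemma ker_mul_II u : E (tgt (g y)) * u = u -> T (g y) * u = 0 ->
  exists q, u = w * q.
Proof.
move=> uE zu; have cf : (c (f y))^-1 * c (f y) = 1 by rewrite mulVf ?wc_neq0.
(* The second arrow at [tgt y] is the virtual [f y], a multiple of [T (g y) * T Y]. Hence a syzygy
   between [T (g y)] and [T (f y)] amounts to an element annihilated by [T (g y)] alone. *)
pose D u u' := exists q, u + (c (f y))^-1 *: (T Y * u') = w * q.
have nI : typI (g y) = false by rewrite (typIIN bip (typII_g Iy)).
have [qA EA] := A_in_syz; have [qB EB] := soc_in_syz.
have := @wsa_presentation (g y) D; rewrite barg => /(_ _ _ _ _ _ _ _ _ _ u 0) [].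
- by exists 0; rewrite !mulr0 scaler0 addr0.
- move=> x x' v v' [q Eq] [q' Eq']; exists (q + q').
  by rewrite mulrDr scalerDr addrACA Eq Eq' mulrDr.
- move=> x x' q [q' Eq]; exists (q' * q).
  by rewrite [RHS]mulrA -Eq mulrDl -scalerAl -[T Y * x' * q]mulrA.
- exists 0; rewrite mulr0 (N_virt Iy) gpath0 mulrN -scalerAr.
  have -> : T Y * E (src (g (f y))) = T Y.
    by rewrite gf_typI // src_f (rep_tgt HR).
  by rewrite scalerN scalerA cf scale1r subrr.
- by exists 1; rewrite mulr1 addrC /syz_gen !c_g !N_g.
- by rewrite typII_g.
- move=> _; have [N4|N4] := eqVneq (N y) 4%N; last first.
    exists (T (bar y)); rewrite gff add0r mulrA -(gpath1 HR (bar y)).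
    rewrite /syz_gen mulrBl -!scalerAl syz_tail ?scaler0 ?subr0 //.
    by left; exact: typI_N_neq4.
  exists (T (bar y) + (c y * (c (f Z) * c Y)) *: qA); rewrite gff add0r mulrA.
  rewrite mulrDr -scalerAr -EA /syz_gen mulrBl -!scalerAl N4 syz_tail1 // scalerA.
  by rewrite subrK.
- move=> _; exists (c Y *: qA).
  by rewrite mulr0 scaler0 addr0 -scalerAr -EA (wsa_rep1 H) barZ.
- move=> _; exists ((c (f y))^-1 *: (c Y *: qB)).
  rewrite fgf_typI // add0r mulrA -!scalerAr -EB; congr (_ *: _).
  rewrite (gf_typI Iy) (wsa_rep1 H) -gE -scalerAl.
  rewrite -[in RHS]barZ -(soc_bar H); congr (_ *: _).
  rewrite (gpath_Nr H); congr (_ * T _).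
  by rewrite barZ -{1}(fgf_typI Iy) gf_typI.
- by [].
- exact: mulr0.
- by rewrite mulr0 addr0.
- by move=> q Eq; exists q; rewrite -Eq mulr0 scaler0 addr0.
Qed.

End Syz.

(** The two generators are the remainders of relation (1) at [y] and [bar y]. Those of relation (2)
    are generators multiplied by [T (g (f y))] or its counterpart, since the other component then
    vanishes by [zA]; relation (3) does not start with an arrow of type I. *)
Lemma ker_pair y u u' : typI y -> E (tgt y) * u = u ->
  E (tgt (bar y)) * u' = u' -> T y * u + T (bar y) * u' = 0 ->
  exists q q',
    u = T (f y) * q - c y *: P (g y) (N y).-2 * q' /\
    u' = T (f (bar y)) * q' - c (bar y) *: P (g (bar y)) (N (bar y)).-2 * q.
Proof.
move=> Iy; have [n4 n4'] := N_bar4 Iy.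
have Iy' : typI (bar y) by rewrite typI_bar.
have zA x : typI x -> P (g (bar x)) (N (bar x)).-2 * T (g (f x)) = 0.
  move=> Ix; have [_ m4] := N_bar4 Ix.
  have -> : g (f x) = bar (iter (N (bar x)).-2 g (g (bar x))).
    rewrite -iterSr prednK; last by lia.
    by rewrite iter_N1' barK.
  rewrite (gpath_II_turn bip H) //; last by lia.
  by apply: typII_g; rewrite typI_bar.
pose D u u' := exists q q',
    u = T (f y) * q - c y *: P (g y) (N y).-2 * q' /\
    u' = T (f (bar y)) * q' - c (bar y) *: P (g (bar y)) (N (bar y)).-2 * q.
rewrite -/(D u u'); move: u u'; apply: (@wsa_presentation y D).
- by exists 0, 0; rewrite !mulr0 subr0.
- move=> v v' x x' [q [q' [-> ->]]] [r [r' [-> ->]]]; exists (q + r), (q' + r').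
  by split; rewrite !mulrDr opprD addrACA.
- move=> v v' x [q [q' [-> ->]]]; exists (q * x), (q' * x).
  by split; rewrite mulrBl !mulrA.
- by exists 1, 0; rewrite !mulr1 !mulr0 subr0 sub0r.
- by exists 0, 1; rewrite !mulr1 !mulr0 subr0 sub0r.
- move=> _; exists (T (g (f y))), 0; rewrite !mulr0 subr0 sub0r; split=> //.
  by rewrite -scalerAl zA // scaler0 oppr0.
- move=> _; exists 0, (T (g (f (bar y)))); rewrite !mulr0 subr0 sub0r; split=> //.
  by have := zA _ Iy'; rewrite barK => z0; rewrite -scalerAl z0 scaler0 oppr0.
- by rewrite Iy.
- by rewrite Iy'.
Qed.

Section Syz.
Variable y : arr W.
Hypothesis Iy : typI y.
Hypothesis big : (6 <= N y)%N \/ (6 <= N (bar y))%N.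
Local Notation Y := (f (g y)).
Local Notation Z := (g (g y)).
Local Notation w := (syz_gen E T y).
Local Notation n := (N (bar y)).

(** Modulo [T y * L] the element [u] is a combination of paths along [bar y] of length below
    [n - 1], because [A_{bar y}] is a multiple of [T y * T (f y)]. Up to corrections, [w] shifts
    these to the paths [P Y k.+2], which are independent. *)
Lemma ker_mul_syz u : E (src y) * u = u -> w * u = 0 -> exists q, u = T y * q.
Proof.
move=> uE wu; have [n4 n4'] := N_bar4 Iy.
have IY := typI_Y Iy; have barY : bar Y = Z by rewrite -barZ barK.
have NY : N Y = n := N_Y Iy; have NZ : N Z = N y by rewrite !N_g.
have Iy' : typI (bar y) by rewrite typI_bar.
have [b [q Eu]] : exists (b : nat -> K) q,
    u = \sum_(k < n.-1) b k *: P (bar y) k + T y * q.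
  have [a [b Eu]] := spanI_full u Iy; rewrite uE in Eu.
  have AY : exists q, P (bar y) n.-1 = T y * q.
    exists ((c (bar y))^-1 *: T (f y)).
    by rewrite -scalerAr (wsa_rep1 H) scalerA mulVf ?scale1r ?wc_neq0.
  have [q0 Eq0] := AY.
  exists (fun k => b k + (if k == 0%N then a 0%N else 0)),
    (\sum_(k < N y) a k.+1 *: P (g y) k + b n.-1 *: q0).
  rewrite Eu big_ord_recl /= mulrDr mulr_sumr -scalerAr -Eq0.
  have -> : \sum_(k < n) b k *: P (bar y) k =
      \sum_(k < n.-1) b k *: P (bar y) k + b n.-1 *: P (bar y) n.-1.
    by move: (N_prednK (bar y)); case: n => // m _; rewrite big_ord_recr.
  have -> : \sum_(k < n.-1) (b k + (if (k : nat) == 0%N then a 0%N else 0)) *: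
      P (bar y) k = \sum_(k < n.-1) b k *: P (bar y) k + a 0%N *: P y 0.
    under eq_bigr do rewrite scalerDl; rewrite big_split /=; congr (_ + _).
    have n1 : (0 < n.-1)%N by lia.
    rewrite (bigD1 (Ordinal n1)) //= big1 => [|i ne].
      by rewrite addr0 !gpath0 src_bar.
    by rewrite (negbTE (_ : val i != 0%N)) ?scale0r.
  have -> : \sum_(i < N y) a (lift ord0 i) *: P y (lift ord0 i) =
      \sum_(i < N y) T y * (a i.+1 *: P (g y) i).
    by apply: eq_bigr => i _; rewrite -scalerAr.
  by rewrite [LHS]addrACA; congr (_ + _); exact: addrC.
have sum0 : \sum_(k < n.-1) b k *: (w * P (bar y) k) = 0.
  rewrite -[RHS]wu Eu mulrDr mulr_sumr mulrA (syz_gen_mul bip H) // mul0r addr0.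
  by apply: eq_bigr => k _; rewrite scalerAr.
suff b0 : forall k, (k < n.-1)%N -> b k = 0.
  exists q; rewrite Eu big1 ?add0r // => k _; by rewrite b0 ?scale0r.
have cf0 : (c (f y))^-1 != 0 by rewrite invr_eq0 wc_neq0.
have [phi phiE] := proj_coord bip IY.
(* The corrections [x1] and [x2] come from the tail; they can be nonzero only if [N y = 4] and [k]
   is 1 or 2. *)
have term k : (k < n.-1)%N -> exists x1 x2, w * P (bar y) k =
    (c (f y))^-1 *: P Y k.+2 - (if k == 0%N then c y else 0) *: P Z (N y).-2
    - (x1 *: P Y n.-1 + x2 *: P Y n) /\
    (((6 <= N y)%N \/ (3 <= k)%N) -> x1 = 0 /\ x2 = 0).
  move=> lt; rewrite (syz_genE Iy) mulrBl -!scalerAl -(gpathY Iy).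
  case: k lt => [|k] lt.
    exists 0, 0; rewrite !scale0r addr0 subr0; split=> //.
    congr (_ - _ *: _); rewrite gpath0 src_bar.
    have -> : src y = src (iter (N y).-2 g Z) by rewrite (iter_Z Iy).
    by rewrite (gpath_tgt HR).
  rewrite scale0r subr0; have [hyp|hyp] := pselect ((6 <= N y)%N \/ (3 <= k.+1)%N).
    exists 0, 0; rewrite !scale0r addr0 subr0; split=> //.
    by rewrite (syz_tail Iy) // scaler0 subr0.
  have N4 : N y = 4%N.
    by apply/eqP; apply: contra_notT hyp => /(typI_N_neq4 bip Iy); left.
  have syz1 := syz_tail1 Iy N4; rewrite [P (bar y) _]gpathS mulrA N4 [4.-2]/= syz1 -scalerAl.
  case: k lt hyp => [|[|k]] lt hyp; last by case: hyp; right.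
    exists (c y * (c (f Z) * c Y)), 0.
    rewrite scale0r addr0 scalerA gpath0.
    split; last by case.
    congr (_ - _ *: _); rewrite -NY.
    apply: (scalerI (_ : c (f Z) * c Y != 0)); first by rewrite mulf_neq0 ?wc_neq0.
    by rewrite scalerAl -syz1 -mulrA src_g (rep_tgt HR).
  have [x Ex] := A_mulT (g (bar y)) IY.
  exists 0, (c y * (c (f Z) * c Y) * x); rewrite scale0r add0r (gpath1 HR) Ex.
  split; last by case.
  by rewrite scalerA scalerA NY.
have phiP j k : (k <= n)%N -> (j <= n)%N -> (0 < j)%N ->
    phi false j (P Y k) = (k == j)%:R.
  rewrite -NY => lek lej j0; have -> := phiE false j false k lej lek.
  rewrite /= gtn_eqF //; case: (eqVneq j (N Y)) => [->|_]; last by rewrite eq_sym.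
  by case: eqP => // _; rewrite divff ?wc_neq0.
have phiZ j : (j <= n)%N -> phi false j (P Z (N y).-2) = 0.
  rewrite -NY -NZ -barY => lej.
  have le2 : ((N (bar Y)).-2 <= N (bar Y))%N by lia.
  have -> := phiE false j true _ lej le2.
  have -> : ((N (bar Y)).-2 == N (bar Y)) = false by rewrite barY NZ; lia.
  have -> : ((N (bar Y)).-2 == 0)%N = false by rewrite barY NZ; lia.
  by rewrite /=; case: ifP => //; case: ifP.
have term' k : exists x : K * K, (k < n.-1)%N -> w * P (bar y) k =
    (c (f y))^-1 *: P Y k.+2 - (if k == 0%N then c y else 0) *: P Z (N y).-2
    - (x.1 *: P Y n.-1 + x.2 *: P Y n) /\
    (((6 <= N y)%N \/ (3 <= k)%N) -> x.1 = 0 /\ x.2 = 0).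
  case: (ltnP k n.-1) => [/term[x1 [x2 ?]]|_]; last by exists (0, 0).
  by exists (x1, x2).
have [x xE] := choice term'.
have coord j : (0 < j)%N -> (j <= n)%N ->
    \sum_(k < n.-1) b k * ((c (f y))^-1 * (k.+2 == j)%:R -
      ((x k).1 * (n.-1 == j)%:R + (x k).2 * (n == j)%:R)) = 0.
  move=> j0 jn; have := congr1 (phi false j) sum0.
  rewrite linear_sum linear0 => E0; rewrite -[RHS]E0; apply: eq_bigr => k _.
  have kn : (k.+2 <= n)%N by have := ltn_ord k; lia.
  rewrite linearZ /= (xE k (ltn_ord k)).1; congr (_ * _).
  rewrite !linearB linearD !linearZ /= phiZ // !phiP ?leq_pred //.
  by rewrite oppr0 scaler0 addr0.
(* The lengths [k + 2] below [n - 1] are not touched by corrections, so their coefficients vanish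
   directly. *)
have b_low k : (k.+3 < n)%N -> b k = 0.
  move=> lt; have := coord k.+2 isT (ltnW (ltnW lt)).
  have -> : (n.-1 == k.+2) = false by lia.
  have -> : (n == k.+2) = false by lia.
  under eq_bigr do rewrite !mulr0 addr0 subr0 eqSS eqSS mulrA.
  have ltk : (k < n.-1)%N by lia.
  rewrite (sum_delta (fun i => b i * (c (f y))^-1) ltk) => /eqP.
  by rewrite mulf_eq0 (negbTE cf0) orbF => /eqP.
(* Only the last two coefficients remain. If [N y = 4], then [n] is at least 6 and these indices are
   at least 3, so they carry no correction; the corrections at 1 and 2 are multiplied by
   coefficients that already vanish. *)
have x0 k : (k.+3 >= n)%N -> (k < n.-1)%N -> (x k).1 = 0 /\ (x k).2 = 0.
  move=> ge lt; apply: (xE k lt).2; case: big => [|n6]; [by left|right; lia].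
move=> k lt; have [/b_low //|ge] := ltnP k.+3 n.
have k2n : (k.+2 <= n)%N by lia.
have := coord k.+2 isT k2n.
rewrite (eq_bigr (fun i : 'I_n.-1 => (b i * (c (f y))^-1) * (i == k :> nat)%:R)).
  rewrite (sum_delta (fun i => b i * (c (f y))^-1) lt) => /eqP.
  by rewrite mulf_eq0 (negbTE cf0) orbF => /eqP.
move=> i _; rewrite !eqSS; have [/b_low ->|gei] := ltnP i.+3 n.
  by rewrite !mul0r.
have [-> ->] := x0 i gei (ltn_ord i).
by rewrite !mul0r addr0 subr0 mulrA.
Qed.

End Syz.

End Kernels.

(** * Resolutions and vanishing of Ext *)

Section RightAction.
Variables (K : fieldType) (A : algType K).
Implicit Types (X Y Z : rmodType A) (a b : A).

Lemma ractA X (x : X) a b : ract (ract x a) b = ract x (a * b).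
Proof. by rewrite /ract scalerA. Qed.
Lemma ract1 X (x : X) : ract x 1 = x.
Proof. exact: scale1r. Qed.
Lemma ractDr X (x : X) a b : ract x (a + b) = ract x a + ract x b.
Proof. exact: scalerDl. Qed.
Lemma ract0r X (x : X) : ract x 0 = 0.
Proof. exact: scale0r. Qed.
Lemma ract0l X a : ract (0 : X) a = 0.
Proof. exact: scaler0. Qed.
Lemma ract_hom X Y (h : {linear X -> Y}) x a : h (ract x a) = ract (h x) a.
Proof. exact: linearZ. Qed.

Lemma lin_comp X Y Z (h : {linear Y -> Z}) (k : {linear X -> Y}) :
  exists hk : {linear X -> Z}, forall x, hk x = h (k x).
Proof.
have L : linear (fun x => h (k x)) by move=> a x y; rewrite !linearP.
by exists (lin_of L).
Qed.

End RightAction.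

Section IdempotentProjective.
Variables (K : fieldType) (L : algType K).
Implicit Types (e : L) (X : rmodType L).

Fact PV_0 e : e * 0 = 0 :> L. Proof. exact: mulr0. Qed.
Fact PV_D e (a : L^c) (x y : regmod L) :
  e * (x : L) = x -> e * (y : L) = y ->
  e * ((a *: x + y : regmod L) : L) = (a *: x + y : regmod L).
Proof. by move=> Ex Ey; rewrite -[a *: x]/((x : L) * a) mulrDr mulrA Ex Ey. Qed.

Definition PV_sub e : submodule (regmod L) :=
  @Submodule _ (regmod L) (fun x : L => e * x = x) (PV_0 e) (@PV_D e).

(* The right ideal [e * L]. *)
Definition PV e : rmodType L := smT (PV_sub e).

Definition pval e (u : PV e) : L := smval u.

Lemma pvalP e (u : PV e) : e * pval u = pval u.
Proof. exact: (smvalP u). Qed.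

Lemma pval_inj e : injective (@pval e).
Proof. exact: smval_inj. Qed.

Lemma pval_lift e (x : L) : e * x = x -> exists u : PV e, pval u = x.
Proof. by move=> Ex; exact: (@sm_lift _ (regmod L) (PV_sub e) x Ex). Qed.

Lemma pval_linear e (a : L) (x y : PV e) :
  pval ((a : L^c) *: x + y) = pval x * a + pval y.
Proof. exact: (@smval_linear _ (regmod L) (PV_sub e) a x y). Qed.

Lemma pval0 e : pval (0 : PV e) = 0.
Proof. by []. Qed.

Lemma pvalD e (u u' : PV e) : pval (u + u') = pval u + pval u'.
Proof. by have := pval_linear 1 u u'; rewrite mulr1 scale1r. Qed.

Lemma pval_eq0 e (u : PV e) : u = 0 <-> pval u = 0.
Proof. by split=> [->|u0]; [exact: pval0|apply: pval_inj; rewrite u0 pval0]. Qed.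

Lemma PV_hom X (x : X) e :
  exists h : {linear PV e -> X}, forall u, h u = ract x (pval u).
Proof.
have lin : linear (fun u : PV e => ract x (pval u)).
  by move=> a u w; rewrite pval_linear ractDr -ractA.
by exists (lin_of lin).
Qed.

Lemma PV_lmul e e' (a : L) : e * a = a ->
  exists h : {linear PV e' -> PV e}, forall u, pval (h u) = a * pval u.
Proof.
move=> Ea; have h_ex (u : PV e') : exists w : PV e, pval w = a * pval u.
  by apply: pval_lift; rewrite mulrA Ea.
have [h hE] := choice h_ex.
have lin : linear h.
  move=> b u w; apply: pval_inj; rewrite pval_linear !hE pval_linear.
  by rewrite mulrDr mulrA.
by exists (lin_of lin).
Qed.

Lemma PV_lmul2 e e1 e2 (a1 a2 : L) : e * a1 = a1 -> e * a2 = a2 ->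
  exists h : {linear (PV e1 * PV e2)%type -> PV e},
    forall u, pval (h u) = a1 * pval u.1 + a2 * pval u.2.
Proof.
move=> /(PV_lmul e1)[h1 h1E] /(PV_lmul e2)[h2 h2E].
have lin : linear (fun u : (PV e1 * PV e2)%type => h1 u.1 + h2 u.2).
  by move=> x u u' /=; rewrite !linearP scalerDr addrACA.
by exists (lin_of lin) => u; rewrite lin_ofE pvalD h1E h2E.
Qed.

Section Idempotent.
Variable e : L.
Hypothesis ee : e * e = e.

Lemma PV_gen : exists x : PV e, pval x = e.
Proof. exact: pval_lift. Qed.

Lemma PV_proj (x : L) : exists u : PV e, pval u = e * x.
Proof. by apply: pval_lift; rewrite mulrA ee. Qed.

Lemma PV_ext X (h : {linear PV e -> X}) :
  exists2 n, ract n e = n & forall u, h u = ract n (pval u).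
Proof.
have [x xE] := PV_gen.
have hE u : h u = ract (h x) (pval u).
  rewrite -ract_hom; congr (h _); apply: pval_inj.
  have := pval_linear (pval u) x 0; rewrite addr0 pval0 addr0 /ract => ->.
  by rewrite xE pvalP.
by exists (h x) => //; rewrite [RHS]hE xE.
Qed.

Lemma PV_projective : projective (PV e).
Proof.
move=> X Y p h p_surj; have [y _ hE] := PV_ext h.
have [x xE] := p_surj y; have [k kE] := PV_hom x e.
by exists k => u; rewrite kE ract_hom xE hE.
Qed.

End Idempotent.

Lemma PV_ext2 X e1 e2 (psi : {linear (PV e1 * PV e2)%type -> X}) :
  e1 * e1 = e1 -> e2 * e2 = e2 ->
  exists n1 n2, [/\ ract n1 e1 = n1, ract n2 e2 = n2
    & forall u, psi u = ract n1 (pval u.1) + ract n2 (pval u.2)].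
Proof.
move=> ee1 ee2.
have L1 : linear (fun u : PV e1 => psi (u, 0)).
  by move=> x u u'; rewrite -linearP; congr (psi (_, _)); rewrite /= scaler0 addr0.
have L2 : linear (fun u : PV e2 => psi (0, u)).
  by move=> x u u'; rewrite -linearP; congr (psi (_, _)); rewrite /= scaler0 addr0.
have [n1 n1E h1E] := PV_ext ee1 (lin_of L1).
have [n2 n2E h2E] := PV_ext ee2 (lin_of L2).
exists n1, n2; split=> // -[u1 u2]; rewrite -h1E -h2E !lin_ofE -linearD.
by congr (psi (_, _)); rewrite /= ?addr0 ?add0r.
Qed.

End IdempotentProjective.

Section SimpleModule.
Variables (K : fieldType) (Q : quiver) (L : algType K).
Variables (E : vert Q -> L) (T : arr Q -> L).

Definition simple_rep v (S : rmodType L) : Prop :=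
  exists x : S, [/\ x <> 0, forall y, exists k : K, y = ract x k%:A,
    ract x (E v) = x & forall a, ract x (T a) = 0].

Definition rep_rad : Prop := forall v x, exists k w,
  E v * x = k *: E v + \sum_(a | src a == v) T a * w a.

Hypothesis HR : quiver_rep E T.
Hypothesis rad : rep_rad.

Lemma rep_EE v : E v * E v = E v.
Proof. by rewrite (rep_orth HR) eqxx. Qed.

Lemma simple_cover v (S : rmodType L) : simple_rep v S ->
  exists2 h : {linear PV (E v) -> S}, surj h &
    forall u, h u = 0 <-> exists w, pval u = \sum_(a | src a == v) T a * w a.
Proof.
move=> [x [x0 xgen xE xT]]; have [h hE] := PV_hom x (E v).
have sum0 w : ract x (\sum_(a | src a == v) T a * w a) = 0.
  apply: (big_ind (fun q => ract x q = 0)) => [|q q' Hq Hq'|a _].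
  - exact: ract0r.
  - by rewrite ractDr Hq Hq' addr0.
  - by rewrite -ractA xT ract0l.
exists h => [y|u].
  have [k ->] := xgen y; have [u uE] := PV_proj (rep_EE v) k%:A.
  by exists u; rewrite hE uE -ractA xE.
have [k [w Eu]] := rad v (pval u); rewrite pvalP in Eu.
have hu : h u = ract x k%:A.
  by rewrite hE Eu ractDr -mulr_algr -ractA xE sum0 addr0.
split=> [|[w' Ew']]; last by rewrite hE Ew' sum0.
rewrite hu => xk; exists w; have [k0|k0] := eqVneq k 0.
  by rewrite Eu k0 scale0r add0r.
case: x0; rewrite -(ract1 x) -(scale1r 1) -(mulfV k0) -scalerA.
by rewrite -[_ *: _]mulr_algr mulr_algl -mulr_algr -ractA xk ract0l.
Qed.

End SimpleModule.

Section MatrixModule.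
Variables (K : fieldType) (A : algType K) (n : nat).

Definition mxmod of {lrmorphism A -> 'M[K]_n.+1} : Type := 'rV[K]_n.+1.
HB.instance Definition _ rho := GRing.Zmodule.on (mxmod rho).

Variable rho : {lrmorphism A -> 'M[K]_n.+1}.
Local Notation X := (mxmod rho).

Definition mxact (a : A^c) (v : X) : X := (v : 'rV[K]_n.+1) *m rho a.

Fact mxactA a b v : mxact a (mxact b v) = mxact (a * b) v.
Proof. by rewrite /mxact -mulmxA -[X in _ *m X](rmorphM rho). Qed.
Fact mxact1 : left_id 1 mxact.
Proof. by move=> v; rewrite /mxact (rmorph1 rho) mulmx1. Qed.
Fact mxactDr : right_distributive mxact +%R.
Proof. by move=> a u v; rewrite /mxact mulmxDl. Qed.
Fact mxactDl v : {morph mxact^~ v : a b / a + b}.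
Proof. by move=> a b; rewrite /mxact rmorphD mulmxDr. Qed.

HB.instance Definition _ := GRing.Zmodule_isLmodule.Build A^c X
  mxactA mxact1 mxactDr mxactDl.

Lemma mxractE (v : X) (a : A) : ract v a = (v : 'rV[K]_n.+1) *m rho a.
Proof. by []. Qed.

Lemma mxmod_fin_dim : fin_dim (X : rmodType A).
Proof.
pose s : seq X := map (fun i : 'I_n.+1 => bvec i) (enum 'I_n.+1).
have sz : size s = n.+1 by rewrite size_map size_enum_ord.
exists s => v; exists (fun i => (v : 'rV[K]_n.+1) 0 (cast_ord sz i)).
rewrite [LHS](row_sum_delta v) (reindex (cast_ord sz)) /=; last first.
  by exists (cast_ord (esym sz)) => i _; rewrite ?cast_ordK ?cast_ordKV.
apply: eq_bigr => i _; rewrite mxractE rmorph_alg.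
have lt : (i < n.+1)%N by have := ltn_ord i; rewrite [X in (_ < X)%N]sz.
rewrite (nth_map 0) ?size_enum_ord // -scalemxAr mulmx1.
have -> : (enum 'I_n.+1)`_i = cast_ord sz i.
  by apply: val_inj; rewrite /= nth_enum_ord.
by rewrite bvec_delta.
Qed.

End MatrixModule.

Section ComparableOne.
Variables (K : fieldType) (A : algType K).

Lemma comparable_start1 (X P0 R0 : rmodType A) (eps : {linear P0 -> X})
    (e0 : {linear R0 -> X}) :
  projective P0 -> projective R0 -> surj eps -> surj e0 ->
  comparable eps (fun _ : unit => e0).
Proof.
move=> projP projR epsS e0S.
have lin : linear (@id X) by [].
apply: (comparable_start (inj := fun=> lin_of lin) (prj := fun=> lin_of lin)) => //.
by move=> x; rewrite big_const card_unit /= addr0.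
Qed.

Lemma comparable_step1 (P1 P0 P' R1 R0 R' : rmodType A)
    (d1 : {linear P1 -> P0}) (d0 : {linear P0 -> P'})
    (e1 : {linear R1 -> R0}) (e0 : {linear R0 -> R'}) :
  projective P0 -> projective P1 -> projective R1 ->
  (forall x, d0 x = 0 <-> exists x', d1 x' = x) ->
  (forall x, e0 x = 0 <-> exists x', e1 x' = x) ->
  comparable d0 (fun _ : unit => e0) -> comparable d1 (fun _ : unit => e1).
Proof. by move=> pP0 pP1 pR1 exP exR; apply: comparable_step. Qed.

Lemma vanish_at1 (P P' R R' N : rmodType A) (d : {linear P -> P'})
    (e : {linear R -> R'}) :
  comparable d (fun _ : unit => e) -> vanish_at N e -> vanish_at N d.
Proof. by move=> comp van; apply: (comparable_vanish comp). Qed.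

Lemma syzygy2_cover (X Om : rmodType A) : is_syzygy2 X Om ->
  exists (Pa Pb : rmodType A) (p : {linear Pa -> X}) (r : {linear Pb -> Pa})
    (i : {linear Om -> Pb}),
  [/\ projective Pa, projective Pb & surj p] /\
  [/\ forall x, p x = 0 <-> exists x', r x' = x, injective i
    & forall x, r x = 0 <-> exists z, i z = x].
Proof.
move=> [M1 [[Pa [p [i1 [[projPa pS _] i1I i1P]]]]
  [Pb [q [i2 [[projPb qS _] i2I i2P]]]]]].
have [r rE] := lin_comp i1 q; exists Pa, Pb, p, r, i2; split; split=> // x.
- rewrite i1P; split=> [[z <-]|[z <-]]; last by exists (q z).
  by have [z' <-] := qS z; exists z'.
- rewrite -i2P rE; split=> [E0|->]; last exact: linear0.
  by apply: i1I; rewrite E0 linear0.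
Qed.

End ComparableOne.

Section Model.
Variables (K : fieldType) (W : weighted_tq K).
Implicit Types (a b y z : arr W).
Local Notation f := (tq_f W).
Local Notation g := (@tq_g W).
Local Notation bar := (@tq_bar W).
Local Notation c := (@wc K W).
Local Notation N := (@arrN K W).

Definition big_orbit y : Prop := (6 <= N y)%N \/ (6 <= N (bar y))%N.

(* The facts about [wsa W] needed to resolve the simple modules, stated for an
   arbitrary algebra [L] so that quotients of path algebras are never unfolded. *)
Record wsa_model (L : algType K) (E : vert W -> L) (T : arr W -> L) : Prop :=
  WsaModel {
    model_rep : wsa_rep E T;
    model_rad : rep_rad E T;
    model_ker_I : forall y (u : L), typI y -> E (tgt y) * u = u -> T y * u = 0 ->
      exists x, u = x *: gpath E T (g y) (N y);
    model_ker_II : forall y (u : L), typI y -> big_orbit y ->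
      E (tgt (g y)) * u = u -> T (g y) * u = 0 ->
      exists q, u = syz_gen E T y * q;
    model_ker_syz : forall y (u : L), typI y -> big_orbit y ->
      E (src y) * u = u -> syz_gen E T y * u = 0 -> exists q, u = T y * q;
    model_ker_pair : forall y (u u' : L), typI y -> E (tgt y) * u = u ->
      E (tgt (bar y)) * u' = u' -> T y * u + T (bar y) * u' = 0 ->
      exists q q',
        u = T (f y) * q - c y *: gpath E T (g y) (N y).-2 * q' /\
        u' = T (f (bar y)) * q' -
             c (bar y) *: gpath E T (g (bar y)) (N (bar y)).-2 * q
  }.

Lemma quot_wsa_model : gabriel_bipartite W ->
  wsa_model (L := wsa W) (qE (wsa_relations W)) (qT (wsa_relations W)).
Proof.
move=> bip; split.
- exact: quot_wsa_rep.
- by move=> v x; exact: quot_rad.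
- exact: (ker_mul_I bip).
- by move=> y u Iy big; exact: (ker_mul_II bip Iy big).
- by move=> y u Iy big; exact: (ker_mul_syz bip Iy big).
- exact: (ker_pair bip).
Qed.

End Model.

Section Resolutions.
Variables (K : fieldType) (W : weighted_tq K).
Hypothesis bip : gabriel_bipartite W.
Implicit Types (a b y z : arr W).
Local Notation f := (tq_f W).
Local Notation g := (@tq_g W).
Local Notation bar := (@tq_bar W).
Local Notation c := (@wc K W).
Local Notation N := (@arrN K W).
Variables (L : algType K) (E : vert W -> L) (T : arr W -> L).
Hypothesis HM : wsa_model E T.
Local Notation P := (gpath E T).
Local Notation PV v := (PV (E v)).
Let H : wsa_rep E T := model_rep HM.
Let HR : quiver_rep E T := wsa_quiver_rep H.
Let EE v : E v * E v = E v := rep_EE HR v.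

Lemma sum_src v y (F : arr W -> L) : src y = v ->
  \sum_(a | src a == v) F a = F y + F (bar y).
Proof.
move=> <-; rewrite (bigD1 y) //= (bigD1 (bar y)) /= ?src_bar ?eqxx ?bar_neq //.
rewrite big1 ?addr0 // => a /andP[/andP[]].
by rewrite src_eq => /orP[]/eqP->; rewrite eqxx.
Qed.

Section AtTarget.
Variable y : arr W.
Hypothesis Iy : typI y.
Local Notation iota := (tgt y).
Local Notation kap := (tgt (g y)).
Local Notation w := (syz_gen E T y).

Lemma syz_gen_E : E kap * w = w.
Proof.
rewrite /syz_gen mulrBr -!scalerAr mulrA -src_g -[src (g (g y))]src_bar barg.
by rewrite (rep_src HR) -[src (f (g y))]src_bar -gE (src_gpath HR).
Qed.

Lemma syz_gen_Er : w * E (src y) = w.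
Proof.
rewrite /syz_gen mulrBl -!scalerAl -mulrA -[in src y](f3 y) src_f (rep_tgt HR).
congr (_ - _ *: _); rewrite -src_f f3.
have -> : src y = src (iter (N y).-2 g (g (g y))) by rewrite iter_Z.
exact: (gpath_tgt HR).
Qed.

(** The differentials are left multiplication by [g y], [w], [y] and the cycle of [g y]. The image
    of [d2] is a second syzygy, so [d3] and [d4] compute its Ext groups in degrees 1 and 2. *)
Lemma resolution_tgt (S : rmodType L) : big_orbit y -> simple_rep E T iota S ->
  exists (d0 : {linear PV iota -> S}) (d1 : {linear PV kap -> PV iota})
    (d2 : {linear PV (src y) -> PV kap}) (d3 : {linear PV iota -> PV (src y)})
    (d4 : {linear PV iota -> PV iota}),
  [/\ surj d0, forall u, d0 u = 0 <-> exists u', d1 u' = u,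
      forall u, d1 u = 0 <-> exists u', d2 u' = u,
      forall u, d2 u = 0 <-> exists u', d3 u' = u
    & forall u, d3 u = 0 <-> exists u', d4 u' = u] /\
  [/\ forall u, pval (d2 u) = w * pval u, forall u, pval (d3 u) = T y * pval u
    & forall u, pval (d4 u) = P (g y) (N y) * pval u].
Proof.
move=> big simpS; have [d0 d0S d0K] := simple_cover HR (model_rad HM) simpS.
have [d1 d1E] : exists h : {linear PV kap -> PV iota},
    forall u, pval (h u) = T (g y) * pval u.
  by apply: PV_lmul; rewrite -src_g (rep_src HR).
have [d2 d2E] := PV_lmul (E (src y)) syz_gen_E.
have [d3 d3E] := PV_lmul (E iota) (rep_src HR y).
have [d4 d4E] : exists h : {linear PV iota -> PV iota},
    forall u, pval (h u) = P (g y) (N y) * pval u.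
  by apply: PV_lmul; rewrite -src_g (src_gpath HR).
exists d0, d1, d2, d3, d4; split; last by split.
split=> // u.
- rewrite d0K; split=> [[x Eu]|[u' <-]]; last first.
    exists (fun a => if a == g y then pval u' else 0).
    by rewrite d1E (sum_src _ (src_g y)) eqxx bar_neq mulr0 addr0.
  (* The radical at [iota] is generated by [T (g y)] alone, which is why one projective suffices in
     degree 1. *)
  have zf : T (f y) = T (g y) * ((c (f y))^-1 *: T (bar (g (g y)))).
    by rewrite -scalerAr (rel_II H) // scalerA mulVf ?scale1r ?wc_neq0.
  rewrite (sum_src _ (src_g y)) barg zf -mulrA -mulrDr in Eu.
  set X := (_ + _) in Eu; have [u' Eu'] := PV_proj (EE kap) X; exists u'.
  by apply: pval_inj; rewrite d1E Eu' Eu mulrA (rep_tgt HR).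
- rewrite pval_eq0 d1E; split=> [zu|[u' <-]].
    have [q Eq] := model_ker_II HM Iy big (pvalP u) zu.
    have [u' Eu'] := PV_proj (EE (src y)) q; exists u'.
    by apply: pval_inj; rewrite d2E Eu' mulrA syz_gen_Er Eq.
  by rewrite d2E mulrA (mul_syz_gen bip H) // mul0r.
- rewrite pval_eq0 d2E; split=> [wu|[u' <-]].
    have [q Eq] := model_ker_syz HM Iy big (pvalP u) wu.
    have [u' Eu'] := PV_proj (EE iota) q; exists u'.
    by apply: pval_inj; rewrite d3E Eu' mulrA (rep_tgt HR) Eq.
  by rewrite d3E mulrA (syz_gen_mul bip H) // mul0r.
- rewrite pval_eq0 d3E; split=> [yu|[u' <-]].
    have [x Ex] := model_ker_I HM Iy (pvalP u) yu.
    have [u' Eu'] := PV_proj (EE iota) x%:A; exists u'.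
    apply: pval_inj; rewrite d4E Eu' Ex mulrA mulr_algr; congr (_ *: _).
    by rewrite -[RHS](gpath_tgt HR) iter_Ng src_g.
  by rewrite d4E mulrA -gpathS (gpath_ge bip H) // mul0r.
Qed.

End AtTarget.

Lemma penultimate x : typI x -> iter (N x).-2 g (g x) = f (f (bar x)).
Proof.
move=> Ix; have [n4 _] := N_bar4 bip Ix.
by rewrite -iterSr prednK; [rewrite iter_N1'|lia].
Qed.

Lemma gpath_penult_E x : typI x ->
  P (g x) (N x).-2 * E (tgt (f (bar x))) = P (g x) (N x).-2.
Proof.
by move=> Ix; rewrite -src_f -penultimate //; exact: (gpath_tgt HR).
Qed.

Lemma gpath_penult_T x : typI x ->
  P (g x) (N x).-2 * T (f (f (bar x))) = P (g x) (N x).-1.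
Proof.
move=> Ix; rewrite -penultimate // -(gpathSr HR) prednK //.
by have [n4 _] := N_bar4 bip Ix; lia.
Qed.

Section AtSource.
Variable y : arr W.
Hypothesis Iy : typI y.
Let Iy' : typI (bar y). Proof. by rewrite typI_bar. Qed.

Lemma pair_complex (q q' : L) :
  T y * (T (f y) * q - c y *: P (g y) (N y).-2 * q') +
  T (bar y) * (T (f (bar y)) * q' - c (bar y) *: P (g (bar y)) (N (bar y)).-2 * q) = 0.
Proof.
have E1 x : typI x -> T x * P (g x) (N x).-2 = P x (N x).-1.
  move=> Ix; rewrite -gpathS prednK //; have [n4 _] := N_bar4 bip Ix; lia.
rewrite !mulrBr !mulrA !(wsa_rep1 H) barK -!scalerAr !E1 // -!scalerAl.
by rewrite addrA subrK subrr.
Qed.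

Lemma resolution_src (S : rmodType L) : simple_rep E T (src y) S ->
  exists (d0 : {linear PV (src y) -> S})
    (d1 : {linear (PV (tgt y) * PV (tgt (bar y)))%type -> PV (src y)})
    (d2 : {linear (PV (tgt (f y)) * PV (tgt (f (bar y))))%type ->
             (PV (tgt y) * PV (tgt (bar y)))%type}),
  [/\ surj d0, forall u, d0 u = 0 <-> exists u', d1 u' = u
    & forall u, d1 u = 0 <-> exists u', d2 u' = u] /\
  [/\ forall u, pval (d1 u) = T y * pval u.1 + T (bar y) * pval u.2,
      forall u, pval (d2 u).1 =
        T (f y) * pval u.1 - c y *: P (g y) (N y).-2 * pval u.2
    & forall u, pval (d2 u).2 = T (f (bar y)) * pval u.2 -
        c (bar y) *: P (g (bar y)) (N (bar y)).-2 * pval u.1].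
Proof.
move=> simpS; have [d0 d0S d0K] := simple_cover HR (model_rad HM) simpS.
have yb : E (src y) * T (bar y) = T (bar y) by rewrite -(src_bar y) (rep_src HR).
have [d1 d1E] := PV_lmul2 (E (tgt y)) (E (tgt (bar y))) (rep_src HR y) yb.
have EP x : E (tgt x) * - (c x *: P (g x) (N x).-2) = - (c x *: P (g x) (N x).-2).
  by rewrite mulrN -scalerAr -src_g (src_gpath HR).
have Ef x : E (tgt x) * T (f x) = T (f x) by rewrite -src_f (rep_src HR).
have [d21 d21E'] := PV_lmul2 (E (tgt (f y))) (E (tgt (f (bar y)))) (Ef y) (EP y).
have [d22 d22E'] := PV_lmul2 (E (tgt (f y))) (E (tgt (f (bar y))))
  (EP (bar y)) (Ef (bar y)).
have d21E u : pval (d21 u) =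
    T (f y) * pval u.1 - c y *: P (g y) (N y).-2 * pval u.2.
  by rewrite d21E' mulNr.
have d22E u : pval (d22 u) = T (f (bar y)) * pval u.2 -
    c (bar y) *: P (g (bar y)) (N (bar y)).-2 * pval u.1.
  by rewrite d22E' mulNr addrC.
have lin : linear (fun u => (d21 u, d22 u)) by move=> x u u'; rewrite !linearP.
exists d0, d1, (lin_of lin); split; last by split=> // u; rewrite lin_ofE.
split=> // u.
- rewrite d0K; split=> [[x Eu]|[u' <-]]; last first.
    exists (fun a => if a == y then pval u'.1 else pval u'.2).
    by rewrite (sum_src _ (erefl (src y))) eqxx bar_neq d1E.
  rewrite (sum_src _ (erefl (src y))) in Eu.
  have [u1 E1] := PV_proj (EE (tgt y)) (x y).
  have [u2 E2] := PV_proj (EE (tgt (bar y))) (x (bar y)).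
  exists (u1, u2); apply: pval_inj.
  by rewrite d1E /= E1 E2 !mulrA !(rep_tgt HR) Eu.
- rewrite pval_eq0 d1E; split=> [yu|[u' <-]].
    have [q [q' [E1 E2]]] := model_ker_pair HM Iy (pvalP u.1) (pvalP u.2) yu.
    have [u1 Eu1] := PV_proj (EE (tgt (f y))) q.
    have [u2 Eu2] := PV_proj (EE (tgt (f (bar y)))) q'.
    have last := gpath_penult_E Iy.
    have last' := gpath_penult_E Iy'; rewrite barK in last'.
    exists (u1, u2); rewrite lin_ofE; case: u yu E1 E2 => v1 v2 /= yu E1 E2.
    congr (_, _); apply: pval_inj; rewrite ?d21E ?d22E /= Eu1 Eu2 ?E1 ?E2.
      by rewrite !mulrA (rep_tgt HR) -!scalerAl last.
    by rewrite !mulrA (rep_tgt HR) -!scalerAl last'.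
  by rewrite lin_ofE /= d21E d22E pair_complex.
Qed.

End AtSource.

Section ExtVanishing.
Variables (y : arr W) (S U : rmodType L).
Hypothesis Iy : typI y.

Section AtSource.
Hypothesis simpS : simple_rep E T (src y) S.
Hypothesis U1 : forall n1 n2 : U, ract n1 (E (tgt y)) = n1 ->
  ract n2 (E (tgt (bar y))) = n2 ->
  exists u, ract u (T y) = n1 /\ ract u (T (bar y)) = n2.
Hypothesis U2 : forall n1 n2 : U, ract n1 (E (tgt (f y))) = n1 ->
  ract n2 (E (tgt (f (bar y)))) = n2 ->
  ract n1 (T (f (f y))) + ract n2 (T (f (f (bar y)))) = 0 -> n1 = 0 /\ n2 = 0.

(** A map from a right ideal [E v * L] to [U] is an element of [U] fixed by [E v]. By [U1] every map
    in degree 1 factors through [d1]. By [U2] a cocycle in degree 2 is 0: it is tested on the pair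
    of [T (f (f y))] and [T (f (f (bar y)))], which [rel_V] puts into the kernel of [d2]. *)
Lemma ext_src : ext_zero 1 S U /\ ext_zero 2 S U.
Proof.
have [d0 [d1 [d2 [[d0S ex0 ex1] [d1E d21E d22E]]]]] := resolution_src Iy simpS.
have projR v1 v2 : projective (PV v1 * PV v2)%type.
  by apply: projective_prod; apply: PV_projective.
have comp0 (Q : proj_resolution S) : comparable (pr_eps Q) (fun _ : unit => d0).
  by apply: comparable_start1 => //; [exact: pr_projective|exact: PV_projective
    |exact: pr_eps_surj].
have comp1 (Q : proj_resolution S) :
    comparable (@pr_diff _ _ _ Q 0) (fun _ : unit => d1).
  by apply: comparable_step1 (comp0 Q); [exact: pr_projective|exact: pr_projective
    |exact: projR|exact: pr_exact0|exact: ex0].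
have comp2 (Q : proj_resolution S) :
    comparable (@pr_diff _ _ _ Q 1) (fun _ : unit => d2).
  by apply: comparable_step1 (comp1 Q); [exact: pr_projective|exact: pr_projective
    |exact: projR|exact: pr_exact|exact: ex1].
split=> Q; apply: vanish_ext; [apply: (vanish_at1 (comp1 Q))|
  apply: (vanish_at1 (comp2 Q))] => psi psi0;
  have [n1 [n2 [n1E n2E psiE]]] := PV_ext2 psi (EE _) (EE _).
- have [u [Eu1 Eu2]] := U1 n1E n2E.
  have [chi chiE] := PV_hom u (E (src y)); exists chi => x.
  by rewrite chiE d1E ractDr -!ractA Eu1 Eu2 psiE.
- have [u1 E1] : exists u : PV (tgt (f y)), pval u = T (f (f y)).
    by apply: pval_lift; rewrite -src_f (rep_src HR).
  have [u2 E2] : exists u : PV (tgt (f (bar y))), pval u = T (f (f (bar y))).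
    by apply: pval_lift; rewrite -src_f (rep_src HR).
  have Iy' : typI (bar y) by rewrite typI_bar.
  have last := gpath_penult_T Iy.
  have last' := gpath_penult_T Iy'; rewrite barK in last'.
  have /psi0 : d2 (u1, u2) = 0.
    have K1 : (d2 (u1, u2)).1 = 0.
      by apply/pval_eq0; rewrite d21E /= E1 E2 (rel_V H) -scalerAl last subrr.
    have K2 : (d2 (u1, u2)).2 = 0.
      by apply/pval_eq0; rewrite d22E /= E1 E2 (rel_V H) -scalerAl last' subrr.
    by case: (d2 _) K1 K2 => p q /= -> ->.
  rewrite psiE /= E1 E2 => /(U2 n1E n2E)[n10 n20].
  have lin : linear (fun _ : (PV (tgt y) * PV (tgt (bar y)))%type => 0 : U).
    by move=> a u v; rewrite scaler0 addr0.
  by exists (lin_of lin) => x; rewrite psiE n10 n20 !ract0l addr0.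
Qed.

End AtSource.

Section AtTarget.
Hypothesis big : big_orbit y.
Hypothesis simpS : simple_rep E T (tgt y) S.
Variable Om : rmodType L.
Hypothesis syzOm : is_syzygy2 S Om.
Hypothesis U3 : forall n : U, ract n (E (tgt y)) = n ->
  exists u, ract u (T y) = n.
Hypothesis U4 : forall n : U, ract n (E (tgt y)) = n ->
  ract n (T (g y)) = 0 -> n = 0.

(** A resolution of [Om], spliced with the given covers, is compared with the explicit one, so the
    relevant differentials are [d3] and [d4]. [U3] factors maps through [d3]. [U4] kills cocycles on
    the next term, tested on [T (g y)], which [d4] sends to 0 by [socII_mul]. *)
Lemma ext_tgt : ext_zero 1 Om U /\ ext_zero 2 Om U.
Proof.
have [d0 [d1 [d2 [d3 [d4 [[d0S ex0 ex1 ex2 ex3] [d2E d3E d4E]]]]]]] :=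
  resolution_tgt Iy big simpS.
have [Pa [Pb [p [r1 [i2 [[projPa projPb pS] [pK i2I r1K]]]]]]] := syzygy2_cover syzOm.
have i20 x : i2 x = 0 -> x = 0 by move=> x0; apply: i2I; rewrite x0 linear0.
have comp0 : comparable p (fun _ : unit => d0).
  by apply: comparable_start1 => //; exact: PV_projective.
have comp1 : comparable r1 (fun _ : unit => d1).
  by apply: comparable_step1 comp0 => //; exact: PV_projective.
have comp2 (Q : proj_resolution Om) : exists r2 : {linear pr_obj Q 0 -> Pb},
    (forall x, r2 x = i2 (pr_eps Q x)) /\ comparable r2 (fun _ : unit => d2).
  have [r2 r2E] := lin_comp i2 (pr_eps Q); exists r2; split=> //.
  apply: comparable_step1 comp1 => //; [exact: pr_projective|exact: PV_projective|].
  move=> x; rewrite r1K; split=> [[z <-]|[z <-]]; last by exists (pr_eps Q z).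
  by have [z' <-] := @pr_eps_surj _ _ _ Q z; exists z'.
have comp3 (Q : proj_resolution Om) :
    comparable (@pr_diff _ _ _ Q 0) (fun _ : unit => d3).
  have [r2 [r2E c2]] := comp2 Q.
  apply: comparable_step1 c2 => //; try exact: pr_projective; try exact: PV_projective.
  by move=> x; rewrite -pr_exact0 r2E; split=> [/i20|->] //; exact: linear0.
have comp4 (Q : proj_resolution Om) :
    comparable (@pr_diff _ _ _ Q 1) (fun _ : unit => d4).
  by apply: comparable_step1 (comp3 Q); [exact: pr_projective|exact: pr_projective
    |exact: PV_projective|exact: pr_exact|exact: ex3].
split=> Q; apply: vanish_ext; [apply: (vanish_at1 (comp3 Q))|
  apply: (vanish_at1 (comp4 Q))] => psi psi0;
  have [n nE psiE] := PV_ext (EE _) psi.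
- have [u Eu] := U3 nE; have [chi chiE] := PV_hom u (E (src y)).
  by exists chi => x; rewrite chiE d3E psiE -ractA Eu.
- have [u1 E1] : exists u : PV (tgt y), pval u = T (g y).
    by apply: pval_lift; rewrite -src_g (rep_src HR).
  have /psi0 : d4 u1 = 0 by apply/pval_eq0; rewrite d4E E1 (socII_mul bip H).
  rewrite psiE E1 => /(U4 nE) n0.
  have lin : linear (fun _ : PV (tgt y) => 0 : U).
    by move=> a u v; rewrite scaler0 addr0.
  by exists (lin_of lin) => x; rewrite psiE n0 ract0l.
Qed.

(* Composites [U -> Om -> U] modulo those through a projective are composites
   [U -> w L -> U], where [w = syz_gen y] generates the second syzygy in the
   explicit resolution. *)
Lemma syzygy_factor (th : {linear U -> Om}) (pi : {linear Om -> U}) :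
  exists (Q : rmodType L) (al : {linear U -> Q}) (be : {linear Q -> U})
    (n : U) (t : {linear U -> PV (tgt (g y))}),
  [/\ projective Q, ract n (E (src y)) = n, ract n (T y) = 0
    & forall x, exists s, pval (t x) = syz_gen E T y * s /\
        E (src y) * s = s /\ pi (th x) = be (al x) + ract n s].
Proof.
have [d0 [d1 [d2 [d3 [d4 [[d0S ex0 ex1 ex2 ex3] [d2E d3E d4E]]]]]]] :=
  resolution_tgt Iy big simpS.
have [Pa [Pb [p [r1 [i2 [[projPa projPb pS] [pK i2I r1K]]]]]]] := syzygy2_cover syzOm.
have i20 x : i2 x = 0 -> x = 0 by move=> x0; apply: i2I; rewrite x0 linear0.
have comp0 : comparable p (fun _ : unit => d0).
  by apply: comparable_start1 => //; exact: PV_projective.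
have comp1 : comparable r1 (fun _ : unit => d1).
  by apply: comparable_step1 comp0 => //; exact: PV_projective.
have [v [u [u' [h [vK uE vuE]]]]] := comp1.
have [v2 v2E] : exists v2 : {linear PV (src y) -> Om},
    forall x, i2 (v2 x) = v tt (d2 x).
  apply: (projective_lift (h := fun x => v tt (d2 x))).
  - exact: PV_projective.
  - by move=> a x z; rewrite !linearP.
  - by move=> x; apply/r1K/vK/ex1; exists x.
have sum1 (x : Pb) : \sum_j v j (u j x) = v tt (u tt x).
  by rewrite (bigD1 tt) //= big1 ?addr0 // => -[].
(* On the image of [Om] in [Pb] the map [r1] vanishes, so the identity there is [v u] plus the
   restriction of [hh]. The latter passes through the projective [Pb]. *)
have [hh hhE] : exists hh : {linear Pb -> Om},
    forall x, i2 (hh x) = x - v tt (u tt x) - h (r1 x).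
  have h_lift (x : Pb) : exists o, i2 o = x - v tt (u tt x) - h (r1 x).
    by apply/r1K; rewrite -sum1.
  have [hh hhE] := choice h_lift.
  have lin : linear hh.
    move=> a x x'; apply: i2I; rewrite linearP !hhE.
    have -> : h (r1 (a *: x + x')) = a *: h (r1 x) + h (r1 x') by rewrite !linearP.
    have -> : v tt (u tt (a *: x + x')) = a *: v tt (u tt x) + v tt (u tt x').
      by rewrite !linearP.
    rewrite !scalerBr !opprD (addrACA (a *: x) x'); exact: addrACA.
  by exists (lin_of lin).
have [be beE] := lin_comp pi hh; have [al alE] := lin_comp i2 th.
have [t tE] := lin_comp (u tt) al; have [nu nuE] := lin_comp pi v2.
have [n nE nuP] := PV_ext (EE (src y)) nu.
exists Pb, al, be, n, t; split=> // [|x].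
  have [s0 s0E] := pval_lift (rep_src HR y).
  rewrite -s0E -nuP nuE (_ : v2 s0 = 0) ?linear0 //; apply: i20.
  rewrite v2E (_ : d2 s0 = 0) ?linear0 //.
  by apply/pval_eq0; rewrite d2E s0E (syz_gen_mul bip H).
have r10 : r1 (al x) = 0 by apply/r1K; exists (th x); rewrite alE.
have [s sE] : exists s, d2 s = t x.
  by apply/ex1; rewrite tE uE r10 linear0.
exists (pval s); rewrite -sE d2E pvalP; split=> //; split=> //.
rewrite beE -nuP nuE -linearD; congr (pi _); apply: i2I.
by rewrite linearD /= hhE v2E sE r10 linear0 subr0 tE alE subrK.
Qed.

End AtTarget.

End ExtVanishing.

End Resolutions.

(** * A uniserial module outside add M *)

Section FiniteSums.
Variables (K : fieldType) (A : algType K).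
Implicit Types (X Y N : rmodType A).

Definition sum_of (J : finType) X (Y : J -> rmodType A) : Prop :=
  exists (inj : forall j, {linear Y j -> X}) (prj : forall j, {linear X -> Y j}),
    forall x, \sum_j inj j (prj j x) = x.

Lemma sum_of_prod X Y : sum_of (X * Y)%type (fun b : bool => if b then X else Y).
Proof.
have i1 : linear (fun x : X => (x, 0 : Y)).
  by move=> a x x'; congr (_, _); rewrite /= scaler0 addr0.
have i2 : linear (fun y : Y => (0 : X, y)).
  by move=> a x x'; congr (_, _); rewrite /= scaler0 addr0.
have p1 : linear (fun x : X * Y => x.1) by [].
have p2 : linear (fun x : X * Y => x.2) by [].
exists (fun b => if b return {linear (if b then X else Y) -> (X * Y)%type}
  then lin_of i1 else lin_of i2).
exists (fun b => if b return {linear (X * Y)%type -> (if b then X else Y)}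
  then lin_of p1 else lin_of p2) => -[x y].
rewrite (bigD1 true) //= (bigD1 false) //= big1 ?addr0 => [|[] //].
by congr (_, _); rewrite /= ?addr0 ?add0r.
Qed.

Lemma dsum_projP (I : finType) (V : I -> rmodType A) i :
  linear (fun x : dsum V => dsum_proj x i).
Proof.
move=> a x y.
by rewrite -[LHS]/(dsum_proj (dsum_add (dsum_scale a x) y) i) !dsumE.
Qed.

Lemma sum_of_dsum (I : finType) (V : I -> rmodType A) : sum_of (dsum V) V.
Proof.
have injL i : linear (fun v : V i => dsum_mk (dfwith (fun j => 0 : V j) v)).
  move=> a v v'; apply/dsumP => j; rewrite dsum_projP !dsumE.
  case: (eqVneq i j) => [ij|ij]; last by rewrite !dfwith_out // scaler0 addr0.
  by case: j / ij; rewrite !dfwith_in.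
exists (fun i => lin_of (injL i)), (fun i => lin_of (@dsum_projP I V i)) => x.
apply/dsumP => j; rewrite -[dsum_proj _ _]/(lin_of (@dsum_projP I V j) _) linear_sum.
rewrite (bigD1 j) //= big1 => [|i ij]; rewrite dsumE.
  by rewrite dfwith_in addr0.
by rewrite dfwith_out.
Qed.

Lemma sum_of_ffun n X : sum_of {ffun 'I_n -> X} (fun _ : 'I_n => X).
Proof.
have injL i : linear (fun v : X => [ffun j : 'I_n => if j == i then v else 0]).
  move=> a v v'; apply/ffunP => j; rewrite !ffunE; case: eqP => //.
  by rewrite scaler0 addr0.
have prjL i : linear (fun x : {ffun 'I_n -> X} => x i).
  by move=> a x x'; rewrite !ffunE.
exists (fun i => lin_of (injL i)), (fun i => lin_of (prjL i)) => x.
apply/ffunP => j; rewrite sum_ffunE (bigD1 j) //= big1 => [|i ij].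
  by rewrite ffunE eqxx addr0.
by rewrite ffunE eq_sym (negbTE ij).
Qed.

Lemma ext_zero_sum_of (J : finType) X (Y : J -> rmodType A) N n :
  sum_of X Y -> (forall j, ext_zero n.+1 (Y j) N) -> ext_zero n.+1 X N.
Proof. by move=> [inj [prj idE]]; exact: (ext_zero_sum idE). Qed.

Lemma ext_zero_prod X Y N n : ext_zero n.+1 X N -> ext_zero n.+1 Y N ->
  ext_zero n.+1 (X * Y)%type N.
Proof. by move=> HX HY; apply: (ext_zero_sum_of (sum_of_prod X Y)) => -[]. Qed.

Lemma regmod_projective : projective (regmod A).
Proof.
move=> X Y p h p_surj; have [x xE] := p_surj (h (1 : A)).
have lin : linear (fun a : regmod A => ract x (a : A)).
  by move=> a b b'; rewrite -[a *: b]/((b : A) * a) ractDr -ractA.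
exists (lin_of lin) => a; rewrite lin_ofE ract_hom xE -ract_hom.
by congr (h _); rewrite regmodE mul1r.
Qed.

(** The comparison is with the sequence of copies of [X] whose augmentation is the identity and
    whose differentials are 0 and the identity; it is exact and avoids a zero module. *)
Lemma projective_ext X N : projective X -> ext_zero 1 X N /\ ext_zero 2 X N.
Proof.
move=> projX; have idL : linear (@id X) by [].
have zL : linear (fun _ : X => 0 : X) by move=> a x y; rewrite scaler0 addr0.
have comp0 (Q : proj_resolution X) :
    comparable (pr_eps Q) (fun _ : unit => lin_of idL).
  apply: comparable_start1 => //; [exact: pr_projective|exact: pr_eps_surj|].
  by move=> x; exists x.
have comp1 (Q : proj_resolution X) :
    comparable (@pr_diff _ _ _ Q 0) (fun _ : unit => lin_of zL).
  apply: comparable_step1 (comp0 Q) => //; try exact: pr_projective.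
    exact: pr_exact0.
  by move=> x; rewrite lin_ofE; split=> [->|[_ <-] //]; exists 0.
have comp2 (Q : proj_resolution X) :
    comparable (@pr_diff _ _ _ Q 1) (fun _ : unit => lin_of idL).
  apply: comparable_step1 (comp1 Q) => //; try exact: pr_projective.
    exact: pr_exact.
  by move=> x; rewrite lin_ofE; split=> // _; exists x.
split=> Q; apply: vanish_ext; [apply: (vanish_at1 (comp1 Q))|
  apply: (vanish_at1 (comp2 Q))] => psi psi0.
  by exists psi => x; rewrite lin_ofE linear0 psi0.
by exists psi.
Qed.

End FiniteSums.

Section UniserialModule.
Variables (K : fieldType) (W : weighted_tq K).
Implicit Types (a b y z : arr W).
Local Notation f := (tq_f W).
Local Notation g := (@tq_g W).
Local Notation bar := (@tq_bar W).
Local Notation N := (@arrN K W).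
Variables (L : algType K) (E : vert W -> L) (T : arr W -> L).
Local Notation P := (gpath E T).

Definition uniserial y n (rho : {lrmorphism L -> 'M[K]_n.+1}) : Prop :=
  (forall v k, bvec k *m rho (E v) = (src (iter k g y) == v)%:R *: bvec k) /\
  (forall a k, bvec k *m rho (T a) = (a == iter k g y)%:R *: bvec k.+1).

Lemma bvec_sum n (v : 'rV[K]_n.+1) : v = \sum_(k < n.+1) v 0 k *: bvec k.
Proof.
rewrite {1}(row_sum_delta v); apply: eq_bigr => k _.
by rewrite bvec_delta.
Qed.

Section Coordinates.
Variables (y : arr W) (n : nat) (rho : {lrmorphism L -> 'M[K]_n.+1}).
Hypothesis Hrho : uniserial y rho.
Implicit Types (v : 'rV[K]_n.+1) (j : 'I_n.+1).

Lemma uni_E v u j : (v *m rho (E u)) 0 j = (src (iter j g y) == u)%:R * v 0 j.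
Proof.
rewrite {1}(bvec_sum v) mulmx_suml summxE (bigD1 j) //= big1 => [|k kj].
  by rewrite -scalemxAl Hrho.1 !mxE eqxx mulr1 addr0 mulrC.
rewrite -scalemxAl Hrho.1 !mxE.
by rewrite [j == k :> nat](_ : _ = false) ?mulr0 // eq_sym; exact: negbTE.
Qed.

Lemma uni_T v a j (k : 'I_n.+1) : j = k.+1 :> nat ->
  (v *m rho (T a)) 0 j = (a == iter k g y)%:R * v 0 k.
Proof.
move=> jk; rewrite {1}(bvec_sum v) mulmx_suml summxE (bigD1 k) //= big1 => [|l lk].
  by rewrite -scalemxAl Hrho.2 !mxE jk eqxx mulr1 addr0 mulrC.
rewrite -scalemxAl Hrho.2 !mxE jk eqSS.
by rewrite [k == l :> nat](_ : _ = false) ?mulr0 // eq_sym; exact: negbTE.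
Qed.

Lemma uni_bvec_T a k : bvec k *m rho (T a) = (a == iter k g y)%:R *: bvec k.+1.
Proof. exact: Hrho.2. Qed.

Hypothesis HR : quiver_rep E T.
Hypothesis rad : rep_rad E T.

Lemma uni_triangular k (x : L) : (0 < k)%N -> (bvec k *m rho x) 0 0 = 0.
Proof.
have [d] := ubnP (n.+1 - k); elim: d k x => // d IHd k x kd k0.
have [lt|ge] := ltnP n k; first by rewrite bvec_out // mul0mx mxE.
pose v := src (iter k g y).
have -> : bvec k *m rho x = bvec k *m rho (E v * x).
  by rewrite [rho (E v * x)]rmorphM mulmxA Hrho.1 eqxx scale1r.
have [l [w ->]] := rad v x; rewrite linearD linear_sum mulmxDr mulmx_sumr mxE.
rewrite linearZ -scalemxAr Hrho.1 eqxx scale1r !mxE ltn_eqF // mulr0 add0r.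
rewrite summxE big1 // => a _; rewrite rmorphM mulmxA Hrho.2 -scalemxAl mxE.
by rewrite IHd ?mulr0 //; lia.
Qed.

Lemma uni_lead_mul v (x : L) : (v *m rho x) 0 0 = v 0 0 * (bvec 0 *m rho x) 0 0.
Proof.
rewrite {1}(bvec_sum v) mulmx_suml summxE (bigD1 0) //= big1 => [|k k0].
  by rewrite -scalemxAl mxE addr0.
rewrite -scalemxAl mxE uni_triangular ?mulr0 //.
by rewrite lt0n; exact: k0.
Qed.

(** The scalar [l] of [rep_rad] thus becomes a matrix coefficient, the same in every uniserial
    module starting at this vertex. This allows a change of module within a computation. *)
Lemma uni_lead (x : L) l w : E (src y) * x =
  l *: E (src y) + \sum_(a | src a == src y) T a * w a ->
  (bvec 0 *m rho x) 0 0 = l.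
Proof.
move=> Ex; have -> : bvec 0 *m rho x = bvec 0 *m rho (E (src y) * x).
  by rewrite [rho (_ * x)]rmorphM mulmxA Hrho.1 eqxx scale1r.
rewrite Ex linearD linear_sum mulmxDr mulmx_sumr mxE.
rewrite linearZ -scalemxAr Hrho.1 eqxx scale1r !mxE mulr1.
rewrite summxE big1 ?addr0 // => a _; rewrite rmorphM mulmxA Hrho.2 -scalemxAl mxE.
by rewrite uni_triangular ?mulr0.
Qed.

End Coordinates.

Lemma uni_lead_eq y z n n' (rho : {lrmorphism L -> 'M[K]_n.+1})
    (sig : {lrmorphism L -> 'M[K]_n'.+1}) (x : L) : rep_rad E T ->
  uniserial y rho -> uniserial z sig -> src y = src z ->
  (bvec 0 *m rho x) 0 0 = (bvec 0 *m sig x) 0 0.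
Proof.
move=> rad Hrho Hsig yz; have [l [w Ex]] := rad (src y) x.
by rewrite (uni_lead Hrho rad Ex) (@uni_lead z _ sig Hsig rad x l w) // -yz.
Qed.

Hypothesis bip : gabriel_bipartite W.
Hypothesis HM : wsa_model E T.
Hypothesis HU : forall y n, (n.+2 <= N y)%N ->
  exists rho : {lrmorphism L -> 'M[K]_n.+1}, uniserial y rho.
Let H : wsa_rep E T := model_rep HM.
Let HR : quiver_rep E T := wsa_quiver_rep H.
Let rad : rep_rad E T := model_rad HM.

Variables (y0 : arr W) (rho : {lrmorphism L -> 'M[K]_3}).
Hypotheses (Iy0 : typI y0) (N6 : (6 <= N y0)%N) (Hrho : uniserial y0 rho).
Hypothesis big : forall y, typI y -> big_orbit y.
Local Notation U := (mxmod rho).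
Let u0 : U := bvec 0.

Let j1 : 'I_3 := inord 1.
Let j2 : 'I_3 := inord 2.
Let j1E : j1 = 1%N :> nat. Proof. by rewrite inordK. Qed.
Let j2E : j2 = 2%N :> nat. Proof. by rewrite inordK. Qed.

(** The basis vectors 0 and 2 of [U] sit at sources of type I arrows, which are never targets of
    type I arrows. The vector 1 sits at [tgt y0], and [y0] is the only type I arrow ending there. *)
Lemma uni_tgt y (n : U) : typI y -> ract n (E (tgt y)) = n ->
  exists2 b : K, n = b *: (bvec 1 : 'rV[K]_3) & y != y0 -> b = 0.
Proof.
move=> Iy nE; have coord j : n 0 j = (src (iter j g y0) == tgt y)%:R * n 0 j.
  by rewrite -[in RHS](uni_E Hrho) -mxractE nE.
exists (n 0 j1) => [|ne].
  rewrite {1}(bvec_sum n) (bigD1 j1) //= big1 ?addr0 ?j1E // => k k1.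
  suff -> : n 0 k = 0 by rewrite scale0r.
  rewrite coord; have Ik : typI (iter k g y0).
    case: k k1 => -[|[|[|//]]] /= lt; rewrite -val_eqE /= j1E // => _.
    by rewrite typI_gg.
  by rewrite (negbTE (src_typI_g bip Ik Iy)) mul0r.
rewrite coord j1E /= src_g typI_tgt_inj // eq_sym (negbTE ne); exact: mul0r.
Qed.

Lemma uni_bvec1_g y (b : K) : ract (b *: (bvec 1 : 'rV[K]_3) : U) (T (g y)) =
  (b * (y == y0)%:R) *: (bvec 2 : 'rV[K]_3).
Proof.
rewrite mxractE -scalemxAl (uni_bvec_T Hrho) scalerA /= (inj_eq (@g_inj W)).
by [].
Qed.

Lemma uni_bvec0 y (b : K) : ract (b *: (bvec 0 : 'rV[K]_3) : U) (T y) =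
  (b * (y == y0)%:R) *: (bvec 1 : 'rV[K]_3).
Proof. by rewrite mxractE -scalemxAl (uni_bvec_T Hrho) scalerA. Qed.

Lemma bvec2_inj (b : K) : b *: (bvec 2 : 'rV[K]_3) = 0 -> b = 0.
Proof. by move=> /rowP/(_ j2); rewrite !mxE j2E mulr1. Qed.

Lemma uni_tgt_lift y (n1 n2 : U) : typI y -> ract n1 (E (tgt y)) = n1 ->
  ract n2 (E (tgt (bar y))) = n2 ->
  exists u : U, ract u (T y) = n1 /\ ract u (T (bar y)) = n2.
Proof.
move=> Iy /(uni_tgt Iy)[b1 -> b1P].
have Iy' : typI (bar y) by rewrite typI_bar.
move=> /(uni_tgt Iy')[b2 -> b2P].
(* At most one of [y] and [bar y] is [y0], so at most one of [b1] and [b2] is nonzero. *)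
exists ((b1 + b2) *: (bvec 0 : 'rV[K]_3)); rewrite !uni_bvec0.
have [yy|ne] := eqVneq y y0.
  have by0 : bar y != y0 by rewrite -yy bar_neq.
  by rewrite (b2P by0) addr0 mulr1 (negbTE by0) mulr0 scale0r.
rewrite (b1P ne) add0r mulr0 scale0r; split=> //.
by have [|/b2P->] := eqVneq (bar y) y0; rewrite ?mulr1 ?mul0r.
Qed.

Lemma uni_tgt_f y (n : U) : typI y -> ract n (E (tgt (f y))) = n ->
  exists z (b : K), [/\ typI z, g z = f (f y), n = b *: (bvec 1 : 'rV[K]_3)
    & z != y0 -> b = 0].
Proof.
move=> Iy nE; have [z Iz gz] : exists2 z, typI z & g z = f (f y).
  by apply: typI_prev; rewrite /typII !f3.
move: nE; rewrite -src_f -gz src_g => /(uni_tgt Iz)[b nb b0].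
by exists z, b.
Qed.

(** The two predecessors [z1] and [z2] differ because [y] and [bar y] do, so at most one of them is
    [y0]. On that component [g y0] acts injectively, sending [bvec 1] to [bvec 2]. *)
Lemma uni_pair_inj y (n1 n2 : U) : typI y ->
  ract n1 (E (tgt (f y))) = n1 -> ract n2 (E (tgt (f (bar y)))) = n2 ->
  ract n1 (T (f (f y))) + ract n2 (T (f (f (bar y)))) = 0 -> n1 = 0 /\ n2 = 0.
Proof.
move=> Iy /(uni_tgt_f Iy)[z1 [b1 [_ gz1 -> b1P]]].
have Iy' : typI (bar y) by rewrite typI_bar.
move=> /(uni_tgt_f Iy')[z2 [b2 [_ gz2 -> b2P]]].
have [z1y|/b1P->] := eqVneq z1 y0; last first.
  rewrite scale0r ract0l add0r -gz2 uni_bvec1_g => /bvec2_inj.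
  have [_|/b2P->] := eqVneq z2 y0; last by rewrite scale0r.
  by rewrite mulr1 => ->; rewrite scale0r.
have /b2P-> : z2 != y0.
  apply/eqP => z2y; have := bar_neq y; rewrite -(inj_eq (@perm_inj _ f)).
  by rewrite -(inj_eq (@perm_inj _ f)) -gz1 -gz2 z1y z2y eqxx.
rewrite scale0r ract0l addr0 -gz1 uni_bvec1_g z1y eqxx mulr1 => /bvec2_inj ->.
by rewrite scale0r.
Qed.

Lemma uni_src_lift y (n : U) : typI y -> ract n (E (tgt y)) = n ->
  exists u : U, ract u (T y) = n.
Proof.
move=> Iy /(uni_tgt Iy)[b -> b0]; exists (b *: (bvec 0 : 'rV[K]_3)).
by rewrite uni_bvec0; have [|/b0->] := eqVneq y y0; rewrite ?mulr1 ?mul0r.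
Qed.

Lemma uni_tgt_inj y (n : U) : typI y -> ract n (E (tgt y)) = n ->
  ract n (T (g y)) = 0 -> n = 0.
Proof.
move=> Iy /(uni_tgt Iy)[b -> b0]; rewrite uni_bvec1_g => /bvec2_inj.
have [_|/b0-> _] := eqVneq y y0; last by rewrite scale0r.
by rewrite mulr1 => ->; rewrite scale0r.
Qed.

Lemma uni_ext_src y (S : rmodType L) : typI y -> simple_rep E T (src y) S ->
  ext_zero 1 S U /\ ext_zero 2 S U.
Proof.
move=> Iy simpS; apply: (ext_src bip HM Iy simpS) => [n1 n2|n1 n2].
  exact: uni_tgt_lift.
exact: uni_pair_inj.
Qed.

Lemma uni_ext_tgt y (S Om : rmodType L) : typI y -> simple_rep E T (tgt y) S ->
  is_syzygy2 S Om -> ext_zero 1 Om U /\ ext_zero 2 Om U.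
Proof.
move=> Iy simpS syz; apply: (ext_tgt bip HM Iy (big Iy) simpS syz) => n.
  exact: uni_src_lift.
exact: uni_tgt_inj.
Qed.

(** The condition is linear in the composite and therefore passes to finite direct sums, in contrast
    to the mere absence of [U] as a summand. *)
Definition small (X : rmodType L) : Prop :=
  forall (th : {linear U -> X}) (pi : {linear X -> U}),
    (pi (th u0) : 'rV[K]_3) 0 0 = 0.

Lemma small_sum_of (J : finType) X (Y : J -> rmodType L) :
  sum_of X Y -> (forall j, small (Y j)) -> small X.
Proof.
move=> [inj [prj idE]] Ysmall th pi; rewrite -(idE (th u0)) linear_sum summxE.
apply: big1 => j _; have [th' th'E] := lin_comp (prj j) th.
by have [pi' pi'E] := lin_comp pi (inj j); rewrite -pi'E -th'E Ysmall.
Qed.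

Let u0E : ract u0 (E (src y0)) = u0.
Proof. by rewrite mxractE Hrho.1 eqxx scale1r. Qed.

Let u0T a : a != y0 -> ract u0 (T a) = 0.
Proof. by move=> ne; rewrite mxractE Hrho.2 (negbTE ne) scale0r. Qed.

Let u0P3 : ract u0 (P y0 3) = 0.
Proof.
rewrite mxractE gpathS rmorphM mulmxA Hrho.2 eqxx scale1r.
rewrite (gpath2 HR) rmorphM mulmxA Hrho.2 eqxx scale1r Hrho.2.
by rewrite [bvec _]bvec_out ?scaler0.
Qed.

(* The coefficient of the top of [U] is read off in any uniserial module with
   the same top. *)
Let lead y n (sig : {lrmorphism L -> 'M[K]_n.+1}) (x : L) :
  uniserial y sig -> src y = src y0 ->
  (bvec 0 *m rho x) 0 0 = (bvec 0 *m sig x) 0 0.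
Proof. by move=> Hsig yy; apply: (uni_lead_eq x rad Hrho Hsig); rewrite yy. Qed.

(** [pi] lifts through the cover [p] of [U], and the image [t] of the top satisfies
    [t * T (bar y0) = 0], since [bar y0] kills [u0]. Hence [t] has no idempotent part: in the
    uniserial module of length 2 along [bar y0], the arrow [bar y0] does not kill the top. *)
Lemma small_projective X : projective X -> small X.
Proof.
move=> projX th pi; have EE := rep_EE HR (src y0).
have [p pE] := PV_hom u0 (E (src y0)).
have pS : surj p.
  move=> u; pose a := u 0 0 *: 1 + u 0 j1 *: T y0 + u 0 j2 *: P y0 2.
  have [v vE] := PV_proj EE a; exists v; rewrite pE vE -ractA u0E mxractE.
  rewrite !linearD !linearZ /= rmorph1 (gpath2 HR) rmorphM
    mulmx1 mulmxA !Hrho.2 !eqxx !scale1r Hrho.2 eqxx scale1r.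
  rewrite [RHS](bvec_sum u) !big_ord_recl big_ord0 addr0 addrA.
  by congr (_ *: bvec _ + _ *: bvec _ + _ *: bvec _); congr (u 0 _);
    apply: val_inj; rewrite /= ?j1E ?j2E.
have [h hE] := projX _ _ p pi pS; set t := pval (h (th u0)).
have tE : pi (th u0) = ract u0 t by rewrite -hE pE.
have tT : t * T (bar y0) = 0.
  have <- : pval (ract (h (th u0)) (T (bar y0))) = t * T (bar y0).
    by have := pval_linear (T (bar y0)) (h (th u0)) 0; rewrite !addr0.
  by rewrite -!ract_hom u0T ?bar_neq // !linear0.
rewrite tE mxractE; have [|sig Hsig] := HU (y := bar y0) (n := 1).
  by have [_] := N_bar4 bip Iy0; lia.
rewrite (lead t Hsig) ?src_bar //.
have := congr1 (fun q => (bvec 0 *m sig q) 0 (inord 1 : 'I_2)) tT.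
rewrite rmorphM mulmxA (@uni_T _ _ _ Hsig _ _ _ 0) ?inordK //= eqxx mul1r => ->.
by rewrite linear0 mulmx0 mxE.
Qed.

(** [T y0] moves the top coefficient of an element of [U] to coordinate 1, where it must vanish. *)
Lemma small_killed (X : rmodType L) :
  (forall (x : X) a, ract x (T a) = 0) -> small X.
Proof.
move=> XT th pi.
have E0 : ract (pi (th u0)) (T y0) = 0 by rewrite -ract_hom XT linear0.
have := congr1 (fun q : U => (q : 'rV[K]_3) 0 j1) E0.
by rewrite mxractE (@uni_T _ _ _ Hrho _ _ _ 0) ?j1E //= eqxx mul1r mxE.
Qed.

Lemma small_simple v X : simple_rep E T v X -> small X.
Proof.
move=> [x [_ xgen _ xT]]; apply: small_killed => z a.
have [k ->] := xgen z.
by rewrite ractA mulr_algl -mulr_algr -ractA xT ract0l.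
Qed.

(** By [syzygy_factor] the top coefficient is that of [n] times that of [s]. If the former is
    nonzero, then [y = bar y0]; in that case the path of length 3 along [y0], which kills [u0],
    forces the latter to vanish. *)
Lemma small_syzygy2 y (S Om : rmodType L) : typI y ->
  simple_rep E T (tgt y) S -> is_syzygy2 S Om -> small Om.
Proof.
move=> Iy simpS syz th pi.
have [Q [al [be [n [t [projQ nE nT facE]]]]]] :=
  syzygy_factor bip HM Iy (big Iy) simpS syz th pi.
have [s [tE [sE ->]]] := facE u0.
rewrite mxE (small_projective projQ) add0r mxractE (uni_lead_mul Hrho rad).
have [n0|n0] := eqVneq ((n : 'rV[K]_3) 0 0) 0; first by rewrite n0 mul0r.
have srcy : src y0 = src y.
  apply/eqP; have := congr1 (fun q : U => (q : 'rV[K]_3) 0 0) nE.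
  rewrite mxractE (uni_E Hrho) /=; case: eqP => // _ /eqP.
  by rewrite mul0r eq_sym (negbTE n0).
(* The alternative [y = y0] is excluded by [n T y = 0], because [y0] does not kill an element of [U]
   with nonzero top coefficient. *)
have yy0 : y0 = bar y.
  apply/eqP; move/eqP: srcy; rewrite src_eq => /orP[/eqP yy|//].
  have := congr1 (fun q : U => (q : 'rV[K]_3) 0 j1) nT.
  rewrite mxractE (@uni_T _ _ _ Hrho _ _ _ 0) ?j1E //= -yy eqxx mul1r mxE.
  by move/eqP; rewrite (negbTE n0).
have tP : pval (t u0) * P y0 3 = 0.
  have := pval_linear (P y0 3) (t u0) 0; rewrite !addr0 => <-.
  by rewrite -[_ *: _]/(ract _ _) -ract_hom u0P3 [t 0]linear0.
rewrite tE -mulrA in tP.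
have [|q qE] := model_ker_syz HM Iy (big Iy) _ tP; first by rewrite mulrA sE.
(* Length 4 is needed to see a path of length 3, and it requires [N y0] to be at least 5. There
   [T y * q], with [y = bar y0], kills the top, while [s] followed by the path puts the top
   coefficient of [s] into coordinate 3. *)
have [|sig Hsig] := HU (y := y0) (n := 3); first by lia.
rewrite (lead s Hsig) //.
have := congr1 (fun q => (bvec 0 *m sig q) 0 (inord 3 : 'I_4)) qE.
have -> : T y = T (bar y0) by rewrite yy0 barK.
rewrite [RHS]/= [in RHS]rmorphM mulmxA Hsig.2 bar_neq scale0r mul0mx.
rewrite gpathS (gpath2 HR) !rmorphM !mulmxA.
rewrite (@uni_T _ _ _ Hsig _ _ _ (inord 2)) ?inordK //= eqxx mul1r.
rewrite (@uni_T _ _ _ Hsig _ _ _ (inord 1)) ?inordK //= eqxx mul1r.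
rewrite (@uni_T _ _ _ Hsig _ _ _ 0) ?inordK //= eqxx mul1r => ->.
by rewrite mxE mulr0.
Qed.

(** Otherwise the identity of [U] would factor through a power of [X], and its top coefficient is
    1. *)
Lemma small_not_in_add X : small X -> ~ in_add X U.
Proof.
move=> smallX [n [N' [phi [psi phiK psiK]]]].
have lin : linear psi.
  by move=> a x x'; apply: (can_inj phiK); rewrite linearP !psiK.
have thL : linear (fun u : U => phi (u, 0)).
  by move=> a u u'; rewrite -linearP; congr (phi (_, _)); rewrite /= scaler0 addr0.
have piL : linear (fun x => (psi x).1) by move=> a x x'; rewrite lin.
have := small_sum_of (sum_of_ffun n X) (fun=> smallX) (lin_of thL) (lin_of piL).
rewrite !lin_ofE phiK /= mxE => /eqP; rewrite eqxx.
by rewrite oner_eq0.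
Qed.

Variables S Om : vert W -> rmodType L.
Hypothesis simpS : forall v, simple_rep E T v (S v).
Hypothesis syzOm : forall v, v \notin wsa_Gamma W -> is_syzygy2 (S v) (Om v).
Local Notation M := (regmod L *
  dsum (fun i : {i : vert W | i \in wsa_Gamma W} => S (val i)) *
  dsum (fun v : {v : vert W | v \notin wsa_Gamma W} => Om (val v)))%type.

Let Gamma_case v : v \in wsa_Gamma W -> exists2 y, typI y & src y = v.
Proof.
have [y Iy [[_ ->]|[/negbTE-> //]]] := vert_cases bip v.
by exists y.
Qed.

Let nGamma_case v : v \notin wsa_Gamma W -> exists2 y, typI y & tgt y = v.
Proof.
have [y Iy [[-> //]|[_ ->]]] := vert_cases bip v.
by exists y.
Qed.

Lemma small_tilting_candidate : small M.
Proof.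
apply: (small_sum_of (sum_of_prod _ _)) => -[].
  apply: (small_sum_of (sum_of_prod _ _)) => -[].
    by apply: small_projective; exact: regmod_projective.
  apply: (small_sum_of (sum_of_dsum _)) => -[v vG] /=.
  exact: small_simple (simpS v).
apply: (small_sum_of (sum_of_dsum _)) => -[v vG] /=.
have [y Iy yv] := nGamma_case vG; rewrite -yv in vG *.
exact: small_syzygy2 Iy (simpS _) (syzOm vG).
Qed.

Lemma ext_tilting_candidate : ext_zero 1 M U /\ ext_zero 2 M U.
Proof.
have [P1 P2] := projective_ext U (@regmod_projective K L).
have srcS v : v \in wsa_Gamma W -> ext_zero 1 (S v) U /\ ext_zero 2 (S v) U.
  by case/Gamma_case => y Iy <-; exact: uni_ext_src Iy (simpS _).
have tgtS v : v \notin wsa_Gamma W -> ext_zero 1 (Om v) U /\ ext_zero 2 (Om v) U.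
  move=> vG; have [y Iy yv] := nGamma_case vG; rewrite -yv in vG *.
  exact: uni_ext_tgt Iy (simpS _) (syzOm vG).
split; apply: ext_zero_prod; (try apply: ext_zero_prod) => //;
  apply: (ext_zero_sum_of (sum_of_dsum _)) => -[v vG] /=;
  first [by have [] := srcS v vG | by have [] := tgtS v vG].
Qed.

Lemma big_orbits_not_cluster_tilting : ~ cluster_tilting3 M.
Proof.
move=> /(_ _ (mxmod_fin_dim rho))[[_ add_ext] _].
exact: small_not_in_add small_tilting_candidate (add_ext ext_tilting_candidate).
Qed.

End UniserialModule.

(** * Triangle and spherical algebras *)

Section AllOrbitsFour.
Variables (K : fieldType) (W : weighted_tq K).
Hypothesis bip : gabriel_bipartite W.
Implicit Types (a b y z : arr W).
Local Notation f := (tq_f W).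
Local Notation g := (@tq_g W).
Local Notation bar := (@tq_bar W).
Local Notation virt := (@virtual K W).
Local Notation c := (@wc K W).
Local Notation N := (@arrN K W).

Lemma fg_typI y : typI y -> typI (f (g y)).
Proof. exact: typII_g. Qed.

Lemma fgK_typI y : typI y -> f (g (f (g y))) = y.
Proof. by move=> Iy; rewrite gfg_typI // f3. Qed.

Lemma g4_of y : N y = 4%N -> g (g (g (g y))) = y.
Proof. by move=> N4; have := iter_N y; rewrite N4. Qed.

(** Since [f (g y) = bar (g (g y))], two steps of [g] commute with [bar] here. This closes up the
    configuration of arrows around [y] and [bar y]. *)
Lemma gg_bar_of y : typI y -> N (bar y) = 4%N -> g (g (bar y)) = f (g y).
Proof.
move=> Iy N4; have Ix : typI (g (g (bar y))) by rewrite typI_gg ?typI_bar.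
by rewrite -[LHS]fgK_typI // [f (g (g (g _)))]f_g g4_of // barK.
Qed.

Hypothesis N4 : forall y, typI y -> N y = 4%N.

Lemma g4_typI y : typI y -> g (g (g (g y))) = y.
Proof. by move=> /N4/g4_of. Qed.

Lemma gg_bar y : typI y -> g (g (bar y)) = f (g y).
Proof. by move=> Iy; apply: gg_bar_of; rewrite // N4 ?typI_bar. Qed.

(* The relations of the weighted surface algebra after each virtual arrow
   [f y] has been replaced by [T (g y) * T (f (g y))] up to a scalar. *)
Record gabriel_rels (L : algType K) (T : arr W -> L) : Prop := GabrielRels {
  gab_I : forall y, typI y -> T y * T (g y) * T (f (g y)) =
    (c (f y) * c (bar y)) *: (T (bar y) * T (g (bar y)) * T (f (g y)));
  gab_II : forall y, typI y -> T (g y) * T (f (g y)) * T (g (f (g y))) =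
    (c (f y) * c y) *: (T (g y) * T (g (g y)) * T (g (g (g y))));
  gab_zero5 : forall y, typI y ->
    T y * T (g y) * T (f (g y)) * T (g (f (g y))) * T y = 0;
  gab_zero4 : forall y, typI y ->
    T (g y) * T (f (g y)) * T (g (f (g y))) * T (bar y) = 0;
  gab_zero4' : forall y, typI y ->
    T (g y) * T (g (g y)) * T (g (g (g y))) * T (bar y) = 0;
  gab_zero5' : forall y, typI y ->
    T (g y) * T (f (g y)) * T (g (f (g y))) * T y * T (g y) = 0
}.

Section Representations.
Variables (L : algType K) (E : vert W -> L) (T : arr W -> L).

Definition add_virtual a : L :=
  if virt a then (c a)^-1 *: (T (bar a) * T (f (bar a))) else T a.
Local Notation T' := add_virtual.

Lemma add_virtual_f y : typI y -> T' (f y) = (c (f y))^-1 *: (T (g y) * T (f (g y))).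
Proof. by rewrite /add_virtual /typI => ->. Qed.

Lemma add_virtual_I y : typI y -> T' y = T y.
Proof. by rewrite /add_virtual => /(typIN bip)[-> _]. Qed.

Lemma add_virtual_II y : typI y -> T' (g y) = T (g y).
Proof. by rewrite /add_virtual => /typII_g/(typIIN bip)[-> _]. Qed.

Lemma add_virtual_quiver_rep :
  (forall u v, E u * E v = if u == v then E u else 0) -> \sum_v E v = 1 ->
  (forall a, ~~ virt a -> E (src a) * T a = T a) ->
  (forall a, ~~ virt a -> T a * E (tgt a) = T a) -> quiver_rep E T'.
Proof.
move=> E1 E2 Ts Tt; split=> // a; have [y Iy [->|->|->]] := typI_cases bip a.
- by rewrite add_virtual_I // Ts ?(typIN bip Iy).
- by rewrite add_virtual_II // Ts ?(typIIN bip (typII_g Iy)).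
- rewrite add_virtual_f // -scalerAr mulrA src_f -src_g Ts //.
  by rewrite (typIIN bip (typII_g Iy)).
- by rewrite add_virtual_I // Tt ?(typIN bip Iy).
- by rewrite add_virtual_II // Tt ?(typIIN bip (typII_g Iy)).
- rewrite add_virtual_f // -scalerAl -mulrA.
  have -> : tgt (f y) = tgt (f (g y)).
    by rewrite -!src_f -gf_typI // src_g src_f.
  by rewrite Tt // (typIN bip (fg_typI Iy)).
Qed.

(** Relation (1) at [g y] holds by the choice of the virtual arrow. Relation (1) at [y] and [f y] is
    [gab_I] and [gab_II], relation (2) at [y] and [f y] is [gab_zero5] and [gab_zero4], and relation
    (3) at [g y] and [f y] is [gab_zero4'] and [gab_zero5']. *)
Lemma gabriel_wsa_rep : quiver_rep E T' -> gabriel_rels T -> wsa_rep E T'.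
Proof.
move=> HR [G1 G2 G3 G4 G5 G6].
have c0 a : c a != 0 by exact: wc_neq0.
have TI := add_virtual_I; have TII := add_virtual_II; have TV := add_virtual_f.
split=> // a; have [y Iy Ea] := typI_cases bip a;
  have Iy' : typI (bar y) by rewrite typI_bar.
- case: Ea => ->.
  + rewrite N4 // gpathS (gpath2 HR) gg_bar // (TII _ Iy') (TI _ Iy') (TV _ Iy).
    rewrite (TI _ Iy) (TI _ (fg_typI Iy)) -scalerAr !mulrA G1 // scalerA.
    by rewrite (mulKf (c0 _)).
  + rewrite barg (N_virt Iy) (gpath1 HR) (TV _ Iy) scalerA mulfV ?scale1r //.
    by rewrite (TII _ Iy) (TI _ (fg_typI Iy)).
  + rewrite -gE N_g c_g N4 // gpathS (gpath2 HR) (TV _ Iy) -gfg_typI //.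
    rewrite (TII _ Iy) (TII _ (fg_typI Iy)) (TII _ (typI_gg bip Iy)) (TI _ (typI_gg bip Iy)).
    by rewrite -scalerAl G2 // scalerA (mulKf (c0 _)) mulrA.
- case: Ea => -> ta.
  + rewrite gf_typI // (TV _ (fg_typI Iy)) fgK_typI // (TI _ Iy) (TV _ Iy).
    by rewrite -!scalerAr -scalerAl !mulrA G3 // !scaler0.
  + by rewrite typII_g in ta.
  + rewrite gff (TI _ Iy') (TV _ Iy) -gfg_typI // (TII _ (fg_typI Iy)).
    by rewrite -!scalerAl G4 // scaler0.
- case: Ea => -> ta.
  + by rewrite Iy in ta.
  + rewrite (TII _ Iy) (TI _ (typI_gg bip Iy)) (TV _ (typI_gg bip Iy)).
    have -> : f (g (g (g y))) = bar y by rewrite f_g g4_typI.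
    by rewrite -scalerAr !mulrA G5 // scaler0.
  + rewrite fgf_typI // gf_typI // (TV _ (fg_typI Iy)) fgK_typI // (TII _ Iy).
    by rewrite (TV _ Iy) -!scalerAr -!scalerAl !mulrA G6 // !scaler0.
Qed.

End Representations.

Lemma wsa_gabriel_rels (L : algType K) (E : vert W -> L) (T : arr W -> L) :
  wsa_rep E T -> gabriel_rels T.
Proof.
move=> H; have HR := wsa_quiver_rep H.
have TV y : typI y -> T (g y) * T (f (g y)) = c (f y) *: T (f y).
  by move=> Iy; rewrite f_g (rel_II H).
have TV' y : typI y -> T (g (f (g y))) * T y = c (g (f y)) *: T (g (f y)).
  by move=> Iy; rewrite gfg_typI // (rel_ffV H) // c_g.
split=> y Iy; have Iy' : typI (bar y) by rewrite typI_bar.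
- rewrite -[LHS]mulrA TV // -scalerAr (wsa_rep1 H) N4 // gpathS (gpath2 HR).
  by rewrite scalerA gg_bar // mulrA.
- rewrite TV // -scalerAl gfg_typI // (rel_V H) N4 // gpathS (gpath2 HR).
  by rewrite scalerA mulrA.
- rewrite -[T y * _ * _]mulrA TV // -!mulrA TV' // -scalerAl -!scalerAr !mulrA.
  by rewrite (zero_I bip H) // !scaler0.
- by rewrite TV // -!scalerAl gfg_typI // (zero_V bip H) // scaler0.
- have Ix := typI_gg bip Iy; rewrite -mulrA.
  have := TV _ Ix; rewrite [f (g (g (g y)))]f_g g4_typI // => ->.
  by rewrite -scalerAr (zero_II bip H) // scaler0.
- rewrite TV // -[_ * T y]mulrA TV' // -!scalerAl -!scalerAr -scalerAl.
  by rewrite (zero_V' bip H) // !scaler0.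
Qed.

(** * Presentations by the Gabriel quiver *)

Section GabrielIso.
Variables (Q : quiver) (R : relations (pathalg Q K)).
Variables (eV : vert Q -> vert W) (eA : arr Q -> arr W) (s : arr Q -> K).
Hypotheses (eV_bij : bijective eV) (eA_inj : injective eA).
Hypothesis eA_surj : forall a, ~~ virt a -> exists i, eA i = a.
Hypothesis eA_nvirt : forall i, ~~ virt (eA i).
Hypothesis s0 : forall i, s i != 0.
Hypothesis src_eA : forall i, src (eA i) = eV (src i).
Hypothesis tgt_eA : forall i, tgt (eA i) = eV (tgt i).
Hypothesis relsP : forall (L : algType K) (T : arr W -> L)
    (phi : {lrmorphism pathalg Q K -> L}),
  (forall i, T (eA i) = s i *: phi (pa_arr K i)) ->
  gabriel_rels T <-> forall r, R r -> phi r = 0.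

(** [relsP] is required for all algebras because it is applied twice: to the quotient by [R], which
    yields [phi], and to [wsa W], which yields the inverse [psi]. Both composites fix the
    generators; a virtual arrow is recovered from [rel_II]. *)
Lemma gabriel_iso : alg_iso (wsa W) (alg_quot R).
Proof.
have [dV eVK dVK] := eV_bij; have HQ := quot_rep R; have HW := quot_wsa_rep bip.
(* The sum has at most one term, as [eA] is injective. It is 0 on virtual arrows, where
   [add_virtual] replaces it. *)
pose T0 a : alg_quot R := \sum_(i | eA i == a) s i *: qT R i.
have T0E i : T0 (eA i) = s i *: qT R i.
  rewrite /T0 (bigD1 i) //= big1 ?addr0 // => j /andP[/eqP/eA_inj->].
  by rewrite eqxx.
pose E0 v := qE R (dV v).
have G0 : gabriel_rels T0.
  by apply/(relsP (phi := quot_pi R)) => // r /quot_rel.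
have HR0 : quiver_rep E0 (add_virtual T0).
  apply: add_virtual_quiver_rep => [u v||a /eA_surj[i <-]|a /eA_surj[i <-]].
  - by rewrite (rep_orth HQ) (can_eq dVK).
  - by rewrite -(rep_sum HQ) (reindex eV) /E0; [apply: eq_bigr => v _; rewrite eVK|
      exact: onW_bij].
  - by rewrite /E0 src_eA eVK T0E -scalerAr (rep_src HQ).
  - by rewrite /E0 tgt_eA eVK T0E -scalerAl (rep_tgt HQ).
have [phi [phiE phiT]] := wsa_rep_hom (gabriel_wsa_rep HR0 G0).
pose TW i := (s i)^-1 *: qT (wsa_relations W) (eA i).
have HRW : quiver_rep (qE (wsa_relations W) \o eV) TW.
  have HWq := wsa_quiver_rep HW; split=> [u v||i|i] /=.
  - by rewrite (rep_orth HWq) (can_eq eVK).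
  - rewrite -(rep_sum HWq) (reindex eV) //; exact: onW_bij.
  - by rewrite -scalerAr -src_eA (rep_src HWq).
  - by rewrite -scalerAl -tgt_eA (rep_tgt HWq).
have [|psi [psiE psiT]] := quot_rep_hom HRW (R := R).
  move=> h hE hT; apply/(relsP (T := qT (wsa_relations W))).
    by move=> i; rewrite hT scalerA mulfV ?scale1r.
  exact: wsa_gabriel_rels HW.
exists phi, psi.
  move=> x; apply: (quot_hom_ext (phi := psi \o phi) (psi := idfun)) => [v|a] /=.
    by rewrite phiE psiE /= dVK.
  have psiT0 b : ~~ virt b -> psi (T0 b) = qT (wsa_relations W) b.
    case/eA_surj=> i <-; rewrite T0E linearZ /= psiT scalerA mulfV ?scale1r //.
  rewrite phiT /add_virtual; case: ifPn => [va|/psiT0//].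
  have [y Iy Ea] := typI_cases bip a.
  have {Ea}-> : a = f y.
    case: Ea va => [->|->|//]; first by rewrite (typIN bip Iy).
    by rewrite (typIIN bip (typII_g Iy)).
  rewrite linearZ /= rmorphM /= -[bar (f y)]/(g y) !psiT0.
  - by rewrite f_g (rel_II HW) // scalerA mulVf ?scale1r ?wc_neq0.
  - by rewrite (typIN bip (fg_typI Iy)).
  - by rewrite (typIIN bip (typII_g Iy)).
move=> x; apply: (quot_hom_ext (phi := phi \o psi) (psi := idfun)) => [v|i] /=.
  by rewrite psiE phiE /E0 /= eVK.
rewrite psiT linearZ /= phiT /add_virtual (negbTE (eA_nvirt i)) T0E scalerA.
by rewrite mulVf ?scale1r.
Qed.

End GabrielIso.
End AllOrbitsFour.

Section NthEnumeration.
Variables (T : eqType) (x0 : T) (s : seq T) (n : nat).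
Hypotheses (sz : size s = n) (us : uniq s).

Lemma nth_ord_inj : injective (fun i : 'I_n => nth x0 s i).
Proof.
by move=> i j /eqP; rewrite nth_uniq ?sz // => /eqP/val_inj.
Qed.

Lemma nth_ord_surj x : x \in s -> exists i : 'I_n, nth x0 s i = x.
Proof.
move=> xs; have lt : (index x s < n)%N by rewrite -sz index_mem.
by exists (Ordinal lt); rewrite nth_index.
Qed.

Lemma nth_ord_bij : (forall x, x \in s) -> bijective (fun i : 'I_n => nth x0 s i).
Proof.
move=> all_s; have [h hK] := choice (fun x => nth_ord_surj (all_s x)).
by exists h => // i; apply: nth_ord_inj; rewrite hK.
Qed.

End NthEnumeration.

(* The sixteen zero relations come in the order of [spherical_rels]. *)
Definition octahedral_rels (K : fieldType) (L : algType K) (d d' c1 c2 : K)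
    (al be nu de rho om ga si : L) : Prop :=
  [/\ al * be * nu = (d * c2) *: (rho * om * nu),
      be * nu * de = (d * c1) *: (be * ga * si),
      nu * de * al = (d * c1) *: (ga * si * al) &
      de * al * be = (d * c2) *: (de * rho * om)] /\
  [/\ ga * si * rho = (d' * c2) *: (nu * de * rho),
      si * rho * om = (d' * c1) *: (si * al * be),
      rho * om * ga = (d' * c1) *: (al * be * ga) &
      om * ga * si = (d' * c2) *: (om * nu * de)] /\
  [/\ al * be * nu * de * al = 0, be * nu * de * rho = 0,
      nu * de * al * be * nu = 0 & de * al * be * ga = 0] /\
  [/\ ga * si * rho * om * ga = 0, si * rho * om * nu = 0,
      rho * om * ga * si * rho = 0 & om * ga * si * al = 0] /\
  [/\ be * ga * si * rho = 0, si * al * be * nu = 0,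
      de * rho * om * ga = 0 & om * nu * de * al = 0] /\
  [/\ be * nu * de * al * be = 0, de * al * be * nu * de = 0,
      si * rho * om * ga * si = 0 & om * ga * si * rho * om = 0].

Section RelationLists.
Variables (K : fieldType) (L : algType K).
Implicit Types (k l : K) (x y : L).

Lemma forall_in_foldr (T : eqType) (P : T -> Prop) (s : seq T) :
  (forall r, r \in s -> P r) <-> foldr (fun r A => P r /\ A) True s.
Proof.
elim: s => [|a s [IH1 IH2]] /=; first by split.
split=> [H|[Pa /IH2 H] r]; last by rewrite inE => /predU1P[->|/H].
by split; [apply: H; rewrite inE eqxx|apply: IH1 => r rs; apply: H; rewrite inE rs orbT].
Qed.

Lemma mulZl k x y : (k *: x) * y = k *: (x * y). Proof. by rewrite scalerAl. Qed.
Lemma mulZr k x y : x * (k *: y) = k *: (x * y). Proof. by rewrite scalerAr. Qed.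

Lemma scale_eq_iff k1 k2 l x y : k1 != 0 -> k2 = k1 * l ->
  k1 *: x = k2 *: y <-> x - l *: y = 0.
Proof.
move=> k0 ->; rewrite -scalerA; split=> [/(scalerI k0)->|/subr0_eq-> //].
exact: subrr.
Qed.

Lemma scale_eq_iff1 k1 k2 x y : k1 != 0 -> k2 = k1 ->
  k1 *: x = k2 *: y <-> x - y = 0.
Proof. by move=> k0 k12; rewrite (@scale_eq_iff k1 k2 1) ?scale1r ?mulr1. Qed.

Lemma eq_scale_iff k1 k2 x y : k2 = k1 -> x = k2 *: y <-> x - k1 *: y = 0.
Proof. by move=> ->; split=> [->|/subr0_eq->]; rewrite ?subrr. Qed.

Lemma scale0_iff k x : k != 0 -> k *: x = 0 <-> x = 0.
Proof.
move=> k0; split=> [/eqP|->]; last exact: scaler0.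
by rewrite scaler_eq0 (negbTE k0) => /eqP.
Qed.

End RelationLists.

Lemma and4_assoc (P1 P2 P3 P4 Q : Prop) :
  [/\ P1, P2, P3 & P4] /\ Q <-> P1 /\ P2 /\ P3 /\ P4 /\ Q.
Proof. by split=> [[[? ? ? ?] ?]|[? [? [? [? ?]]]]]. Qed.

Lemma and4_true (P1 P2 P3 P4 : Prop) :
  [/\ P1, P2, P3 & P4] <-> P1 /\ P2 /\ P3 /\ P4 /\ True.
Proof. by split=> [[]|[? [? [? []]]]]. Qed.

Lemma and_congr (P P' Q Q' : Prop) :
  (P <-> P') -> (Q <-> Q') -> P /\ Q <-> P' /\ Q'.
Proof. by move=> [PP' P'P] [QQ' Q'Q]; split=> -[? ?]; split; auto. Qed.


Section SphericalCase.
Variables (K : fieldType) (L : algType K) (d d' c1 c2 : K).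
Hypotheses (d0 : d != 0) (d'0 : d' != 0) (c20 : c2 != 0).
Variable phi : {lrmorphism pathalg spherical_quiver K -> L}.
Let x i (Hi : (i < 8)%N) := phi (@pa_arr spherical_quiver K (@Ordinal 8 i Hi)).

(** The binomial relations have the coefficients [d c2], [d c1], [d' c2] and [d' c1]. Absorbing
    [d c2] into alpha and [d' c2] into gamma turns each of them into 1 or [c1 c2 d d']. *)
Lemma spherical_octahedral :
  octahedral_rels d d' c1 c2 ((d * c2) *: x (i := 0) isT) (x (i := 1) isT)
    (x (i := 2) isT) (x (i := 3) isT) (x (i := 4) isT) (x (i := 5) isT)
    ((d' * c2) *: x (i := 6) isT) (x (i := 7) isT) <->
  forall r, r \in spherical_rels (c1 * c2 * d * d') -> phi r = 0.
Proof.
have phiZ k q : phi (k *: q) = k *: phi q by exact: linearZ.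
have phiB p q : phi (p - q) = phi p - phi q by exact: rmorphB.
have phiM p q : phi (p * q) = phi p * phi q by exact: rmorphM.
rewrite forall_in_foldr /spherical_rels [foldr _ _ _]/=.
rewrite !(phiB, phiZ, phiM).
rewrite -/(x (i := 0) isT) -/(x (i := 1) isT) -/(x (i := 2) isT) -/(x (i := 3) isT).
rewrite -/(x (i := 4) isT) -/(x (i := 5) isT) -/(x (i := 6) isT) -/(x (i := 7) isT).
move: (x (i := 0) isT) (x (i := 1) isT)
  (x (i := 2) isT) (x (i := 3) isT)
  (x (i := 4) isT) (x (i := 5) isT)
  (x (i := 6) isT) (x (i := 7) isT).
move=> al be nu de rho om ga si.
rewrite /octahedral_rels !(mulZl, mulZr, scalerA) !and4_assoc.
repeat match goal with
  | |- _ /\ _ <-> _ => apply: and_congr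
  | |- [/\ _, _, _ & _] <-> _ => apply: (iff_trans (and4_true _ _ _ _))
  end.
all: try by [].
all: rewrite ?(mulf_neq0, d0, d'0, c20) //.
all: first [apply: scale0_iff; rewrite ?mulf_neq0 //|
  apply: scale_eq_iff1; [by rewrite mulf_neq0|ring]|
  apply: scale_eq_iff; [by rewrite mulf_neq0|ring]|
  apply: eq_scale_iff; ring].
Qed.
End SphericalCase.

Section TriangleCase.
Variables (K : fieldType) (L : algType K).
Variable phi : {lrmorphism pathalg triangle_quiver K -> L}.
Let x i (Hi : (i < 4)%N) := phi (@pa_arr triangle_quiver K (@Ordinal 4 i Hi)).
Local Notation A := (x (i := 0) isT).
Local Notation B := (x (i := 1) isT).
Local Notation C := (x (i := 2) isT).
Local Notation D := (x (i := 3) isT).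

Lemma triangle_relsE (l : K) :
  (forall r, r \in triangle_rels l -> phi r = 0) <->
  [/\ A * B * A = A * C * D, D * B * A = l *: (D * C * D),
      B * A * B = C * D * B & B * A * C = l *: (C * D * C)] /\
  [/\ A * B * A * C = 0, B * A * B * A * B = 0, D * C * D * B = 0 &
      C * D * C * D * C = 0] /\
  [/\ A * B * A * B * A = 0, D * C * D * C * D = 0 & D * B * A * B = 0].
Proof.
have phiZ k q : phi (k *: q) = k *: phi q by exact: linearZ.
have phiB p q : phi (p - q) = phi p - phi q by exact: rmorphB.
have phiM p q : phi (p * q) = phi p * phi q by exact: rmorphM.
have subE (u v : L) : u - v = 0 <-> u = v by split=> [/subr0_eq|->]; rewrite ?subrr.
rewrite forall_in_foldr /triangle_rels [foldr _ _ _]/= !(phiB, phiZ, phiM).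
rewrite -/A -/B -/C -/D !subE.
by split=> [[? [? [? [? [? [? [? [? [? [? [? _]]]]]]]]]]]
  |[[? ? ? ?] [[? ? ? ?] [? ? ?]]]].
Qed.

Section Cycle.
Variables d c1 c2 : K.
Hypotheses (d0 : d != 0) (c10 : c1 != 0) (c20 : c2 != 0).
Let s := (d * c1)^-1.

(** The configuration in which gamma coincides with alpha and nu with rho, so that [g] has two
    cycles of length 2. Some zero relations of the triangle algebra are consequences of the others,
    and deriving them uses that the parameter is nonzero. *)
Lemma triangle_cycle : octahedral_rels d d c1 c2 (s *: B) A C D C D (s *: B) A <->
  forall r, r \in triangle_rels (c1 * c2 * d * d) -> phi r = 0.
Proof.
have dc0 : d * c1 != 0 by rewrite mulf_neq0.
have s0 : s != 0 by rewrite invr_neq0.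
have l0 : c1 * c2 * d * d != 0 by rewrite !mulf_neq0.
rewrite triangle_relsE /octahedral_rels !(mulZl, mulZr, scalerA).
split=> [[[h1 h2 h3 h4] [_ [[h9 h10 h11 h12] [_ [[h17 _ h19 _] [h21 h22 _ _]]]]]]
  |[[t1 t2 t3 t4] [[t5 t6 t7 t8] [t9 t10 t11]]]].
  have z k (X : L) : k != 0 -> k *: X = 0 -> X = 0 by move=> k0 /(scale0_iff X k0).
  have ss0 : s * s != 0 by rewrite mulf_neq0.
  have e1 : B * A * C = (c1 * c2 * d * d) *: (C * D * C).
    by apply: (scalerI s0); rewrite h1 scalerA; congr (_ *: _);
      rewrite /s; field; rewrite ?d0 ?c10.
  have e2 : A * C * D = A * B * A by rewrite h2 mulfV ?scale1r.
  have e3 : C * D * B = B * A * B.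
    by apply: (scalerI s0); rewrite h3 mulfV ?mul1r.
  have e4 : D * B * A = (c1 * c2 * d * d) *: (D * C * D).
    by apply: (scalerI s0); rewrite h4 scalerA; congr (_ *: _);
      rewrite /s; field; rewrite ?d0 ?c10.
  have DBAB := z _ _ ss0 h12.
  do !split=> //; try exact: z h17; try exact: z h19.
  - have -> : B * A * B * A * B = C * (D * B * A * B) by rewrite -e3 !mulrA.
    by rewrite DBAB mulr0.
  - apply: (z _ _ l0); transitivity (B * (A * C * D * C)).
      by rewrite !(mulrA B) e1 !mulZl.
    by rewrite h10 mulr0.
  - by rewrite -e2; exact: z h21.
  - apply: (z _ _ l0); transitivity (D * B * A * C * D); last exact: z h22.
    by rewrite e4 !mulZl.
have BACDB : B * A * C * D * B = 0.
  transitivity ((c1 * c2 * d * d) *: (C * (D * C * D * B))).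
    by rewrite t4 !mulZl !mulrA.
  by rewrite t7 mulr0 scaler0.
have ACDC : A * C * D * C = 0 by rewrite -t1.
have CDBAC : C * D * B * A * C = 0.
  transitivity (B * (A * B * A * C)); last by rewrite t5 mulr0.
  by rewrite -t3 !mulrA.
have ACDBA : A * C * D * B * A = 0 by rewrite -t1.
have DBACD : D * B * A * C * D = 0.
  by rewrite t2 !mulZl t10 scaler0.
rewrite BACDB ACDC CDBAC ACDBA DBACD t5 t7 t11 t4 t2 -t1 -t3 !scalerA !scaler0.
have -> : s * (c1 * c2 * d * d) = d * c2 by rewrite /s; field; rewrite ?d0 ?c10.
have -> : d * c1 * s = 1 by rewrite mulfV.
rewrite !mul1r !scale1r.
by do !split.
Qed.

End Cycle.

Section Line.
Variables d d' c : K.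
Hypotheses (d0 : d != 0) (d'0 : d' != 0) (c0 : c != 0).
Let s := d * c.

(** The configuration in which gamma coincides with rho and nu with alpha, so that [g] has one cycle
    of length 4 and a single parameter [c]. The triangle relations read the binomials in the
    opposite direction, which inverts the parameter. *)
Lemma triangle_line : octahedral_rels d d' c c (s *: B) A (s *: B) A C D C D <->
  forall r, r \in triangle_rels (d * d' * c * c)^-1 -> phi r = 0.
Proof.
have s0 : s != 0 by rewrite mulf_neq0.
have ss0 : s * s != 0 by rewrite mulf_neq0.
have sss0 : s * (s * s) != 0 by rewrite mulf_neq0.
have k0 : d' * c * s != 0 by rewrite !mulf_neq0.
have lE : (d * d' * c * c)^-1 = (d' * c * s)^-1 by congr (_^-1); rewrite /s; ring.
rewrite lE triangle_relsE /octahedral_rels !(mulZl, mulZr, scalerA).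
have z k (X : L) : k != 0 -> k *: X = 0 -> X = 0 by move=> kn /(scale0_iff X kn).
split=> [[[h1 h2 _ _] [[h5 h6 _ _]
    [[h9 h10 _ _] [[h13 h14 _ _] [[_ h18 _ _] [h21 _ h23 _]]]]]]
  |[[t1 t2 t3 t4] [[t5 t6 t7 t8] [t9 t10 t11]]]].
  do !split=> //; try exact: z h9; try exact: z h10; try exact: z h14;
    try exact: z h18; try exact: z h21.
  - exact: (scalerI s0).
  - by rewrite h6 scalerA mulVf ?scale1r.
  - exact: (scalerI ss0).
  - by rewrite h5 scalerA mulVf ?scale1r.
have ACDC : A * C * D * C = 0 by rewrite -t1.
rewrite t5 t6 t7 t8 t9 t10 t11 ACDC t4 t2 -t1 -t3 !scalerA mulfV // !scale1r !scaler0.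
by do !split.
Qed.

End Line.
End TriangleCase.

(** * The configurations with m n = 4 on both orbits *)

Section SmallOrbits.
Variables (K : fieldType) (W : weighted_tq K).
Hypothesis bip : gabriel_bipartite W.
Implicit Types (a b y z : arr W) (v : vert W).
Local Notation f := (tq_f W).
Local Notation g := (@tq_g W).
Local Notation bar := (@tq_bar W).
Local Notation virt := (@virtual K W).
Local Notation c := (@wc K W).
Local Notation N := (@arrN K W).

Lemma nonvirtual_cases a : ~~ virtual a -> exists2 y, typI y & a = y \/ a = g y.
Proof.
move=> va; have [y Iy [->|->|ay]] := typI_cases bip a.
- by exists y => //; left.
- by exists y => //; right.
- by move: va; rewrite ay; move: Iy; rewrite /typI => ->.
Qed.

Lemma vert_src_tgt v : exists2 y, typI y & v = src y \/ v = tgt y.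
Proof.
by have [y Iy [[_ ->]|[_ ->]]] := vert_cases bip v; exists y => //; [left|right].
Qed.

Lemma typI_neq_g y z : typI y -> typI z -> (y == g z) = false.
Proof.
move=> Iy Iz; apply/eqP => yz; have := (typIN bip Iy).2.
by rewrite yz typII_g.
Qed.

Lemma g_eq y z : (g y == g z) = (y == z).
Proof. by rewrite (inj_eq (@g_inj W)). Qed.

Lemma uniq_typI_g y1 y2 y3 y4 : typI y1 -> typI y2 -> typI y3 -> typI y4 ->
  uniq [:: y1; y2; y3; y4] -> uniq [:: y1; g y1; y2; g y2; y3; g y3; y4; g y4].
Proof.
move=> I1 I2 I3 I4; rewrite /= !inE !negb_or !g_eq.
rewrite !(typI_neq_g I1, typI_neq_g I2, typI_neq_g I3, typI_neq_g I4) //.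
rewrite ![g _ == _]eq_sym.
rewrite !(typI_neq_g I1, typI_neq_g I2, typI_neq_g I3, typI_neq_g I4) //=.
case/and4P=> /and3P[-> -> ->] /andP[-> ->] -> _.
by [].
Qed.

Lemma tgt_neq_src y z : typI y -> typI z -> (tgt z == src y) = false.
Proof. by move=> Iy Iz; rewrite eq_sym; apply/negbTE/src_typI_g. Qed.

Variable al : arr W.
Hypotheses (Ial : typI al) (Nal : N al = 4%N) (Nrho : N (bar al) = 4%N).
Let be := g al.
Let ga := g be.
Let si := g ga.
Let rho := bar al.
Let om := g rho.
Let nu := g om.
Let de := g nu.

Let Irho : typI rho. Proof. by rewrite typI_bar. Qed.
Let Iga : typI ga. Proof. exact: typI_gg. Qed.
Let Inu : typI nu. Proof. exact: typI_gg. Qed.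
Let gsi : g si = al. Proof. exact: g4_of. Qed.
Let gde : g de = rho. Proof. exact: g4_of. Qed.
Let bga : bar ga = nu.
Proof. by rewrite /nu /om /rho gg_bar_of // f_g. Qed.
Let bnu : bar nu = ga. Proof. by rewrite -bga barK. Qed.
Let brho : bar rho = al. Proof. exact: barK. Qed.
Let fbe : f be = nu. Proof. by rewrite -bga -f_g. Qed.
Let fom : f om = ga. Proof. by rewrite -bnu -f_g. Qed.
Let fsi : f si = rho. Proof. by rewrite f_g -/(g si) gsi. Qed.
Let fde : f de = al. Proof. by rewrite f_g -/(g de) gde brho. Qed.

(** The arrows [z], [g z] and [f z], for [z] among these four, are closed under [bar] and [f]: [bar]
    and [z -> f (g z)] permute the four, because both orbits close after four steps. [arrow_ind]
    then gives all arrows. *)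
Lemma four_typI y : typI y -> y \in [:: al; rho; ga; nu].
Proof.
pose D a := exists2 y, y \in [:: al; rho; ga; nu] & [\/ a = y, a = g y | a = f y].
have inI z : z \in [:: al; rho; ga; nu] -> typI z.
  by rewrite !inE => /or4P[]/eqP->.
have stepP : forall a, D a.
  apply: (arrow_ind (a0 := al)) => [|a [z zin Ea]|a [z zin Ea]].
  - by exists al; [rewrite inE eqxx|apply: Or31].
  - have bz : bar z \in [:: al; rho; ga; nu].
      move: zin; rewrite !inE => /or4P[]/eqP->;
      by rewrite ?brho ?bga ?bnu eqxx ?orbT.
    case: Ea => ->.
    + by exists (bar z) => //; apply: Or31.
    + by exists z => //; rewrite barg; apply: Or33.
    + by exists z => //; rewrite -gE; apply: Or32.
  - have fz : f (g z) \in [:: al; rho; ga; nu].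
      move: zin; rewrite !inE => /or4P[]/eqP->;
      by rewrite ?fbe ?fom ?fsi ?fde eqxx ?orbT.
    case: Ea => ->.
    + by exists z => //; apply: Or33.
    + by exists (f (g z)) => //; apply: Or31.
    + by exists (f (g z)) => //; rewrite gfg_typI ?inI //; apply: Or32.
move=> Iy; have [z zin [->|yz|yz]] := stepP y => //.
  by move: (typIIN bip (typII_g (inI z zin))).2; rewrite -yz Iy.
by move: (typIN bip Iy).1; rewrite yz; have := inI z zin; rewrite /typI => ->.
Qed.

Lemma four_N y : typI y -> N y = 4%N.
Proof.
by move/four_typI; rewrite !inE => /or4P[]/eqP->; rewrite ?N_g.
Qed.

Let c_fnu : c (f nu) = c (f al).
Proof. by rewrite -fbe -gf_typI // c_g. Qed.
Let c_fga : c (f ga) = c (f rho).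
Proof. by rewrite -fom -gf_typI // c_g. Qed.
Let c_ga : c ga = c al. Proof. by rewrite !c_g. Qed.
Let c_nu : c nu = c rho. Proof. by rewrite !c_g. Qed.

Lemma gabriel_octahedral (L : algType K) (T : arr W -> L) :
  gabriel_rels T <-> octahedral_rels (c (f al)) (c (f rho)) (c al) (c rho)
    (T al) (T be) (T nu) (T de) (T rho) (T om) (T ga) (T si).
Proof.
split=> [[G1 G2 G3 G4 G5 G6]|].
  have := (G1 _ Ial, G1 _ Irho, (G1 _ Iga, G1 _ Inu)).
  have := (G2 _ Ial, G2 _ Irho, (G2 _ Iga, G2 _ Inu)).
  have := (G3 _ Ial, G3 _ Irho, (G3 _ Iga, G3 _ Inu)).
  have := (G4 _ Ial, G4 _ Irho, (G4 _ Iga, G4 _ Inu)).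
  have := (G5 _ Ial, G5 _ Irho, (G5 _ Iga, G5 _ Inu)).
  have := (G6 _ Ial, G6 _ Irho, (G6 _ Iga, G6 _ Inu)).
  rewrite -/be -/om -/si -/de -/ga -/nu -/si -/de.
  rewrite gsi gde fbe fom fsi fde -/be -/om -/si -/de -/ga -/nu -/rho.
  rewrite brho bga bnu c_fnu c_fga c_ga c_nu -/be -/om -/si -/de -/ga -/nu -/rho.
  move=> [[? ?] [? ?]] [[? ?] [? ?]] [[? ?] [? ?]] [[? ?] [? ?]].
  by move=> [[? ?] [? ?]] [[? ?] [? ?]].
move=> [[? ? ? ?] [[? ? ? ?] [[? ? ? ?] [[? ? ? ?] [[? ? ? ?] [? ? ? ?]]]]]].
split=> y /four_typI; rewrite !inE => /or4P[]/eqP->;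
  rewrite -?/be -?/om -?/si -?/de -?/ga -?/nu -?/si -?/de;
  rewrite ?gsi ?gde ?fbe ?fom ?fsi ?fde -?/be -?/om -?/si -?/de -?/ga -?/nu -?/rho;
  by rewrite ?brho ?bga ?bnu ?c_fnu ?c_fga ?c_ga ?c_nu.
Qed.

Section Spherical.
Hypotheses (ga_al : ga != al) (ga_rho : ga != rho).

Let nu_al : (nu == al) = false.
Proof. by rewrite -bga bar_eq; exact: negbTE. Qed.
Let nu_rho : (nu == rho) = false.
Proof. by rewrite -bga (inj_eq (can_inj (@barK W))); exact: negbTE. Qed.
Let ga_nu : (ga == nu) = false. Proof. by rewrite -bga neq_bar. Qed.
Let al_rho : (al == rho) = false. Proof. exact: neq_bar. Qed.

Lemma spherical_iso : alg_iso (wsa W)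
  (spherical_alg (c al * c rho * c (f al) * c (f rho))).
Proof.
pose sA := [:: al; be; nu; de; rho; om; ga; si].
(* The order matches the numbering 1 to 6 of the spherical quiver, as the order of [sA] matches its
   arrows. *)
pose sV' := [:: src al; tgt al; src ga; tgt ga; tgt nu; tgt rho].
have src_nu : src nu = src ga by rewrite -bga src_bar.
have u4 : uniq [:: al; nu; rho; ga].
  rewrite /= !inE !negb_or [al == nu]eq_sym [al == ga]eq_sym [nu == ga]eq_sym.
  by rewrite [rho == ga]eq_sym nu_al nu_rho ga_nu al_rho ga_al ga_rho.
have usA : uniq sA := uniq_typI_g Ial Inu Irho Iga u4.
have usV : uniq sV'.
  have tE y z : typI y -> typI z -> (tgt y == tgt z) = (y == z) by exact: typI_tgt_inj.
  have sE y z : typI y -> typI z -> (src y == tgt z) = false.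
    by move=> Iy Iz; apply/negbTE/src_typI_g.
  have sg : (src al == src ga) = false.
    by rewrite eq_sym src_eq (negbTE ga_al) (negbTE ga_rho).
  move: u4; rewrite /sV' /= !inE !negb_or !tE // !tgt_neq_src // !sE // sg.
  rewrite [al == nu]eq_sym nu_al nu_rho [al == ga]eq_sym (negbTE ga_al) ga_nu.
  by rewrite [al == rho]neq_bar (negbTE ga_rho).
have aV v : v \in sV'.
  have [y /four_typI yin] := vert_src_tgt v.
  move: yin; rewrite !inE -/be -/ga -/rho -/om -/nu => /or4P[]/eqP-> -[]->;
  by rewrite ?(src_bar al) ?src_nu ?eqxx ?orbT.
have aA a : ~~ virtual a -> a \in sA.
  case/nonvirtual_cases => y /four_typI yin; move: yin.
  by rewrite !inE -/be -/ga -/rho -/om -/nu => /or4P[]/eqP-> -[]->; rewrite ?eqxx ?orbT.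
pose s i := nth 1 [:: c (f al) * c rho; 1; 1; 1; 1; 1; c (f rho) * c rho; 1] i.
apply: (gabriel_iso bip four_N (Q := spherical_quiver)
  (eV := fun i : 'I_6 => nth (src al) sV' i) (eA := fun i : 'I_8 => nth al sA i)
  (s := fun i : 'I_8 => s i)).
- exact: nth_ord_bij.
- exact: nth_ord_inj.
- by move=> a /aA; apply: nth_ord_surj.
- case=> -[|[|[|[|[|[|[|[|//]]]]]]]] lt /=;
    by rewrite ?(typIN bip Ial) ?(typIN bip Irho) ?(typIN bip Iga) ?(typIN bip Inu)
      ?(typIIN bip (typII_g Ial)) ?(typIIN bip (typII_g Irho))
      ?(typIIN bip (typII_g Iga)) ?(typIIN bip (typII_g Inu)).
- by case=> -[|[|[|[|[|[|[|[|//]]]]]]]] lt /=; rewrite /s /= ?oner_neq0 ?mulf_neq0 ?wc_neq0.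
- by case=> -[|[|[|[|[|[|[|[|//]]]]]]]] lt /=; rewrite ?src_nu ?src_g ?(src_bar al).
- by case=> -[|[|[|[|[|[|[|[|//]]]]]]]] lt /=;
    rewrite -?src_g ?gsi ?gde ?src_nu ?(src_bar al).
move=> L T phi TE; apply: (iff_trans (gabriel_octahedral T)).
have := spherical_octahedral (c al) (wc_neq0 (f al)) (wc_neq0 (f rho))
  (wc_neq0 rho) phi.
have := TE (@Ordinal 8 0 isT); have := TE (@Ordinal 8 1 isT).
have := TE (@Ordinal 8 2 isT); have := TE (@Ordinal 8 3 isT).
have := TE (@Ordinal 8 4 isT); have := TE (@Ordinal 8 5 isT).
have := TE (@Ordinal 8 6 isT); have := TE (@Ordinal 8 7 isT).
rewrite /s /= !scale1r => <- <- <- <- <- <- <- <-.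
exact.
Qed.



End Spherical.

Section Triangle.
Hypothesis ga_cases : ga = al \/ ga = rho.

Let nu_cases : (ga = al /\ nu = rho) \/ (ga = rho /\ nu = al).
Proof. by case: ga_cases => E; [left|right]; rewrite -bga E // barK. Qed.

(* The nonvirtual arrows form the quiver of the triangle algebra, in both the
   case where [g] has two cycles on them and the case where it has one. *)
Lemma triangle_iso_of (l s : K) : s != 0 ->
  (forall (L : algType K) (T : arr W -> L)
      (phi : {lrmorphism pathalg triangle_quiver K -> L}),
    let x i Hi := phi (@pa_arr triangle_quiver K (@Ordinal 4 i Hi)) in
    T be = x 0 isT -> T al = s *: x 1 isT -> T rho = x 2 isT -> T om = x 3 isT ->
    gabriel_rels T <-> forall r, r \in triangle_rels l -> phi r = 0) ->
  alg_iso (wsa W) (triangle_alg l).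
Proof.
(* The middle vertex 2 of the triangle quiver is [src al], the only vertex of Gamma. Its arrow
   alpha, from 1 to 2, is therefore [be], and [al] is its beta. *)
move=> s0 relsP; pose sA := [:: be; al; rho; om]; pose sV := [:: tgt al; src al; tgt rho].
have inI y : typI y -> y = al \/ y = rho.
  move/four_typI; rewrite !inE -/be -/ga -/rho -/om -/nu.
  case: nu_cases => -[-> ->] /or4P[]/eqP->; by [left|right].
have tbe : src ga = src al by case: ga_cases => ->; rewrite ?src_bar.
have tom : src nu = src al by rewrite -bga src_bar.
have rho_al : (rho == al) = false by exact: bar_neq.
have usA : uniq sA.
  rewrite /= !inE !negb_or [be == al]eq_sym [be == rho]eq_sym g_eq !typI_neq_g //.
  by rewrite [al == rho]eq_sym rho_al.
have usV : uniq sV.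
  rewrite /= !inE !negb_or tgt_neq_src // typI_tgt_inj // [al == rho]eq_sym rho_al.
  by rewrite (src_typI_g bip Ial Irho).
have aV v : v \in sV.
  have [y Iy [->|->]] := vert_src_tgt v; have [->|->] := inI y Iy;
    by rewrite !inE ?(src_bar al) eqxx ?orbT.
have aA a : ~~ virtual a -> a \in sA.
  by case/nonvirtual_cases => y /inI[]-> -[]->; rewrite !inE eqxx ?orbT.
pose k i := nth 1 [:: 1; s; 1; 1] i.
apply: (gabriel_iso bip four_N (Q := triangle_quiver)
  (eV := fun i : 'I_3 => nth (src al) sV i) (eA := fun i : 'I_4 => nth al sA i)
  (s := fun i : 'I_4 => k i)).
- exact: nth_ord_bij.
- exact: nth_ord_inj.
- by move=> a /aA; apply: nth_ord_surj.
- case=> -[|[|[|[|//]]]] lt /=;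
    by rewrite ?(typIN bip Ial) ?(typIN bip Irho)
      ?(typIIN bip (typII_g Ial)) ?(typIIN bip (typII_g Irho)).
- by case=> -[|[|[|[|//]]]] lt /=; rewrite /k /= ?oner_neq0.
- by case=> -[|[|[|[|//]]]] lt /=; rewrite ?src_g ?(src_bar al).
- by case=> -[|[|[|[|//]]]] lt /=; rewrite -?src_g ?tbe ?tom.
move=> L T phi TE; apply: relsP.
- by have := TE (@Ordinal 4 0 isT); rewrite /k /= scale1r.
- by have := TE (@Ordinal 4 1 isT); rewrite /k /=.
- by have := TE (@Ordinal 4 2 isT); rewrite /k /= scale1r.
- by have := TE (@Ordinal 4 3 isT); rewrite /k /= scale1r.
Qed.

Lemma triangle_iso : exists2 l : K, l != 0 & alg_iso (wsa W) (triangle_alg l).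
Proof.
case: nu_cases => -[gaE nuE].
- have dE : c (f rho) = c (f al) by rewrite -c_fnu nuE.
  exists (c al * c rho * c (f al) * c (f al)); first by rewrite !mulf_neq0 ?wc_neq0.
  apply: (@triangle_iso_of _ (c (f al) * c al)^-1).
    by rewrite invr_neq0 // mulf_neq0 ?wc_neq0.
  move=> L T phi x Tbe Tal Trho Tom.
  apply: (iff_trans (gabriel_octahedral T)).
  have := triangle_cycle phi (wc_neq0 (f al)) (wc_neq0 al) (wc_neq0 rho).
  rewrite dE /si /de gaE nuE -/be -/om Tbe Tal Trho Tom.
  exact.
- have cE : c rho = c al by rewrite -gaE !c_g.
  exists (c (f al) * c (f rho) * c al * c al)^-1.
    by rewrite invr_neq0 // !mulf_neq0 ?wc_neq0.
  apply: (@triangle_iso_of _ (c (f al) * c al)); first by rewrite mulf_neq0 ?wc_neq0.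
  move=> L T phi x Tbe Tal Trho Tom.
  apply: (iff_trans (gabriel_octahedral T)).
  have := triangle_line phi (wc_neq0 (f al)) (wc_neq0 (f rho)) (wc_neq0 al).
  rewrite cE /si /de gaE nuE -/be -/om Tbe Tal Trho Tom.
  exact.
Qed.

End Triangle.

Lemma small_orbits_iso : exists2 l : K, l != 0 &
  alg_iso (wsa W) (triangle_alg l) \/ alg_iso (wsa W) (spherical_alg l).
Proof.
have [E|ne1] := eqVneq ga al.
  by have [l l0 iso] := triangle_iso (or_introl E); exists l => //; left.
have [E|ne2] := eqVneq ga rho.
  by have [l l0 iso] := triangle_iso (or_intror E); exists l => //; left.
exists (c al * c rho * c (f al) * c (f rho)); first by rewrite !mulf_neq0 ?wc_neq0.
by right; exact: spherical_iso.
Qed.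

End SmallOrbits.

Theorem mainTheorem3 (K : closedFieldType) (W : weighted_tq K)
    (S Omega2S : vert W -> rmodType (wsa W)) :
  gabriel_bipartite W ->
  non_singular (wsa W) ->
  (forall lambda : K, lambda != 0 -> lambda != 1 ->
     ~ alg_iso (wsa W) (triangle_alg lambda) /\
     ~ alg_iso (wsa W) (spherical_alg lambda)) ->
  (forall i : vert W, is_simple_at i (S i)) ->
  (forall v : vert W, v \notin wsa_Gamma W -> is_syzygy2 (S v) (Omega2S v)) ->
  ~ cluster_tilting3
      (regmod (wsa W)
       * dsum (fun i : {i : vert W | i \in wsa_Gamma W} => S (val i))
       * dsum (fun v : {v : vert W | v \notin wsa_Gamma W} => Omega2S (val v)))%type.
Proof.
move=> bip [nsT nsS] noTS simpS syz.
have [[y Iy [N1 N2]]|noY] := pselect (exists2 y : arr W, typI y &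
    arrN y = 4%N /\ arrN (tq_bar y) = 4%N).
  have [l l0 iso] := small_orbits_iso bip Iy N1 N2.
  have [l1|l1] := eqVneq l 1; first by rewrite l1 in iso; case: iso.
  by have [] := noTS l l0 l1; case: iso.
have big (y : arr W) : typI y -> big_orbit y.
  move=> Iy; have Iy' : typI (tq_bar y) by rewrite typI_bar.
  have [N1|] := eqVneq (arrN y) 4%N; last by move/(typI_N_neq4 bip Iy); left.
  have [N2|] := eqVneq (arrN (tq_bar y)) 4%N; last by move/(typI_N_neq4 bip Iy'); right.
  by case: noY; exists y.
have [y0 Iy0 N6] : exists2 y0 : arr W, typI y0 & (6 <= arrN y0)%N.
  have [y Iy] := typI_ex bip; case: (big y Iy) => N6; first by exists y.
  by exists (tq_bar y); rewrite ?typI_bar.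
have [|rho Hrho] := uniserial_rep (y := y0) (n := 2); first exact: leq_trans N6.
exact: (big_orbits_not_cluster_tilting bip (quot_wsa_model bip)
  (fun y n => @uniserial_rep _ _ y n) Iy0 N6 Hrho big simpS syz).
Qed.
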